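(* Let $p,r,q\in\mathbb{R}$, $\gamma,\beta,\varepsilon>0$, set $L_\varepsilon=(1+\varepsilon)L$, and let $$w_k=k^p,\qquad \gamma_k=\frac{\gamma}{k^r},\qquad \lambda_k=\max\{\beta k^q,(1+\varepsilon)L\}\qquad(k\in\mathbb{N}).$$ Let $\delta\in\left]0,2/e\right]$ and let $(\bar x_k)_{k\in\mathbb{N}}$ be generated by the Clipped Stochastic subGradient Method (C-SsGM) with these parameters. Then the algorithm converges in high probability provided that $$p>-r,\quad r\in\left]0,1\right[,\quad q\in\left]0,1\right[,\quad q<\frac{r+1}{2},$$ and in such case, with probability greater than $1-\delta$, the following (infinite-horizon) rate holds (i.e., there is a constant independent of $k$ such that for every $k$ the bound holds with probability greater than $1-\delta$): \begin{multline*} f(\bar{x}_k)- \min_{X} f =\mathcal{O} \bigg( \frac{1}{k^{1-r}} +\frac{1}{k^{\min\{p+1, 1-q\}}} + \frac{1}{k^{\min\{p+1, r+1-2q\}}} +\frac{1}{k^{\min\{p+1, \frac 1 2 \}}}\\ +\frac{1}{k^{\min\{p+1, r+ \frac 1 2 - q\}}} + \frac{1}{k^{\min\{p+1, q\}}} +\frac{1}{k^{\min\{p+1, r\}}} \bigg). \end{multline*} Moreover, the optimal choices of $r$ and $q$ in terms of this convergence rate (i.e., those for which the smallest exponent $\min\{1-r,\ p+1,\ 1-q,\ r+1-2q,\ \frac12,\ r+\frac12-q,\ q,\ r\}$ is as large as possible over all triples $(p,r,q)\in\mathbb{R}^3$ satisfying $p>-r$, $r\in\left]0,1\right[$, $q\in\left]0,1\right[$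 and $q<\frac{r+1}{2}$) are $r=1/2$ and $q=1/2$, and with $r=q=1/2$ the following hold. (i) Suppose that $p>-1/2$. Then for every $k\in\mathbb{N}$, with probability at least $1-\delta$, \begin{align*} f(\bar{x}_k)- \min_X f &\leq \frac{\max\{p+1,1\}}{\sqrt{k}} \bigg[ \frac{D^2}{2 \gamma} + \frac 2 3 \bigg( 2 D \max\Big\{\beta, \frac{L_\varepsilon}{k^{\min\{p+ \frac 1 2, \frac 1 2\}}}\Big\} + \gamma \max\Big\{ \beta^2, \frac{L_\varepsilon^2}{k^{\min\{p+\frac 1 2, 1\}}} \Big\} \bigg) \log \frac{2}{\delta}\\ &\quad + \frac{1}{\sqrt{2}} \bigg( 4 \Big(1+ \frac 1 \varepsilon\Big) \frac{D \sigma}{\sqrt{m}} \frac{1}{\min\{2p+1,1\}} + \gamma\, v_p(k)\sqrt{\frac{\sigma^2}{m}+L^2} \bigg) \sqrt{\log \frac{2}{\delta}}\\ &\quad +\frac{1}{\min\{p+ 1/2,1\}} \bigg( \frac{D \sigma^2}{m} \Big( 1 + \frac 1 \varepsilon \Big) \frac 1 \beta +\frac{\gamma}{2} \Big( \frac{\sigma^2}{m} + L^2\Big) \bigg)\bigg], \end{align*} where - if $p>0$: $v_p(k)=\sqrt{\dfrac{2}{\min\{2p,1\}}}\,\max\Big\{\beta,\dfrac{L_\varepsilon}{\sqrt k}\Big\}$; - if $p=0$: $v_p(k)=L_\varepsilon$ when $k<L_\varepsilon^2/\beta^2$, and $v_p(k)=\beta\Big(\dfrac{L_\varepsilon^2/\beta^2}{\sqrt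 k}+1\Big)$ when $k\ge L_\varepsilon^2/\beta^2$; - if $-\frac12<p<0$: $v_p(k)=\dfrac{L_\varepsilon}{k^{p+\frac12}}\sqrt{1-\dfrac1{2p}}+\dfrac{\max\{\beta,L_\varepsilon/\sqrt k\}}{\sqrt{\min\{2p+1,1\}}}$. (ii) Suppose that $p=-1/2$. Then for every $k\in\mathbb{N}$, with probability at least $1-\delta$, \begin{align*} f(\bar{x}_k)- \min_X f &\leq \frac 3 2 \frac{1}{\sqrt{k}} \bigg[ \frac{D^2}{2 \gamma} + \frac 2 3 \Big( 2 D \max\{\beta, L_\varepsilon \} + \gamma \max\{ \beta^2, L_\varepsilon^2 \} \Big) \log \frac{2}{\delta}\\ &\quad + \frac{1}{\sqrt{2}} \bigg( 4 \Big(1+ \frac 1 \varepsilon\Big) \frac{D \sigma}{\sqrt{m}} (1+ \log k) + \gamma\, u(k) \sqrt{\frac{\sigma^2}{m}+L^2} \bigg) \sqrt{\log \frac{2}{\delta}}\\ &\quad + \bigg( \frac{D \sigma^2}{m} \Big( 1 + \frac 1 \varepsilon \Big)\frac 1 \beta +\frac{\gamma}{2} \Big( \frac{\sigma^2}{m} + L^2\Big) \bigg) (1+\log k)\bigg], \end{align*} where $u(k)=\sqrt2\,L_\varepsilon+\beta(1+\log k)$. (iii) (Finite horizon) Let $k\in\mathbb{N}$ and, instead of the infinite-horizon choices $w_i=i^p$, $\gamma_i=\gamma/\sqrt i$, $\lambda_i=\max\{\beta\sqrt i,(1+\varepsilon)L\}$ for all $i\in\mathbb{N}$, run the algorithm with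 $\gamma_i=\gamma/\sqrt k$, $\lambda_i=\max\{\beta\sqrt i,(1+\varepsilon)L\}$ and $w_i=i^p$ for $1\le i\le k$, with $p\ge0$. Then with probability at least $1-\delta$, \begin{align*} f(\bar{x}_k)- \min_X f &\leq \frac{p+1}{\sqrt{k}} \bigg[ \frac{D^2}{2 \gamma} + \frac 2 3 \bigg( 2 D \max\Big\{\beta, \frac{L_\varepsilon}{\sqrt{k}}\Big\} + \gamma \max\Big\{ \beta^2, \frac{L_\varepsilon^2}{k} \Big\} \bigg) \log \frac{2}{\delta}\\ &\quad + \frac{1}{\sqrt{2}} \bigg( 4 \Big(1+ \frac 1 \varepsilon\Big) \frac{D\sigma}{\sqrt{m}} + \gamma\, y_p(k)\sqrt{\frac{\sigma^2}{m}+L^2} \bigg) \sqrt{\log \frac{2}{\delta}}\\ &\quad +\frac{1}{\min\{p+ 1/2,1\}} \frac{D \sigma^2}{m} \Big( 1 + \frac 1 \varepsilon \Big) \frac 1 \beta + \frac{\gamma}{2} \Big( \frac{\sigma^2}{m} + L^2\Big) \bigg], \end{align*} where $y_p(k)=\sqrt2\max\{\beta,L_\varepsilon/\sqrt k\}$.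
   Context: $\mathbb{N}=\{1,2,\dots\}$, $\mathbb{R}_{++}=\left]0,+\infty\right[$, $\log$ is the natural logarithm. ''Converges in high probability'' means that for every $\delta\in\left]0,2/e\right]$ there is a deterministic bound tending to $0$ as $k\to\infty$ which, for each $k$, dominates $f(\bar x_k)-\min_Xf$ with probability at least $1-\delta$. Setting: $H$ is a real Hilbert space with scalar product $\langle\cdot,\cdot\rangle$ and norm $\|\cdot\|$; $X\subset H$ is a nonempty closed convex bounded set with diameter $D\ge 0$, and $P_X$ is the orthogonal projection onto $X$; $f\colon H\to\mathbb{R}$ is convex and Lipschitz continuous with constant $L>0$; $\partial f(x)=\{u\in H : f(y)\ge f(x)+\langle y-x,u\rangle \ \forall y\in H\}$. $\xi$ is a random variable and $\hat u(x,\xi)\in H$ is a stochastic subgradient: for all $x\in X$, $\mathbb{E}[\hat u(x,\xi)]\in\partial f(x)$ and $\mathbb{E}[\|\hat u(x,\xi)-\mathbb{E}[\hat u(x,\xi)]\|^2]\le\sigma^2$. Clipping: for $u\in H$ and $\lambda>0$, $\mathrm{CLIP}(u,\lambda)=u$ if $\|u\|\le\lambda$ and $\mathrm{CLIP}(u,\lambda)=\frac{\lambda}{\|u\|}u$ if $\|u\|>\lambda$. Clipped Stochastic subGradient Method (C-SsGM): given stepsizes $(\gamma_k)_{k\in\mathbb{N}}$, weights $(w_k)_{k\in\mathbb{N}}$ and clipping levels $(\lambda_k)_{k\in\mathbb{N}}$, all in $\mathbb{R}_{++}$, a batch size $m\in\mathbb{N}$, $m\ge1$, and an initial point $x_1\in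 X$, for $k=1,2,\dots$: draw $\boldsymbol{\xi}^k=(\xi^k_j)_{1\le j\le m}$, $m$ independent copies of $\xi$ (also independent of the batches drawn at the previous iterations); set $\bar u_k=\frac1m\sum_{j=1}^m\hat u(x_k,\xi^k_j)$, $\tilde u_k=\mathrm{CLIP}(\bar u_k,\lambda_k)$, $x_{k+1}=P_X(x_k-\gamma_k\tilde u_k)$. The averages are $\bar x_k=\big(\sum_{i=1}^k w_i\big)^{-1}\sum_{i=1}^k w_ix_i$. *)

(* Defs.v *)
From HB Require Import structures.
From mathcomp Require Import all_boot all_order all_algebra.
From mathcomp Require Import finmap.
From mathcomp Require Import all_classical all_reals all_analysis.
Import Order.TTheory GRing.Theory Num.Theory.
Import numFieldNormedType.Exports.

Set Implicit Arguments.
Unset Strict Implicit.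
Unset Printing Implicit Defensive.

Local Open Scope classical_set_scope.
Local Open Scope ring_scope.

Section Hilbert.
Context {R : realType} {H : completeNormedModType R}.

Definition subdifferential (dot : H -> H -> R) (f : H -> R) (x : H) : set H :=
  [set u | forall y, f x + dot (y - x) u <= f y].

(* Junk value 0 when there is no nearest point; for a nonempty closed convex
   subset of a Hilbert space the nearest point exists and is unique. *)
Definition projection (X : set H) (x : H) : H :=
  xget 0 [set p | X p /\ forall y, X y -> `|x - p| <= `|x - y|].

Definition diameter (X : set H) : R :=
  sup [set `|z.1 - z.2| | z in X `*` X].

(* An attained minimum, not an infimum (junk value 0 if it is not attained). *)
Definition min_over (f : H -> R) (X : set H) : R :=
  xget 0 [set v | (f @` X) v /\ lbound (f @` X) v].

Definition clip (u : H) (lam : R) : H :=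
  if `|u| <= lam then u else (lam / `|u|) *: u.

End Hilbert.

(* H-valued expectations are Bochner integrals. *)
Section Bochner.
Context {R : realType} {H : completeNormedModType R}.

Definition simple_fun d (T : measurableType d) (s : T -> H) : Prop :=
  finite_set (range s) /\ forall v, measurable (s @^-1` [set v]).

Context d (T : measurableType d) (P : probability T R).

Definition simple_expectation (s : T -> H) : H :=
  \sum_(v \in range s) fine (P (s @^-1` [set v])) *: v.

Definition is_bochner_expectation (g : T -> H) (e : H) : Prop :=
  exists s : nat -> T -> H,
    [/\ forall n, simple_fun (s n),
        {ae P, forall t, s ^~ t @ \oo --> g t},
        (fun n => \int[P]_t (`|g t - s n t|)%:E)%E @ \oo --> 0%E &
        (fun n => simple_expectation (s n)) @ \oo --> e].

Definition bochner_integrable (g : T -> H) : Prop :=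
  exists e, is_bochner_expectation g e.

Definition bochner_expectation (g : T -> H) : H := xget 0 [set e | is_bochner_expectation g e].

End Bochner.

(* Joint measurability of (x, z) |-> g x z on X x Z. On every separable part of
   X, g is a pointwise limit of simple functions measurable for the product of
   the Borel sigma-algebra of H with that of Z. If H is separable this is plain
   joint Borel measurability of g on X x Z; in the nonseparable case, where sums
   of Borel functions need not be Borel, it does not force the range of g to be
   separable. *)
Definition jointly_measurable {R : realType} {H : completeNormedModType R}
    d (Z : measurableType d) (X : set H) (g : H -> Z -> H) : Prop :=
  forall A : set H, countable A ->
    exists s : nat -> (g_sigma_algebraType (@open H) * Z)%type -> H,
      (forall n, simple_fun (s n)) /\
      (forall x z, X x -> closure A x -> s ^~ (x, z) @ \oo --> g x z).

Section Probability.
Context {R : realType} d (T : measurableType d) (P : probability T R).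

Definition mutually_independent d' (Z : measurableType d') (I : choiceType)
    (D : set I) (Y : I -> T -> Z) : Prop :=
  forall (J : {fset I}) (A : I -> set Z),
    [set` J] `<=` D -> (forall i, i \in J -> measurable (A i)) ->
    P (\bigcap_(i in [set` J]) (Y i @^-1` A i)) =
    (\prod_(i <- J) P (Y i @^-1` A i))%E.

Definition same_law d' (Z : measurableType d') (Y Y' : {RV P >-> Z}) : Prop :=
  forall A, measurable A -> distribution P Y A = distribution P Y' A.

Definition cvg_high_probability (err : nat -> T -> R) : Prop :=
  forall delta : R, 0 < delta -> delta <= 2 / expR 1 ->
    exists b : nat -> R, b @ \oo --> 0 /\
      forall k, (0 < k)%N ->
        ((1 - delta)%:E <= P [set t | (err k t <= b k)%R])%E.

End Probability.

(* Time indices start at 1: the values at index 0 of all sequences below (batches,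
   stepsizes, weights, clipping levels, iterates) are never used. *)
Section CSsGM.
Context {R : realType} {H : completeNormedModType R}.
Context {T Z : Type} (m : nat).

Definition batch_mean (uh : H -> Z -> H) (xi : 'I_m -> T -> Z) (x : T -> H)
    (t : T) : H :=
  m%:R^-1 *: \sum_(j < m) uh (x t) (xi j t).

Definition cssgm (X : set H) (uh : H -> Z -> H) (xi : nat -> 'I_m -> T -> Z)
    (gam lam : nat -> R) (x1 : H) (x : nat -> T -> H) : Prop :=
  (forall t, x 1 t = x1) /\
  forall k, (0 < k)%N -> forall t,
    x k.+1 t =
      projection X (x k t - gam k *: clip (batch_mean uh (xi k) (x k) t) (lam k)).

Definition average (w : nat -> R) (x : nat -> T -> H) (k : nat) (t : T) : H :=
  (\sum_(1 <= i < k.+1) w i)^-1 *: \sum_(1 <= i < k.+1) w i *: x i t.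

End CSsGM.

Section Rates.
Context {R : realType}.
Implicit Types p q r : R.

Definition admissible p r q : Prop :=
  [/\ - r < p, 0 < r < 1, 0 < q < 1 & q < (r + 1) / 2].

Definition rate p r q (k : nat) : R :=
  let K : R := k%:R in
  1 / K `^ (1 - r)
  + 1 / K `^ Num.min (p + 1) (1 - q)
  + 1 / K `^ Num.min (p + 1) (r + 1 - 2 * q)
  + 1 / K `^ Num.min (p + 1) (1 / 2)
  + 1 / K `^ Num.min (p + 1) (r + 1 / 2 - q)
  + 1 / K `^ Num.min (p + 1) q
  + 1 / K `^ Num.min (p + 1) r.

Definition rate_exponent p r q : R :=
  Num.min (1 - r) (Num.min (p + 1) (Num.min (1 - q) (Num.min (r + 1 - 2 * q)
    (Num.min (1 / 2) (Num.min (r + 1 / 2 - q) (Num.min q r)))))).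

(* Leps stands for (1 + eps) * L; only meant for p > - 1/2. *)
Definition vcoef (beta Leps p : R) (k : nat) : R :=
  if 0 < p then
    Num.sqrt (2 / Num.min (2 * p) 1) * Num.max beta (Leps / Num.sqrt k%:R)
  else if p == 0 then
    if k%:R < Leps ^+ 2 / beta ^+ 2 then Leps
    else beta * (Leps ^+ 2 / beta ^+ 2 / Num.sqrt k%:R + 1)
  else
    Leps / k%:R `^ (p + 1 / 2) * Num.sqrt (1 - 1 / (2 * p))
    + Num.max beta (Leps / Num.sqrt k%:R) / Num.sqrt (Num.min (2 * p + 1) 1).

End Rates.

(* Main.v *)
(** Let [b_i] be the clipped batch mean and [xs] a minimizer of [f] on [X].
    Since the projection is nonexpansive and [w_i / gam_i] is nondecreasing,
    the weighted regret is at most [D^2 w_k / (2 gam_k)] plus the sum of the gaps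
      [w_i (f x_i - f xs) + w_i <b_i, xs - x_i> + w_i gam_i |b_i|^2 / 2].
    With [x_i] replaced by a fixed point [x] of [X] and [u] the mean subgradient
    at [x], the subgradient inequality bounds a gap by
      [q = w_i <b_i - u, xs - x> + w_i gam_i |b_i|^2 / 2].
    This [q] is bounded because [b_i] is clipped; its mean comes from the clipping
    bias, of order [|n|^2 / lam_i] for the noise [n], and from [|b_i|^2]; its
    second moment is controlled because clipping brings [b_i] closer to [u].
    A Bernstein estimate bounds the exponential moment of [q] uniformly in [x].
    As [x_i] depends only on the draws before step [i], Fubini's theorem
    multiplies these bounds, and one Chernoff bound on the sum of the gaps gives
    the high probability estimate. What remains are sums of powers, and
    Jensen's inequality to pass from the regret to the averages. *)

Require Import Defs.
From HB Require Import structures.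
From mathcomp Require Import all_boot all_order all_algebra.
From mathcomp Require Import finmap.
From mathcomp Require Import ring lra.
From mathcomp Require Import all_classical all_reals all_analysis.
From mathcomp Require Import measurable_realfun.
Import Order.TTheory GRing.Theory Num.Theory.
Import numFieldNormedType.Exports.

Set Implicit Arguments.
Unset Strict Implicit.
Unset Printing Implicit Defensive.

Local Open Scope classical_set_scope.
Local Open Scope ring_scope.

(** * Hilbert space geometry *)

(** The gaps are dependent and [H] may be nonseparable, so no conditional expectation is formed: the
    new batch is integrated with the past frozen, and a bound that holds at every point of [X]
    leaves the integral as a constant. This needs a gap that is measurable in the iterate, whereas
    the measurability of the mean subgradient in [x] is not established. Hence the gap keeps
    [f x_i - f xs], and the mean subgradient enters only through [q], at a fixed point.

    Gaps are not centred: their means, with the clipping bias, are carried through the exponential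
    estimate. Levels [lam_i >= (1 + eps) L] exceed the norm of every mean subgradient by a fixed
    fraction of themselves, whence the factor [1 + 1 / eps]. Bernstein's estimate uses an upper
    bound of [q] minus its mean, of order [D lam + g lam^2], and its second moment; L2 norms are
    added by Minkowski's inequality, inside a step and then over the steps. One tail is estimated,
    so [log (2 / delta)] gives probability [1 - delta / 2]. *)

Section InnerProduct.
Context {R : realType} {H : completeNormedModType R} (dot : {dot H for idfun}).
Hypothesis dotE : forall x : H, dot x x = `|x| ^+ 2.
Implicit Types x y z : H.

Lemma dotC x y : dot x y = dot y x.
Proof. by rewrite hermC expr0 mul1r. Qed.

Lemma dotDl x y z : dot (x + y) z = dot x z + dot y z.
Proof. by rewrite linearDl. Qed.
Lemma dotDr x y z : dot z (x + y) = dot z x + dot z y.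
Proof. by rewrite linearDr. Qed.
Lemma dotNl x z : dot (- x) z = - dot x z.
Proof. by rewrite linearNl. Qed.
Lemma dotNr x z : dot z (- x) = - dot z x.
Proof. by rewrite linearNr. Qed.
Lemma dotZl a x z : dot (a *: x) z = a * dot x z.
Proof. by rewrite linearZl_LR. Qed.
Lemma dotZr a x z : dot z (a *: x) = a * dot z x.
Proof. by rewrite linearZr_LR. Qed.
Lemma dot0l z : dot 0 z = 0.
Proof. by rewrite linear0l. Qed.
Lemma dot0r z : dot z 0 = 0.
Proof. by rewrite linear0r. Qed.

Definition dot_simp := (dotDl, dotDr, dotNl, dotNr, dotZl, dotZr).

Lemma normD_sqr x y : `|x + y| ^+ 2 = `|x| ^+ 2 + 2 * dot x y + `|y| ^+ 2.
Proof. by rewrite -!dotE !dot_simp (dotC y x); ring. Qed.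

Lemma normB_sqr x y : `|x - y| ^+ 2 = `|x| ^+ 2 - 2 * dot x y + `|y| ^+ 2.
Proof. by rewrite -!dotE !dot_simp (dotC y x); ring. Qed.

Lemma cauchy_schwarz x y : dot x y <= `|x| * `|y|.
Proof.
have [->|x0] := eqVneq x 0; first by rewrite dot0l normr0 mul0r.
have [->|y0] := eqVneq y 0; first by rewrite dot0r normr0 mulr0.
have xp : 0 < `|x| by rewrite normr_gt0.
have yp : 0 < `|y| by rewrite normr_gt0.
have := sqr_ge0 `| `|y| *: x - `|x| *: y |.
rewrite normB_sqr !normrZ !normr_id !dot_simp.
have : 0 < `|x| * `|y| by exact: mulr_gt0.
move=> xy; have -> : (`|y| * `|x|) ^+ 2 - 2 * (`|y| * (`|x| * dot x y)) +
  (`|x| * `|y|) ^+ 2 = (2 * (`|x| * `|y|)) * (`|x| * `|y| - dot x y) by ring.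
by rewrite pmulr_rge0 ?subr_ge0// mulr_gt0.
Qed.

Lemma cauchy_schwarz_norm x y : `|dot x y| <= `|x| * `|y|.
Proof.
rewrite ler_norml cauchy_schwarz andbT lerNl -dotNl -(normrN x).
exact: cauchy_schwarz.
Qed.

Lemma dot_sqr_le x y : dot x y ^+ 2 <= `|x| ^+ 2 * `|y| ^+ 2.
Proof.
by rewrite -exprMn -(real_normK (num_real (dot x y))) lerXn2r ?nnegrE ?mulr_ge0//
  cauchy_schwarz_norm.
Qed.

Lemma parallelogram x y :
  `|x - y| ^+ 2 = 2 * `|x| ^+ 2 + 2 * `|y| ^+ 2 - `|x + y| ^+ 2.
Proof. by rewrite normB_sqr normD_sqr; ring. Qed.

End InnerProduct.

(** * Attained minima on closed bounded convex sets *)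

Section ConvexMinimization.
Context {R : realType} {H : completeNormedModType R} (dot : {dot H for idfun}).
Hypothesis dotE : forall x : H, dot x x = `|x| ^+ 2.

Definition midpoint_closed (C : set H) : Prop :=
  forall x y, C x -> C y -> C (2^-1 *: (x + y)).

(* This replaces weak compactness: by the parallelogram law, points of almost
   minimal norm in [C n] form a Cauchy sequence. *)
Lemma nested_midpoint_closed_nonempty (C : nat -> set H) (B : R) :
  (forall n, C n !=set0) -> (forall n, closed (C n)) ->
  (forall n, midpoint_closed (C n)) ->
  (forall n m, (n <= m)%N -> C m `<=` C n) ->
  (forall x, C 0 x -> `|x| <= B) -> exists z, forall n, C n z.
Proof.
move=> C0 Ccl Cmid Cmono CB.
pose N n : set R := [set `|x| ^+ 2 | x in C n].
have Nlb n : has_lbound (N n) by exists 0 => _ [x _ <-]; exact: sqr_ge0.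
have Nne n : N n !=set0 by have [x Cx] := C0 n; exists (`|x| ^+ 2); exists x.
pose d n := inf (N n).
have d_le n x : C n x -> d n <= `|x| ^+ 2 by move=> Cx; apply: ge_inf => //; exists x.
have dmono n m : (n <= m)%N -> d n <= d m.
  move=> nm; apply: lb_le_inf => // _ [x Cx <-]; apply: d_le.
  exact: Cmono Cx.
have /choice[z zP] n : exists z, C n z /\ `|z| ^+ 2 < d n + n.+1%:R^-1.
  have [||_ [z Cz <-] ze] := @inf_adherent _ (N n) n.+1%:R^-1; rewrite ?invr_gt0//.
  by exists z.
have dub : has_ubound (range d).
  exists (B ^+ 2) => _ [n _ <-]; have [x Cx] := C0 n.
  apply: le_trans (d_le _ _ Cx) _; have := CB _ (Cmono _ _ (leq0n n) _ Cx).
  by move=> xB; rewrite lerXn2r ?nnegrE// (le_trans _ xB).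
have close n m : (n <= m)%N ->
    `|z n - z m| ^+ 2 <= 2 * (d m - d n) + 4 * n.+1%:R^-1.
  move=> nm; have [Cn zn] := zP n; have [Cm zm] := zP m.
  (* The midpoint of [z n] and [z m] lies in [C n], so [|z n + z m|^2 / 4 >= d n]; the parallelogram
     law turns this into a bound on the distance. *)
  have := d_le _ _ (Cmid n _ _ Cn (Cmono _ _ nm _ Cm)).
  rewrite normrZ gtr0_norm ?invr_gt0// exprMn (parallelogram dotE) => dl.
  have : m.+1%:R^-1 <= n.+1%:R^-1 :> R by rewrite lef_pV2 ?posrE// ler_nat.
  have h4 : 2^-1 ^+ 2 = 1 / 4 :> R by field.
  move: dl zn zm; rewrite h4; move: (`|z n + z m| ^+ 2) (`|z n| ^+ 2) (`|z m| ^+ 2) => s a b.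
  move: n.+1%:R^-1 m.+1%:R^-1 => en em; lra.
have : cauchy (z @ \oo).
  apply/cauchy_ballP => e e0.
  (* With [d m - d n] and [1 / (n + 1)] below [e^2 / 32], the bound of [close] is at most
     [(2 + 4) e^2 / 32 < (e / 2)^2]. *)
  have e2 : 0 < e ^+ 2 / 32 by rewrite divr_gt0// exprn_gt0.
  have [|_ [n1 _ <-] dn1] := @sup_adherent _ (range d) _ e2.
    by split=> //; exists (d 0); exists 0%N.
  have [n2 _ n2P] := near_infty_natSinv_lt (PosNum e2).
  pose n0 := maxn n1 n2.
  have far m : (n0 <= m)%N -> `|z n0 - z m| < e / 2.
    move=> nm; rewrite -(@ltr_pXn2r _ 2) ?nnegrE ?divr_ge0// ?(ltW e0)//.
    have := close _ _ nm; have /= := n2P n0 (leq_maxr _ _); move: n0.+1%:R^-1 => en.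
    have : d n1 <= d n0 by apply: dmono; rewrite leq_maxl.
    have : d m <= sup (range d) by apply: ub_le_sup => //; exists m.
    have -> : (e / 2) ^+ 2 = e ^+ 2 / 4 by field.
    have e2' := e2; move: dn1 e2'; move: (`|z n0 - z m| ^+ 2) (e ^+ 2) => a b; lra.
  have near0 : \forall m \near \oo, `|z n0 - z m| < e / 2.
    by exists n0 => // m /= /far.
  exists ([set y | `|z n0 - y| < e / 2], [set y | `|z n0 - y| < e / 2]).
    by split; exact: near0.
  move=> [a b] /= [za zb]; rewrite -ball_normE /ball_/=.
  by rewrite (splitr e) (le_lt_trans (ler_distD (z n0) _ _))// ltrD// distrC.
move=> /cauchy_cvg zc; exists (lim (z @ \oo)) => n.
apply: (closed_cvg (C n) (Ccl n) _ _ zc).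
by exists n => // m /= nm; apply: Cmono nm _ _; have [] := zP m.
Qed.

(** The sublevel sets at heights [inf + 1 / (n + 1)] are nested, closed and stable under midpoints,
    so they share a point. It serves twice: for the distance to a point (projection) and for [f]
    (minimizer). *)
Lemma quasiconvex_attains_min (X : set H) (B : R) (g : H -> R) :
  X !=set0 -> closed X -> midpoint_closed X -> (forall x, X x -> `|x| <= B) ->
  continuous g -> has_lbound (g @` X) ->
  (forall x y a, g x <= a -> g y <= a -> g (2^-1 *: (x + y)) <= a) ->
  exists2 z, X z & forall y, X y -> g z <= g y.
Proof.
move=> [x0 Xx0] Xcl Xmid XB gc glb gq.
pose i := inf (g @` X).
have i_le y : X y -> i <= g y by move=> Xy; apply: ge_inf => //; exists y.
pose C n := X `&` [set y | g y <= i + n.+1%:R^-1].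
have [||||y [Xy _]|z zP] := @nested_midpoint_closed_nonempty C B.
- move=> n; have [||_ [y Xy <-] /ltW ylt] := @inf_adherent _ (g @` X) n.+1%:R^-1.
  + by rewrite invr_gt0.
  + by split=> //; exists (g x0); exists x0.
  + by exists y.
- move=> n; apply: closedI => //.
  have := @preimage_closed _ _ g [set r | r <= i + n.+1%:R^-1].
  apply; last exact: closed_le.
  by move=> x _; exact: gc.
- by move=> n x y [Xx gx] [Xy gy]; split; [exact: Xmid | exact: gq].
- move=> n m nm y [Xy /= gy]; split => //=; apply: le_trans gy _.
  by rewrite lerD2l lef_pV2 ?posrE// ler_nat.
- exact: XB.
exists z; first by have [] := zP 0%N.
move=> y Xy; apply: le_trans (i_le _ Xy); apply/ler_addgt0Pr => e e0.
have [n _ /(_ n (leqnn n))/= nP] := near_infty_natSinv_lt (PosNum e0).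
by have [_ /= /le_trans] := zP n; apply; rewrite lerD2l ltW.
Qed.

End ConvexMinimization.

Section ConvexSets.
Context {R : realType} {H : completeNormedModType R}.

Lemma convex_setP (X : set H) x y t : convex_set X -> X x -> X y ->
  0 <= t <= 1 -> X (t *: x + (1 - t) *: y).
Proof.
move=> Xc Xx Xy /andP[t0 t1].
have := Xc x y (Itv01 t0 t1); rewrite !inE; exact.
Qed.

Lemma convex_functionP (f : H -> R) x y t : convex_function [set: H] f ->
  0 <= t <= 1 -> f (t *: x + (1 - t) *: y) <= t * f x + (1 - t) * f y.
Proof.
move=> fc /andP[t0 t1].
by have := fc (Itv01 t0 t1) x y; rewrite !inE; apply.
Qed.

Lemma midpointE (x y : H) : 2^-1 *: (x + y) = 2^-1 *: x + (1 - 2^-1) *: y.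
Proof. by rewrite scalerDr; congr (_ + _ *: _); field. Qed.

Lemma half_itv : 0 <= (2^-1 : R) <= 1.
Proof. by apply/andP; split; lra. Qed.

Lemma convex_set_midpoint (X : set H) : convex_set X -> midpoint_closed X.
Proof. by move=> Xc x y Xx Xy; rewrite midpointE; apply: convex_setP => //; exact: half_itv. Qed.

Lemma convex_function_midpoint (f : H -> R) x y a : convex_function [set: H] f ->
  f x <= a -> f y <= a -> f (2^-1 *: (x + y)) <= a.
Proof.
move=> fc fx fy; rewrite midpointE.
by apply: le_trans (convex_functionP _ _ fc half_itv) _; lra.
Qed.

Lemma jensen_average (T : Type) (f : H -> R) (w : nat -> R) (x : nat -> T -> H) k t :
  convex_function [set: H] f -> (forall i, (0 < i)%N -> 0 < w i) -> (0 < k)%N ->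
  f (average w x k t) <=
    (\sum_(1 <= i < k.+1) w i)^-1 * \sum_(1 <= i < k.+1) w i * f (x i t).
Proof.
move=> fc w0; case: k => // k _; elim: k => [|k ih].
  rewrite /average !big_nat1 scalerA mulrA mulVf ?scale1r ?mul1r// gt_eqF//.
  exact: w0.
have Wp n : 0 < \sum_(1 <= i < n.+2) w i.
  by rewrite big_nat_recl//= ltr_pwDl ?w0// big_nat sumr_ge0// => i /andP[i0 _]; rewrite ltW// w0.
move: ih; rewrite /average !(@big_nat_recr _ _ _ k.+2)//=.
set W := \sum_(1 <= i < k.+2) w i; set S := \sum_(1 <= i < k.+2) w i *: x i t.
set F := \sum_(1 <= i < k.+2) w i * f (x i t); set v := w k.+2; set y := x k.+2 t.
have W0 : 0 < W := Wp k; have v0 : 0 < v by exact: w0.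
have Wv : 0 < W + v by exact: addr_gt0.
move=> ih.
(* The new average is a convex combination of the old one, with weight [W / (W + v)], and of the new
   point. *)
have -> : (W + v)^-1 *: (S + v *: y) =
    (W / (W + v)) *: (W^-1 *: S) + (1 - W / (W + v)) *: y.
  rewrite scalerDr !scalerA; congr (_ *: _ + _ *: _); field.
    by rewrite !gt_eqF.
  by rewrite gt_eqF.
apply: le_trans (convex_functionP _ _ fc _) _.
  by rewrite divr_ge0 ?(ltW W0) ?(ltW Wv)//= ler_pdivrMr// mul1r lerDl ltW.
rewrite mulrDr lerD//.
  apply: (@le_trans _ _ (W / (W + v) * (W^-1 * F))).
    by rewrite ler_wpM2l// divr_ge0// ltW.
  by rewrite mulrA le_eqVlt; apply/orP; left; apply/eqP; congr (_ * _); field; rewrite !gt_eqF.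
rewrite mulrA le_eqVlt; apply/orP; left; apply/eqP; congr (_ * _); field.
by rewrite gt_eqF.
Qed.

End ConvexSets.

(** * Projection onto a closed bounded convex set *)

Section Projection.
Context {R : realType} {H : completeNormedModType R} (dot : {dot H for idfun}).
Hypothesis dotE : forall x : H, dot x x = `|x| ^+ 2.
Variable X : set H.
Hypotheses (X0 : X !=set0) (Xclosed : closed X) (Xconvex : convex_set X)
  (Xbounded : bounded_set X).

Lemma bounded_set_bound : exists B, forall x, X x -> `|x| <= B.
Proof.
case: Xbounded => M [_ /(_ (M + 1))]; rewrite ltrDl ltr01 => /(_ isT) MP.
by exists (M + 1) => x /MP.
Qed.

Lemma lipschitz_continuous (g : H -> R) (L : R) :
  (forall x y, `|g x - g y| <= L * `|x - y|) -> continuous g.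
Proof.
move=> gL x; apply/cvgrPdist_lt => e e0; near=> y.
apply: le_lt_trans (gL _ _) _.
have L1 : 0 < `|L| + 1 by rewrite ltr_wpDl.
apply: (@le_lt_trans _ _ ((`|L| + 1) * `|x - y|)).
  by rewrite ler_wpM2r// (le_trans (ler_norm _))// lerDl.
rewrite mulrC -ltr_pdivlMr//; near: y.
by apply: cvgr_dist_lt => //; exact: divr_gt0.
Unshelve. all: by end_near. Qed.

Lemma projection_exists x : exists p, X p /\ forall y, X y -> `|x - p| <= `|x - y|.
Proof.
have [B XB] := bounded_set_bound.
have [|||||p Xp pP] := @quasiconvex_attains_min _ _ _ dotE X B (fun y => `|x - y|) X0 Xclosed.
- exact: convex_set_midpoint.
- exact: XB.
- apply: (@lipschitz_continuous _ 1) => y z; rewrite mul1r.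
  apply: le_trans (ler_dist_dist _ _) _.
  by rewrite opprB [x - y + _]addrC subrKA distrC.
- by exists 0 => _ [y _ <-].
- move=> y z a ya za; have -> : x - 2^-1 *: (y + z) = 2^-1 *: ((x - y) + (x - z)).
    rewrite !scalerDr !scalerN addrACA -scalerDl -opprD; congr (_ + _).
    by rewrite -[LHS]scale1r; congr (_ *: _); field.
  rewrite normrZ gtr0_norm ?invr_gt0//.
  have := ler_normD (x - y) (x - z); move: ya za; lra.
by exists p.
Qed.

Lemma projection_spec x :
  X (projection X x) /\ forall y, X y -> `|x - projection X x| <= `|x - y|.
Proof.
by rewrite /projection; case: xgetP => [p _ //|no]; have [p /no] := projection_exists x.
Qed.

Lemma projection_in x : X (projection X x). Proof. by have [] := projection_spec x. Qed.

Lemma projection_variational x y : X y ->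
  dot (x - projection X x) (y - projection X x) <= 0.
Proof.
move=> Xy; have [Xp pP] := projection_spec x; set p := projection X x in Xp pP *.
set a := dot _ _; pose b := `|y - p| ^+ 2.
have ht t : 0 < t -> t <= 1 -> 2 * a <= t * b.
  move=> t0 t1; have := pP _ (@convex_setP _ _ X y p t Xconvex Xy Xp _).
  rewrite (ltW t0) t1 => /(_ isT).
  have -> : x - (t *: y + (1 - t) *: p) = (x - p) - t *: (y - p).
    rewrite scalerBl scale1r scalerBr !opprD !opprK.
    by rewrite [X in x + X]addrCA [LHS]addrA.
  move=> h0; have h : `|x - p| ^+ 2 <= `|x - p - t *: (y - p)| ^+ 2.
    by rewrite lerXn2r// ?nnegrE.
  move: h; rewrite [leRHS](normB_sqr dotE) dotZr normrZ exprMn.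
  rewrite -/a real_normK ?num_real// -/b => h.
  have : t * (2 * a) <= t * (t * b) by move: h; nra.
  by rewrite ler_pM2l.
have b0 : 0 <= b by exact: sqr_ge0.
rewrite leNgt; apply/negP => a0.
(* If [a > 0], this choice of [t] gives [t * b <= a], against [2 * a <= t * b]. The [+ 1] covers
   [b = 0]. *)
have := ht (Num.min 1 (a / (b + 1))); rewrite lt_min ltr01 ge_min lexx/=.
rewrite divr_gt0 ?ltr_wpDl// => /(_ isT isT).
have : Num.min 1 (a / (b + 1)) * b <= a.
  apply: (@le_trans _ _ (a / (b + 1) * b)); first by rewrite ler_wpM2r// ge_min lexx orbT.
  by rewrite mulrAC ler_pdivrMr ?ltr_wpDl// ler_wpM2l ?(ltW a0)// lerDl.
move: a0; lra.
Qed.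

Lemma projection_nonexpansive x y : `|projection X x - projection X y| <= `|x - y|.
Proof.
set p := projection X x; set q := projection X y.
have h1 : dot (x - p) (q - p) <= 0 by apply: projection_variational; exact: projection_in.
have h2 : dot (y - q) (p - q) <= 0 by apply: projection_variational; exact: projection_in.
(* Firm nonexpansiveness: the sum of the two variational inequalities. *)
have h3 : `|p - q| ^+ 2 <= dot (x - y) (p - q).
  move: h1 h2; rewrite -dotE !dot_simp; rewrite !(dotC dot q p); lra.
have h4 := cauchy_schwarz dotE (x - y) (p - q).
have [->|pq] := eqVneq `|p - q| 0; first by [].
have pq0 : 0 < `|p - q| by rewrite lt_def pq/=.
rewrite -(ler_pM2r pq0) -expr2; exact: le_trans h3 h4.
Qed.

Lemma projection_continuous : continuous (projection X).
Proof.
move=> x; apply/cvgrPdist_lt => e e0; near=> y.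
apply: le_lt_trans (projection_nonexpansive _ _) _.
by near: y; apply: cvgr_dist_lt.
Unshelve. all: by end_near. Qed.

Lemma projection_id x : X x -> projection X x = x.
Proof.
move=> Xx; have [_ /(_ _ Xx)] := projection_spec x.
by rewrite subrr normr0 normr_le0 subr_eq0 => /eqP.
Qed.

Lemma projection_dist x y : X y -> `|projection X x - y| <= `|x - y|.
Proof. by move=> Xy; rewrite -{1}(projection_id Xy); exact: projection_nonexpansive. Qed.

Lemma diameterP x y : X x -> X y -> `|x - y| <= diameter X.
Proof.
move=> Xx Xy; have [B XB] := bounded_set_bound.
apply: ub_le_sup; last by exists (x, y).
exists (B + B) => _ [[a b] [/= Xa Xb] <-].
by rewrite (le_trans (ler_normB _ _))// lerD// XB.
Qed.

Lemma diameter_ge0 : 0 <= diameter X.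
Proof. by case: X0 => x Xx; have := diameterP Xx Xx; rewrite subrr normr0. Qed.

(** Rules out the junk value of [min_over] and supplies the comparison point [xs] of the regret. *)
Lemma min_over_attained (f : H -> R) (L : R) : convex_function [set: H] f ->
  (forall x y, `|f x - f y| <= L * `|x - y|) ->
  exists2 z, X z & f z = min_over f X.
Proof.
move=> fc fL; have [B XB] := bounded_set_bound; have [x0 Xx0] := X0.
have [|||||z Xz zP] := @quasiconvex_attains_min _ _ _ dotE X B f X0 Xclosed.
- exact: convex_set_midpoint.
- exact: XB.
- exact: lipschitz_continuous fL.
- exists (f x0 - `|L| * diameter X) => _ [y Xy <-].
  rewrite lerBlDr -lerBlDl; apply: le_trans (ler_norm _) _.
  apply: le_trans (fL _ _) _; apply: (@le_trans _ _ (`|L| * `|x0 - y|)).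
    by rewrite ler_wpM2r// ler_norm.
  by rewrite ler_wpM2l// diameterP.
- by move=> x y a; exact: convex_function_midpoint.
rewrite /min_over; case: xgetP => [v _ [[y Xy <-] lb]|no].
  by exists y.
by case: (no (f z)); split; [exists z|move=> _ [y Xy <-]; exact: zP].
Qed.

End Projection.

(** * Clipping: distance and bias *)

Section Clipping.
Context {R : realType} {H : completeNormedModType R} (dot : {dot H for idfun}).
Hypothesis dotE : forall x : H, dot x x = `|x| ^+ 2.
Variable lam : R.
Hypothesis lam0 : 0 < lam.
Implicit Types u v : H.

(** A formula without case distinction, from which continuity of clipping can be read off. *)
Lemma clipE u : clip u lam = (lam / Num.max lam `|u|) *: u.
Proof.
rewrite /clip; case: (leP `|u| lam) => // _.
by rewrite divff ?scale1r// gt_eqF.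
Qed.

Lemma clip_continuous : continuous (fun u => clip u lam).
Proof.
have -> : (fun u => clip u lam) = (fun u => (lam / Num.max lam `|u|) *: u).
  by apply/funext => u; exact: clipE.
move=> u; apply: cvgZ; last exact: cvg_id.
apply: cvgM; first exact: cvg_cst.
apply: cvgV; first by rewrite gt_eqF// lt_max lam0.
by apply: (@continuous_max _ _ (fun=> lam) (fun v : H => `|v|) u);
  [exact: cst_continuous|exact: norm_continuous].
Qed.

Lemma norm_clip u : `|clip u lam| <= lam.
Proof.
rewrite /clip; case: (leP `|u| lam) => // lu.
have u0 : 0 < `|u| by exact: lt_trans lam0 lu.
by rewrite normrZ normrM normfV normr_id divfK ?gt_eqF// gtr0_norm.
Qed.

(** Clipping is the projection onto the ball of radius [lam], and [v] lies in that ball. Used with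
    [v] the mean subgradient, to compare clipped noise with noise, and with [v = 0]. *)
Lemma clip_dist u v : `|v| <= lam -> `|clip u lam - v| ^+ 2 <= `|u - v| ^+ 2.
Proof.
move=> vl; rewrite /clip; case: (leP `|u| lam) => // lu.
have u0 : 0 < `|u| by exact: lt_trans lam0 lu.
rewrite !(normB_sqr dotE) normrZ normrM normfV normr_id divfK ?gt_eqF//.
rewrite gtr0_norm// dotZl.
have cs := cauchy_schwarz dotE u v.
have : (1 - lam / `|u|) * dot u v <= (1 - lam / `|u|) * (`|u| * lam).
  apply: ler_wpM2l; first by rewrite subr_ge0 ler_pdivrMr// mul1r ltW.
  by apply: le_trans cs _; rewrite ler_wpM2l.
have -> : (1 - lam / `|u|) * (`|u| * lam) = (`|u| - lam) * lam.
  by field; rewrite gt_eqF.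
rewrite mulrBl mul1r; move: (lam / `|u| * dot u v) => c; nra.
Qed.

(** With [a = |u - v|] and [b = lam - |v|], the part cut off has length at most [a - b], and
    [4 b (a - b) <= a^2] because [(a - 2 b)^2 >= 0]. A quadratic bound makes the bias of order
    variance over level. *)
Lemma clip_bias u v : `|v| < lam ->
  `|clip u lam - u| <= `|u - v| ^+ 2 / (4 * (lam - `|v|)).
Proof.
move=> vl; have b0 : 0 < lam - `|v| by rewrite subr_gt0.
rewrite /clip; case: (leP `|u| lam) => [ul|lu].
  by rewrite subrr normr0 divr_ge0// mulr_ge0// ltW.
have u0 : 0 < `|u| by exact: lt_trans lam0 lu.
have -> : (lam / `|u|) *: u - u = - ((1 - lam / `|u|) *: u).
  by rewrite scalerBl scale1r opprB.
rewrite normrN normrZ ger0_norm; last by rewrite subr_ge0 ler_pdivrMr// mul1r ltW.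
rewrite mulrBl mul1r divfK ?gt_eqF// ler_pdivlMr ?mulr_gt0//.
have := lerB_dist u v; move: (`|u - v|) => a ha.
have : 0 <= (a - 2 * (lam - `|v|)) ^+ 2 by exact: sqr_ge0.
have : (`|u| - lam) * (4 * (lam - `|v|)) <= (a - (lam - `|v|)) * (4 * (lam - `|v|)).
  by rewrite ler_wpM2r ?mulr_ge0 ?(ltW b0)//; move: ha; lra.
move=> h1 h2; apply: le_trans h1 _; move: h2; nra.
Qed.

End Clipping.

(** Test the subgradient inequality at [x + u]: [|u|^2 <= f (x + u) - f x <= L |u|]. *)
Lemma subgradient_norm {R : realType} {H : completeNormedModType R}
    (dot : {dot H for idfun}) (f : H -> R) (L : R) x u :
  0 <= L -> (forall x : H, dot x x = `|x| ^+ 2) ->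
  (forall x y, `|f x - f y| <= L * `|x - y|) ->
  subdifferential dot f x u -> `|u| <= L.
Proof.
move=> L0 dotE fL /(_ (x + u)); rewrite addrAC subrr add0r dotE => h.
have := fL (x + u) x; rewrite addrAC subrr add0r => /(le_trans (ler_norm _)) h2.
have [->|u0] := eqVneq u 0; first by rewrite normr0.
by rewrite -(@ler_pM2r _ `|u|) ?normr_gt0// -expr2; move: h h2; lra.
Qed.

(** * Measurability and independence *)

Section StrongMeasurability.
Context {R : realType} {H : completeNormedModType R}.

(* [H] need not be separable, and Borel measurability would not be stable under
   addition. *)
Definition strongly_measurable d (T : measurableType d) (g : T -> H) : Prop :=
  exists s : nat -> T -> H,
    (forall n, simple_fun (s n)) /\ forall t, s ^~ t @ \oo --> g t.

Lemma simple_fun_preimage d (T : measurableType d) (s : T -> H) (B : set H) :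
  simple_fun s -> measurable (s @^-1` B).
Proof.
move=> [sfin sm].
have -> : s @^-1` B = \bigcup_(v in range s `&` B) (s @^-1` [set v]).
  apply/seteqP; split=> [t Bt|t [v [_ Bv] /= ->]//].
  by exists (s t) => //; split.
apply: fin_bigcup_measurable => [|v _]; last exact: sm.
exact: finite_setIl.
Qed.

Lemma simple_fun_comp d (T : measurableType d) d' (T' : measurableType d')
    (s : T' -> H) (h : T -> T') :
  measurable_fun setT h -> simple_fun s -> simple_fun (s \o h).
Proof.
move=> mh [sfin sm]; split.
  by apply: sub_finite_set sfin => _ [t _ <-]; exists (h t).
by move=> v; have := mh measurableT _ (sm v); rewrite setTI.
Qed.

Lemma simple_fun_map d (T : measurableType d) (s : T -> H) (F : H -> H) :
  simple_fun s -> simple_fun (F \o s).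
Proof.
move=> ss; split; last first.
  by move=> v; rewrite comp_preimage; exact: simple_fun_preimage.
have [sfin _] := ss; apply: sub_finite_set (finite_image F sfin).
by move=> _ [t _ <-]; exists (s t) => //; exists t.
Qed.

Lemma simple_funD d (T : measurableType d) (s s' : T -> H) :
  simple_fun s -> simple_fun s' -> simple_fun (fun t => s t + s' t).
Proof.
move=> ss ss'; have [sfin sm] := ss; have [sfin' sm'] := ss'.
have fin : finite_set (range (fun t => s t + s' t)).
  apply: sub_finite_set (finite_image2 (fun x y => x + y) sfin sfin').
  by move=> _ [t _ <-]; exists (s t); [by exists t|exists (s' t); [exists t|]].
split=> // v.
have -> : (fun t => s t + s' t) @^-1` [set v] =
    \bigcup_(a in range s) (s @^-1` [set a] `&` s' @^-1` [set v - a]).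
  apply/seteqP; split=> [t /= st|t [a _ [/= -> ->]]]; last by rewrite addrC subrK.
  by exists (s t) => //; split=> //=; rewrite -st addrAC subrr add0r.
by apply: fin_bigcup_measurable => // a _; apply: measurableI.
Qed.

Lemma simple_fun_measurable d (T : measurableType d) d' (Y : measurableType d')
    (s : T -> H) (F : H -> Y) : simple_fun s -> measurable_fun setT (F \o s).
Proof.
move=> ss _ B _; rewrite setTI comp_preimage; exact: simple_fun_preimage.
Qed.

Section Closure.
Context d (T : measurableType d).
Implicit Types g : T -> H.

Lemma strongly_measurable_cst (v : H) : strongly_measurable (fun _ : T => v).
Proof.
exists (fun _ _ => v); split=> [n|t]; last exact: cvg_cst.
split=> [|u]; first by apply: sub_finite_set (finite_set1 v) => _ [t _ <-].
rewrite preimage_cst; case: ifP => _; exact: measurableT || exact: measurable0.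
Qed.

Lemma strongly_measurableD g g' : strongly_measurable g -> strongly_measurable g' ->
  strongly_measurable (fun t => g t + g' t).
Proof.
move=> [s [ss sg]] [s' [ss' sg']]; exists (fun n t => s n t + s' n t).
by split=> [n|t]; [exact: simple_funD|exact: cvgD].
Qed.

Lemma strongly_measurable_continuous g (F : H -> H) : continuous F ->
  strongly_measurable g -> strongly_measurable (F \o g).
Proof.
move=> Fc [s [ss sg]]; exists (fun n => F \o s n).
by split=> [n|t]; [exact: simple_fun_map|exact: (continuous_cvg _ (Fc _) (sg t))].
Qed.

Lemma strongly_measurableZ g (a : R) : strongly_measurable g ->
  strongly_measurable (fun t => a *: g t).
Proof.
by apply: strongly_measurable_continuous; exact: scaler_continuous.
Qed.

Lemma strongly_measurableB g g' : strongly_measurable g -> strongly_measurable g' ->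
  strongly_measurable (fun t => g t - g' t).
Proof.
move=> mg mg'; apply: strongly_measurableD => //.
by apply: (strongly_measurable_continuous _ mg') => v; apply: cvgN; exact: cvg_id.
Qed.

Lemma strongly_measurable_sum (I : Type) (r : seq I) (P : pred I) (g : I -> T -> H) :
  (forall i, P i -> strongly_measurable (g i)) ->
  strongly_measurable (fun t => \sum_(i <- r | P i) g i t).
Proof.
move=> mg; elim: r => [|i r ih].
  by under eq_fun do rewrite big_nil; exact: strongly_measurable_cst.
under eq_fun do rewrite big_cons.
by case: (boolP (P i)) => Pi //; apply: strongly_measurableD => //; exact: mg.
Qed.

Lemma strongly_measurable_real g (F : H -> R) : continuous F ->
  strongly_measurable g -> measurable_fun setT (F \o g).
Proof.
move=> Fc [s [ss sg]].
apply: (@measurable_fun_cvg _ _ _ setT (fun n => F \o s n)) => [n|t _].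
  exact: simple_fun_measurable.
exact: (continuous_cvg _ (Fc _) (sg t)).
Qed.

Lemma strongly_measurable_norm g : strongly_measurable g ->
  measurable_fun setT (fun t => `|g t|).
Proof. by apply: strongly_measurable_real; exact: norm_continuous. Qed.

Lemma strongly_measurable_borel g : strongly_measurable g ->
  measurable_fun setT (g : T -> g_sigma_algebraType (@open H)).
Proof.
move=> [s [ss sg]]; apply: (@measurability _ _ T (g_sigma_algebraType (@open H)) setT g (@open H)) => //.
move=> _ [U Uo <-]; rewrite setTI.
(* [g t] is in [U] iff, for some radius [1 / (j + 1)], the balls around [s n t] are eventually
   contained in [U]; each condition on [s n] alone is measurable since [s n] is simple. *)
have -> : g @^-1` U = \bigcup_j \bigcup_N \bigcap_(n in [set n | (N <= n)%N])
    (s n @^-1` [set v | ball v j.+1%:R^-1 `<=` U]).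
  apply/seteqP; split=> t /=.
    move=> Ugt; have /nbhs_ballP[e /= e0 eU] := open_nbhs_nbhs (conj Uo Ugt).
    have e20 : 0 < e / 2 by rewrite divr_gt0.
    have [j _ /(_ j (leqnn j))/= je] := near_infty_natSinv_lt (PosNum e20).
    have /cvgrPdist_lt/(_ _ e20)[N _ Nn] := sg t.
    exists j => //; exists N => // n Nn' v; rewrite -ball_normE/= => sv.
    apply: eU; rewrite -ball_normE/= (splitr e).
    rewrite (le_lt_trans (ler_distD (s n t) _ _))// ltrD//; first exact: Nn.
    exact: lt_trans je.
  move=> [j _ [N _ sN]].
  have j0 : 0 < j.+1%:R^-1 :> R by rewrite invr_gt0.
  have /cvgrPdist_lt/(_ _ j0)[M _ Mn] := sg t.
  apply: (sN (maxn N M)); first exact: leq_maxl.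
  by rewrite -ball_normE/= distrC; apply: Mn; exact: leq_maxr.
apply: bigcup_measurable => j _; apply: bigcup_measurable => N _.
apply: bigcap_measurable; first by exists N => /=.
by move=> n _; exact: simple_fun_preimage.
Qed.

(** Supplies the countable set that [jointly_measurable] asks for: all values of the approximating
    simple functions. *)
Lemma strongly_measurable_separable g : strongly_measurable g ->
  exists2 A : set H, countable A & forall t, closure A (g t).
Proof.
move=> [s [ss sg]]; exists (\bigcup_n range (s n)).
  apply: bigcup_countable => // n _; have [fin _] := ss n.
  exact: finite_set_countable.
move=> t; apply: (closed_cvg _ (@closed_closure _ _) _ _ (sg t)).
by apply: nearW => n; apply: subset_closure; exists n => //; exists t.
Qed.

End Closure.

Lemma strongly_measurable_comp d (T : measurableType d) d' (T' : measurableType d')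
    (g : T' -> H) (h : T -> T') :
  measurable_fun setT h -> strongly_measurable g -> strongly_measurable (g \o h).
Proof.
move=> mh [s [ss sg]]; exists (fun n => s n \o h).
by split=> [n|t]; [exact: simple_fun_comp|exact: sg].
Qed.

(** The values of [x] stay in the closure of one countable set. The simple functions attached to
    that set, composed with [(x, z)], remain simple and converge at every point. *)
Lemma jointly_measurable_comp d (T : measurableType d) d' (Z : measurableType d')
    (X : set H) (uh : H -> Z -> H) (x : T -> H) (z : T -> Z) :
  jointly_measurable X uh -> strongly_measurable x -> (forall t, X (x t)) ->
  measurable_fun setT z -> strongly_measurable (fun t => uh (x t) (z t)).
Proof.
move=> muh mx Xx mz; have [A cA Ax] := strongly_measurable_separable mx.
have [s [ss sA]] := muh A cA.
exists (fun n t => s n (x t, z t)); split=> [n|t]; last exact: sA.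
apply: (@simple_fun_comp _ _ _ _ (s n)
  (fun t => ((x t : g_sigma_algebraType (@open H)), z t))) => //.
by apply/measurable_fun_pairP; split=> //; exact: strongly_measurable_borel.
Qed.

Section Dot.
Context (dot : {dot H for idfun}) d (T : measurableType d).
Hypothesis dotE : forall x : H, dot x x = `|x| ^+ 2.

Lemma strongly_measurable_dot (g g' : T -> H) : strongly_measurable g ->
  strongly_measurable g' -> measurable_fun setT (fun t => dot (g t) (g' t)).
Proof.
move=> mg mg'.
(* Polarization leaves only norms, which are continuous functions of a single strongly measurable
   map. *)
have -> : (fun t => dot (g t) (g' t)) =
    (fun t => (`|g t + g' t| ^+ 2 - `|g t| ^+ 2 - `|g' t| ^+ 2) * 2^-1).
  by apply/funext => t; rewrite (normD_sqr dotE); field.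
apply: measurable_funM => //; apply: measurable_funB; first apply: measurable_funB.
- by apply: measurable_funX; apply: strongly_measurable_norm; exact: strongly_measurableD.
- by apply: measurable_funX; exact: strongly_measurable_norm.
- by apply: measurable_funX; exact: strongly_measurable_norm.
Qed.

End Dot.

End StrongMeasurability.

(** * Independent blocks of draws *)

Section Independence.
Context {R : realType} d (T : measurableType d) (P : probability T R).
Context d' (Z : measurableType d') (I : choiceType) (D : set I) (Y : I -> T -> Z).
Hypothesis mY : forall i, measurable_fun setT (Y i).
Hypothesis indep : mutually_independent P D Y.
Implicit Types J : set I.

(** A pi-system generating the information carried by the block [J]. It lives on [T] itself, so that
    measurability with respect to a block is measurability on [T] with a coarser sigma-algebra. *)
Definition cylinders J : set (set T) :=
  [set B | exists (F : {fset I}) (A : I -> set Z),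
    [/\ [set` F] `<=` J, forall i, i \in F -> measurable (A i) &
        B = \bigcap_(i in [set` F]) (Y i @^-1` A i)]].

Lemma cylinders_measurable J : cylinders J `<=` measurable.
Proof.
move=> _ [F [A [_ mA ->]]]; apply: fin_bigcap_measurable => // i iF.
by have := mY i measurableT (mA _ iF); rewrite setTI.
Qed.

Lemma cylindersT J : cylinders J setT.
Proof.
exists fset0, (fun=> setT); split=> //.
by apply/seteqP; split=> // t _ i; rewrite /= inE.
Qed.

Lemma cylinders_preimage J i (A : set Z) : J i -> measurable A ->
  cylinders J (Y i @^-1` A).
Proof.
move=> Ji mA; exists [fset i]%fset, (fun=> A); split=> //.
  by move=> j; rewrite /= inE => /eqP ->.
by apply/seteqP; split=> [t At j /=|t /(_ i)/=]; rewrite inE ?eqxx ?(rwP eqP)//;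
  [move=> /eqP ->|apply].
Qed.

Lemma cylinders_setI_closed J : setI_closed (cylinders J).
Proof.
move=> _ _ [F [A [FJ mA ->]]] [F' [A' [FJ' mA' ->]]].
exists (F `|` F')%fset, (fun i => (if i \in F then A i else setT) `&`
  (if i \in F' then A' i else setT)); split.
- by move=> i; rewrite /= inE => /orP[/FJ|/FJ'].
- move=> i _; apply: measurableI; case: ifP => [iF|_]; try exact: measurableT.
    exact: mA.
  exact: mA'.
- apply/seteqP; split=> t.
    move=> [h h'] i _ /=; split; case: ifP => // iF; [exact: h|exact: h'].
  move=> h; split=> i /= iF.
    by have := h i; rewrite /= inE iF => /(_ isT)[].
  by have := h i; rewrite /= inE iF orbT => /(_ isT)[].
Qed.

Section Blocks.
Variables J J' : set I.
Hypotheses (JD : J `<=` D) (JD' : J' `<=` D) (JJ' : J `&` J' = set0).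

Lemma cylinders_independent B B' : cylinders J B -> cylinders J' B' ->
  P (B `&` B') = (P B * P B')%E.
Proof.
move=> [F [A [FJ mA ->]]] [F' [A' [FJ' mA' ->]]].
have disj i : i \in F -> i \in F' -> False.
  by move=> /FJ Ji /FJ' Ji'; have : (J `&` J') i by []; rewrite JJ'.
(* As the blocks are disjoint, one family of sets describes both cylinders, and independence applies
   to their union. *)
pose C i := if i \in F then A i else A' i.
have CF i : i \in F -> C i = A i by rewrite /C => ->.
have CF' i : i \in F' -> C i = A' i.
  by rewrite /C => iF'; case: ifP => // /disj /(_ iF').
have mC i : i \in (F `|` F')%fset -> measurable (C i).
  rewrite inE => /orP[iF|iF']; first by rewrite CF//; exact: mA.
  by rewrite CF'//; exact: mA'.
have FD : [set` F] `<=` D := subset_trans FJ JD.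
have FD' : [set` F'] `<=` D := subset_trans FJ' JD'.
rewrite (indep FD mA) (indep FD' mA').
have -> : \bigcap_(i in [set` F]) (Y i @^-1` A i) `&`
    \bigcap_(i in [set` F']) (Y i @^-1` A' i) =
    \bigcap_(i in [set` (F `|` F')%fset]) (Y i @^-1` C i).
  apply/seteqP; split=> t.
    move=> [h h'] i /=; rewrite inE => /orP[iF|iF'].
      by rewrite CF//; exact: h.
    by rewrite CF'//; exact: h'.
  move=> h; split=> i /= iF.
    by rewrite -CF//; apply: (h i); rewrite /= inE iF.
  by rewrite -CF'//; apply: (h i); rewrite /= inE iF orbT.
rewrite indep//; last by move=> i; rewrite /= inE => /orP[/FD|/FD'].
rewrite (big_fsetID _ (mem F))/=; congr (_ * _)%E.
  rewrite (_ : [fset x in _ | _]%fset = F); last first.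
    by apply/fsetP => i; rewrite !inE/=; case: (i \in F); rewrite ?andbF.
  by rewrite !big_seq; apply: eq_bigr => i iF; rewrite CF.
rewrite (_ : [fset x in _ | _]%fset = F'); last first.
  apply/fsetP => i; rewrite !inE/=; case: (boolP (i \in F)) => //= iF; last by rewrite andbT.
  by apply/esym/negP => /(disj _ iF).
by rewrite !big_seq; apply: eq_bigr => i iF; rewrite CF'.
Qed.

Lemma g_cylinders_measurable K A : <<s cylinders K >> A -> measurable A.
Proof.
exact: (smallest_sub (@sigma_algebra_measurable _ T) (@cylinders_measurable K)).
Qed.

(** For fixed [B'], the finite measures [B |-> P (B & B')] and [B |-> P B * P B'] agree on a
    pi-system, hence on the sigma-algebra it generates. The argument is applied to one factor and
    then to the other. *)
Lemma g_cylinders_independent A A' : <<s cylinders J >> A -> <<s cylinders J' >> A' ->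
  P (A `&` A') = (P A * P A')%E.
Proof.
have scale_unique K B' : measurable B' ->
    (forall B, cylinders K B -> P (B `&` B') = (P B * P B')%E) ->
    forall B, <<s cylinders K >> B -> P (B `&` B') = (P B * P B')%E.
  move=> mB' PB B sB.
  pose c : {nonneg R} := NngNum (fine_ge0 (measure_ge0 P B')).
  have cE : (fine (P B'))%:E = P B' by rewrite fineK// fin_num_measure.
  have scaleE C : mscale c P C = (P C * P B')%E by rewrite /mscale/= cE muleC.
  rewrite -scaleE -[LHS]/(mrestr P mB' B).
  apply: (g_sigma_algebra_measure_unique (cylinders K) _ (fun=> setT)) sB.
  - exact: cylinders_measurable.
  - by move=> _; exact: cylindersT.
  - by rewrite bigcup_const//; exists 0%N.
  - exact: cylinders_setI_closed.
  - by move=> C KC; apply: etrans (esym (scaleE C)); exact: PB.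
  - by move=> _; rewrite /mrestr (le_lt_trans (probability_le1 _ _))// ?ltry//;
      exact: measurableI.
move=> sA sA'; apply: (scale_unique) (sA); first exact: g_cylinders_measurable sA'.
move=> B KB; rewrite setIC muleC; apply: scale_unique (sA').
  exact: cylinders_measurable KB.
by move=> B' KB'; rewrite setIC muleC; exact: cylinders_independent.
Qed.

Lemma cylinders_id_measurable K :
  measurable_fun setT (id : T -> g_sigma_algebraType (cylinders K)).
Proof. by move=> _ A mA; rewrite setTI preimage_id; exact: g_cylinders_measurable mA. Qed.

Lemma cylinders_coordinate_measurable K i : K i ->
  measurable_fun setT (Y i : g_sigma_algebraType (cylinders K) -> Z).
Proof.
move=> Ki _ A mA; rewrite setTI; apply: sub_sigma_algebra.
exact: cylinders_preimage.
Qed.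

Local Notation TJ := (g_sigma_algebraType (cylinders J)).
Local Notation TJ' := (g_sigma_algebraType (cylinders J')).

(* By independence of the blocks, the law of [t |-> (t, t)] on the product of the
   two sigma-algebras is a product measure. *)
Lemma fubini_independent_le (f : TJ * TJ' -> \bar R) (h : T -> \bar R) :
  measurable_fun setT f -> (forall z, 0 <= f z)%E -> measurable_fun setT h ->
  (forall t, \int[P]_t' f (t, t') <= h t)%E ->
  (\int[P]_t f (t, t) <= \int[P]_t h t)%E.
Proof.
move=> mf f0 mh fh.
pose X : {mfun T >-> TJ} := HB.pack (id : T -> TJ)
  (isMeasurableFun.Build _ _ _ _ _ (@cylinders_id_measurable J)).
pose X' : {mfun T >-> TJ'} := HB.pack (id : T -> TJ')
  (isMeasurableFun.Build _ _ _ _ _ (@cylinders_id_measurable J')).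
have mdiag : measurable_fun setT (fun t : T => ((t : TJ), (t : TJ'))).
  apply/measurable_fun_pairP; split; [exact: (@cylinders_id_measurable J)|].
  exact: (@cylinders_id_measurable J').
pose XX : {mfun T >-> (TJ * TJ')%type} := HB.pack (fun t : T => ((t : TJ), (t : TJ')))
  (isMeasurableFun.Build _ _ _ _ _ mdiag).
have -> : (\int[P]_t f (t, t) = \int[distribution P XX]_z f z)%E.
  by rewrite ge0_integral_distribution.
have -> : (\int[distribution P XX]_z f z =
    \int[(distribution P X \x distribution P X')%E]_z f z)%E.
  apply: eq_measure_integral => A mA _; apply/esym.
  apply: product_measure_unique => // B B' mB mB'.
  exact: (g_cylinders_independent mB mB').
have mF := measurable_fun_fubini_tonelli_F (m2 := distribution P X') f mf f0.
have FE (t : T) : fubini_F (distribution P X') f t = (\int[P]_t' f (t, t'))%E.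
  rewrite /fubini_F ge0_integral_distribution//.
  exact: (measurableT_comp mf (pair1_measurable _)).
rewrite fubini_tonelli1//= ge0_integral_distribution//; last first.
  by move=> t; apply: integral_ge0.
apply: ge0_le_integral => //.
- by move=> t _; apply: integral_ge0.
- exact: (measurableT_comp mF (@cylinders_id_measurable J)).
- by move=> t _; apply: le_trans (fh t); rewrite -FE.
Qed.

End Blocks.

End Independence.

Section RealExpectation.
Context {R : realType} d (T : measurableType d) (P : probability T R).
Implicit Types f g : T -> R.

Lemma EFin_Rintegral f : P.-integrable setT (EFin \o f) ->
  (\int[P]_t f t)%:E = (\int[P]_t (f t)%:E)%E.
Proof. by move=> fi; rewrite fineK//; exact: integrable_fin_num. Qed.

Lemma bounded_integrable f B : measurable_fun setT f -> (forall t, `|f t| <= B) ->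
  P.-integrable setT (EFin \o f).
Proof.
move=> mf fB; apply: measurable_bounded_integrable => //.
  by rewrite (le_lt_trans (probability_le1 _ _))// ltry.
exists B; split; first exact: num_real.
by move=> M BM t _ /=; rewrite (le_trans (fB t))// ltW.
Qed.

Lemma dominated_integrable f g : measurable_fun setT f ->
  (forall t, `|f t| <= g t) -> P.-integrable setT (EFin \o g) ->
  P.-integrable setT (EFin \o f).
Proof.
move=> mf fg; apply: le_integrable => //; first exact/measurable_EFinP.
by move=> t _ /=; rewrite lee_fin (le_trans (fg t))// ler_norm.
Qed.

Lemma ge0_integral_le f c : measurable_fun setT f -> (forall t, 0 <= f t) ->
  (\int[P]_t (f t)%:E <= c%:E)%E ->
  P.-integrable setT (EFin \o f) /\ \int[P]_t f t <= c.
Proof.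
move=> mf f0 fc.
have fi : P.-integrable setT (EFin \o f).
  apply/integrableP; split; first exact/measurable_EFinP.
  apply: le_lt_trans (ltry c); apply: le_trans fc.
  by under eq_integral => t _ do rewrite /= ger0_norm//.
by split=> //; rewrite -lee_fin EFin_Rintegral.
Qed.

Lemma rintegrableD f g : P.-integrable setT (EFin \o f) ->
  P.-integrable setT (EFin \o g) -> P.-integrable setT (EFin \o (fun t => f t + g t)).
Proof. by move=> fi gi; exact: (integrableD measurableT fi gi). Qed.

Lemma rintegrableB f g : P.-integrable setT (EFin \o f) ->
  P.-integrable setT (EFin \o g) -> P.-integrable setT (EFin \o (fun t => f t - g t)).
Proof. by move=> fi gi; exact: (integrableB measurableT fi gi). Qed.

Lemma rintegrableZ c f : P.-integrable setT (EFin \o f) ->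
  P.-integrable setT (EFin \o (fun t => c * f t)).
Proof. by move=> fi; exact: (integrableZl measurableT c fi). Qed.

Lemma Rintegral_prob_cst (c : R) : \int[P]_t c = c.
Proof. by rewrite Rintegral_cst// [X in fine X](probability_setT P) mulr1. Qed.

End RealExpectation.

(** * Bochner expectations tested against vectors *)

Section BochnerDot.
Context {R : realType} {H : completeNormedModType R} (dot : {dot H for idfun}).
Hypothesis dotE : forall x : H, dot x x = `|x| ^+ 2.
Context d (T : measurableType d) (P : probability T R).

Lemma dot_suml (I : Type) (r : seq I) (Q : pred I) (F : I -> H) v :
  dot (\sum_(i <- r | Q i) F i) v = \sum_(i <- r | Q i) dot (F i) v.
Proof.
by elim/big_ind2: _ => [|x a y b <- <-|//]; rewrite ?dot0l ?dotDl.
Qed.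

Lemma simple_fun_strongly_measurable (s : T -> H) : simple_fun s -> strongly_measurable s.
Proof. by move=> ss; exists (fun=> s); split=> // t; exact: cvg_cst. Qed.

Lemma simple_fun_bounded (s : T -> H) : simple_fun s -> exists B, forall t, `|s t| <= B.
Proof.
move=> [sfin _].
exists (\sum_(v \in range s) `|v|) => t.
have ht : s t \in fset_set (range s) by rewrite in_fset_set// inE; exists t.
rewrite fsbig_finite//= (big_fsetD1 (s t))//= lerDl.
by apply: sumr_ge0.
Qed.

Lemma simple_fun_norm_integrable (s : T -> H) : simple_fun s ->
  P.-integrable setT (EFin \o (fun t => `|s t|)).
Proof.
move=> ss; have [B sB] := simple_fun_bounded ss.
apply: (@bounded_integrable _ _ _ _ _ B) => [|t]; last by rewrite normr_id.
by apply: strongly_measurable_norm; exact: simple_fun_strongly_measurable.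
Qed.

Lemma simple_expectation_dot (s : T -> H) (v : H) : simple_fun s ->
  \int[P]_t dot (s t) v = dot (simple_expectation P s) v.
Proof.
move=> ss; have [sfin sm] := ss.
have E t : (dot (s t) v)%:E =
    (\sum_(w <- fset_set (range s)) (dot w v)%:E * (\1_(s @^-1` [set w]) t)%:E)%E.
  have ht : s t \in fset_set (range s) by rewrite in_fset_set// inE; exists t.
  rewrite (big_fsetD1 (s t))//= indicE mem_set// mule1 big_seq big1 ?adde0// => w.
  rewrite !inE => /andP[wst _]; rewrite indicE memNset ?mule0//.
  by move=> /= stw; move: wst; rewrite stw eqxx.
rewrite /Rintegral; under eq_integral do rewrite E.
rewrite integral_sum//; last first.
  by move=> w; apply: integrableZl => //; exact: integrable_indic.
rewrite /simple_expectation fsbig_finite// dot_suml.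
rewrite -[RHS]/(fine (_%:E)) -sumEFin; congr fine; apply: eq_bigr => w _.
rewrite integralZl//; last exact: integrable_indic.
by rewrite integral_indic// setIT dotZl mulrC EFinM fineK// fin_num_measure.
Qed.

(** The link from the vector-valued expectation to real integrals: the scalar product with [v]
    commutes with it. This is clear for simple functions, and passing to [g] changes both sides by
    [|v|] times a quantity tending to 0. *)
Lemma bochner_dot (g : T -> H) (e : H) : strongly_measurable g ->
  is_bochner_expectation P g e ->
  P.-integrable setT (EFin \o (fun t => `|g t|)) /\
  forall v, \int[P]_t dot (g t) v = dot e v.
Proof.
move=> mg [s [ss _ sg se]].
have mgs n : strongly_measurable (fun t => g t - s n t).
  by apply: strongly_measurableB => //; exact: simple_fun_strongly_measurable.
have /fine_cvgP[sfin /cvgrPdist_lt sg0] := sg.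
have gs_int n : (\int[P]_t (`|g t - s n t|)%:E)%E \is a fin_num ->
    P.-integrable setT (EFin \o (fun t => `|g t - s n t|)).
  move=> fn; apply/integrableP; split.
    by apply/measurable_EFinP; exact: strongly_measurable_norm.
  by under eq_integral => t _ do rewrite /= normr_id; rewrite -ge0_fin_numE// integral_ge0.
have gi : P.-integrable setT (EFin \o (fun t => `|g t|)).
  have [n _ /(_ n (leqnn n)) fn] := sfin.
  apply: (@dominated_integrable _ _ _ _ _ (fun t => `|g t - s n t| + `|s n t|)).
  - exact: strongly_measurable_norm.
  - by move=> t; rewrite normr_id -{1}(subrK (s n t) (g t)) ler_normD.
  - by apply: rintegrableD; [exact: gs_int|exact: simple_fun_norm_integrable].
split=> // v.
have doti (h : T -> H) : strongly_measurable h ->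
    P.-integrable setT (EFin \o (fun t => `|h t|)) ->
    P.-integrable setT (EFin \o (fun t => dot (h t) v)).
  move=> mh hi; apply: (@dominated_integrable _ _ _ _ _ (fun t => `|v| * `|h t|)).
  - by apply: strongly_measurable_dot => //; exact: strongly_measurable_cst.
  - by move=> t; rewrite mulrC cauchy_schwarz_norm.
  - exact: rintegrableZ.
apply/eqP; rewrite -subr_eq0 -normr_le0; apply/ler_addgt0Pr => eps eps0; rewrite add0r.
(* Each of the two approximation errors is at most [|v| * e'], and [2 * |v| * e' <= eps]; the [+ 1]
   covers [v = 0]. *)
pose e' := eps / (2 * (`|v| + 1)).
have v1 : 0 < `|v| + 1 by rewrite ltr_wpDl.
have e'0 : 0 < e' by rewrite divr_gt0// mulr_gt0.
move/cvgrPdist_lt : se => /(_ _ e'0) se.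
have [n _ /(_ n (leqnn n))[[fn sn] en]] := filterI (filterI sfin (sg0 _ e'0)) se.
rewrite sub0r normrN ger0_norm in sn; last by rewrite fine_ge0// integral_ge0.
have si := simple_fun_norm_integrable (ss n).
have -> : \int[P]_t dot (g t) v - dot e v =
    \int[P]_t dot (g t - s n t) v + dot (simple_expectation P (s n) - e) v.
  rewrite dotDl dotNl -(simple_expectation_dot _ (ss n)).
  under [X in _ = X + _]eq_Rintegral do rewrite dotDl dotNl.
  rewrite RintegralB//; last 2 first.
  - exact: doti.
  - by apply: doti => //; exact: simple_fun_strongly_measurable.
  by rewrite addrA subrK.
apply: le_trans (ler_normD _ _) _.
have -> : eps = `|v| * e' + `|v| * e' + 2 * e' by rewrite /e'; field; rewrite gt_eqF.
apply: ler_wpDr; first by rewrite mulr_ge0// ltW.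
apply: lerD; last first.
  apply: le_trans (cauchy_schwarz_norm dotE _ _) _.
  by rewrite mulrC ler_wpM2l// distrC ltW.
apply: le_trans (le_normr_Rintegral _ _) _ => //.
  by apply: doti => //; exact: gs_int.
apply: (@le_trans _ _ (\int[P]_t (`|v| * `|g t - s n t|))).
  apply: le_Rintegral => //.
  - by apply: integrable_norm; apply: doti => //; exact: gs_int.
  - by apply: rintegrableZ; exact: gs_int.
  - by move=> t _; rewrite mulrC cauchy_schwarz_norm.
rewrite RintegralZl//; last exact: gs_int.
by rewrite ler_wpM2l// ltW.
Qed.

End BochnerDot.

(** * Concentration of one step *)

Section ExponentialInequalities.
Context {R : realType}.
Implicit Types z c s v V l : R.

(** Compares the exponential series, from its quadratic term on, with a geometric series of ratio
    [z / 3]. *)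
Lemma fact_ge_pow3 n : (2 * 3 ^ n <= n.+2`!)%N.
Proof.
elim: n => // n ih; rewrite expnS factS mulnCA.
by apply: leq_mul.
Qed.

Lemma expR_le_pade z : 0 <= z -> z < 3 -> expR z <= 1 + z + z ^+ 2 / (2 * (1 - z / 3)).
Proof.
move=> z0 z3; have q0 : 0 < 1 - z / 3 by rewrite subr_gt0 ltr_pdivrMr// mul1r.
(* The last term is the remaining tail of the geometric series; keeping it makes the induction close
   exactly. *)
have partial N : series (exp_coeff z) N.+2 <=
    1 + z + z ^+ 2 / (2 * (1 - z / 3)) - z ^+ 2 * (z / 3) ^+ N / (2 * (1 - z / 3)).
  elim: N => [|N ih].
    rewrite /series/= big_nat_recr//= big_nat1 /exp_coeff/= expr0 mulr1 addrK.
    by rewrite fact0 factS fact0 !divr1.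
  rewrite /series/= big_nat_recr//=; move: ih; rewrite /series/= => ih.
  apply: le_trans (lerD ih (lexx _)) _.
  have key : exp_coeff z N.+2 <= z ^+ 2 * (z / 3) ^+ N / 2.
    rewrite /exp_coeff/= -addn2 addnC exprD -[X in X <= _](mulrA (z ^+ 2)) -[X in _ <= X](mulrA (z ^+ 2)).
    apply: ler_wpM2l; first by rewrite exprn_ge0.
    rewrite expr_div_n -mulrA -invfM; apply: ler_wpM2l; first by rewrite exprn_ge0.
    rewrite lef_pV2 ?posrE.
    - by rewrite -natrX -natrM ler_nat mulnC add2n; exact: fact_ge_pow3.
    - by rewrite ltr0n fact_gt0.
    - by rewrite mulr_gt0// exprn_gt0.
  apply: le_trans (lerD (lexx _) key) _; rewrite (exprS (z / 3)) le_eqVlt; apply/orP; left.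
  apply/eqP; move: ((z / 3) ^+ N) => w; field; lra.
rewrite /expR; apply: limr_le; first exact: is_cvg_series_exp_coeff.
exists 2%N => // n; case: n => [|[|n]]// _; apply: le_trans (partial n) _.
by rewrite lerBlDr lerDl divr_ge0// ?mulr_ge0// ?exprn_ge0 ?divr_ge0// ltW// mulr_gt0.
Qed.

Lemma expR_ge1DxDx2 z : 0 <= z -> 1 + z + z ^+ 2 / 2 <= expR z.
Proof.
move=> z0.
have -> : 1 + z + z ^+ 2 / 2 = series (exp_coeff z) 3.
  rewrite /series/= !big_nat_recr//= big_nil /exp_coeff/= add0r.
  by rewrite !factS fact0 expr0 expr1 !divr1.
apply: nondecreasing_cvgn_le; last exact: is_cvg_series_exp_coeff.
by apply: nondecreasing_series => n _ _; exact: exp_coeff_ge0.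
Qed.

(** With [y = - z], [(1 - y + y^2 / 2) (1 + y + y^2 / 2) = 1 + y^4 / 4 >= 1], and the second factor
    is at most [expR y]. *)
Lemma expR_le_neg z : z <= 0 -> expR z <= 1 + z + z ^+ 2 / 2.
Proof.
move=> z0; rewrite -[z]opprK expRN; set y := - z.
have y0 : 0 <= y by rewrite oppr_ge0.
have h := expR_ge1DxDx2 y0.
rewrite -[X in X <= _]mul1r ler_pdivrMr ?expR_gt0//.
have d0 : 0 <= 1 - y + y ^+ 2 / 2 by have := sqr_ge0 (1 - y); nra.
rewrite sqrrN; apply: le_trans (ler_wpM2l d0 h).
have := sqr_ge0 (y ^+ 2); lra.
Qed.

(** Only an upper bound on [z] is available in the application. Positive [z] fall under
    [expR_le_pade], whose bound increases with the denominator's parameter; for negative [z] the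
    parameter 0 suffices. *)
Lemma expR_bernstein c z : 0 <= c -> c < 3 -> z <= c ->
  expR z <= 1 + z + z ^+ 2 / (2 * (1 - c / 3)).
Proof.
move=> c0 c3 zc.
have mono a : 0 <= a -> a <= c -> z ^+ 2 / (2 * (1 - a / 3)) <= z ^+ 2 / (2 * (1 - c / 3)).
  move=> a0 ac; rewrite ler_wpM2l ?sqr_ge0// lef_pV2 ?posrE; lra.
have [z0|/ltW z0] := leP 0 z.
  apply: le_trans (expR_le_pade z0 (le_lt_trans zc c3)) _.
  by rewrite lerD2l mono.
apply: le_trans (expR_le_neg z0) _; rewrite lerD2l.
by apply: le_trans (mono 0 _ _) => //; rewrite mul0r subr0 mulr1.
Qed.

(* Minkowski's inequality in L2 follows from this: the minimum over [eta] of the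
   right-hand side is at [eta = b / a]. *)
Lemma sqr_le_param (v a b : R) : 0 <= a -> 0 <= b ->
  (forall eta, 0 < eta -> v <= (1 + eta) * a ^+ 2 + (1 + eta^-1) * b ^+ 2) ->
  v <= (a + b) ^+ 2.
Proof.
move=> a0 b0 h; apply/ler_addgt0Pr => e e0.
have ab1 : 0 < a + b + 1 by lra.
(* Since [a] or [b] may vanish, both are shifted by [t] in the optimal [eta]; the loss is at most
   [t * (a + b) <= e]. *)
have [t t0 h3] : exists2 t, 0 < t & t * (a + b) <= e.
  exists (e / (a + b + 1)); first by rewrite divr_gt0.
  by rewrite mulrAC ler_pdivrMr// ler_wpM2l ?(ltW e0)//; lra.
have at0 : 0 < a + t by lra. have bt0 : 0 < b + t by lra.
apply: le_trans (h ((b + t) / (a + t)) _) _; first by rewrite divr_gt0.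
rewrite invf_div.
have h1 : (b + t) / (a + t) * a ^+ 2 <= a * (b + t).
  rewrite mulrAC ler_pdivrMr//.
  have : 0 <= a * (b + t) * t by rewrite !mulr_ge0// ltW.
  lra.
have h2 : (a + t) / (b + t) * b ^+ 2 <= b * (a + t).
  rewrite mulrAC ler_pdivrMr//.
  have : 0 <= b * (a + t) * t by rewrite !mulr_ge0// ltW.
  lra.
rewrite !mulrDl !mul1r; move: h1 h2 h3; lra.
Qed.

(** Take [s = 1 / (c / 3 + r)] with [V = 2 l r^2]. Then [1 - s c / 3 = s r], so the quadratic term
    is [s l r], while [l = s l (c / 3 + r)]; finally [2 l r = sqrt (2 V l)]. *)
Lemma chernoff_parameter c V l : 0 < c -> 0 < V -> 0 < l ->
  exists s, [/\ 0 < s, s * c < 3 &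
    l + s ^+ 2 * V / (2 * (1 - s * c / 3)) = s * (c * l / 3 + Num.sqrt (2 * V * l))].
Proof.
move=> c0 V0 l0; pose r := Num.sqrt (V / (2 * l)).
have r0 : 0 < r by rewrite sqrtr_gt0 divr_gt0// mulr_gt0.
have r2 : V = 2 * l * r ^+ 2.
  by rewrite sqr_sqrtr ?divr_ge0 ?mulr_ge0// ?ltW//; field; rewrite gt_eqF.
have cr : 0 < c / 3 + r by rewrite addr_gt0// divr_gt0.
exists (c / 3 + r)^-1; split; first by rewrite invr_gt0.
  by rewrite mulrC ltr_pdivrMr//; lra.
have -> : Num.sqrt (2 * V * l) = 2 * l * r.
  rewrite r2; have -> : 2 * (2 * l * r ^+ 2) * l = (2 * l * r) ^+ 2 by ring.
  by rewrite sqrtr_sqr ger0_norm// !mulr_ge0// ltW.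
rewrite {1}r2; field.
by rewrite !gt_eqF//; lra.
Qed.

End ExponentialInequalities.

(** [B] gives integrability; the estimate itself involves [mu], the one-sided range [c] of the
    centred variable, and the second moment [v], which dominates the variance. *)
Lemma bernstein_mgf {R : realType} d (T : measurableType d) (P : probability T R)
    (q : T -> R) (B c v mu s : R) :
  measurable_fun setT q -> (forall t, `|q t| <= B) ->
  \int[P]_t q t <= mu -> (forall t, q t - \int[P]_t q t <= c) ->
  \int[P]_t (q t ^+ 2) <= v -> 0 <= c -> 0 < s -> s * c < 3 ->
  (\int[P]_t (expR (s * q t))%:E <=
    (expR (s * mu + s ^+ 2 * v / (2 * (1 - s * c / 3))))%:E)%E.
Proof.
move=> mq qB qmu qc qv c0 s0 sc3.
set q0 := \int[P]_t q t in qmu qc *.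
have qi : P.-integrable setT (EFin \o q) by exact: bounded_integrable qB.
have q2i : P.-integrable setT (EFin \o (fun t => q t ^+ 2)).
  apply: (@bounded_integrable _ _ _ _ _ (B ^+ 2)); first exact: measurable_funX.
  by move=> t; rewrite normrX lerXn2r// nnegrE// (le_trans _ (qB t)).
have sq3 : 0 < 1 - s * c / 3 by rewrite subr_gt0 ltr_pdivrMr// mul1r.
set k := (2 * (1 - s * c / 3))^-1.
have k0 : 0 <= k by rewrite invr_ge0 mulr_ge0// ltW.
(* The quadratic majorant in [q - q0], expanded in powers of [q], so that its integral involves only
   the first two moments. *)
pose h t := expR (s * q0) * ((1 - s * q0 + k * s ^+ 2 * q0 ^+ 2) +
   ((s - 2 * k * s ^+ 2 * q0) * q t + k * s ^+ 2 * q t ^+ 2)).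
have le_h t : expR (s * q t) <= h t.
  have -> : s * q t = s * q0 + s * (q t - q0) by ring.
  rewrite expRD ler_wpM2l ?expR_ge0//.
  have := @expR_bernstein _ (s * c) (s * (q t - q0)).
  rewrite mulr_ge0 ?(ltW s0)// sc3 ler_pM2l// qc => /(_ isT isT isT) /le_trans; apply.
  by rewrite -/k le_eqVlt; apply/orP; left; apply/eqP; ring.
have hi : P.-integrable setT (EFin \o h).
  apply: rintegrableZ; apply: rintegrableD.
    by apply: finite_measure_integrable_cst.
  by apply: rintegrableD; exact: rintegrableZ.
have mexp : measurable_fun setT (fun t => expR (s * q t)).
  by apply: measurableT_comp => //; exact: measurable_funM.
have ei : P.-integrable setT (EFin \o (fun t => expR (s * q t))).
  by apply: (dominated_integrable mexp _ hi) => t; rewrite ger0_norm ?expR_ge0.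
rewrite -EFin_Rintegral// lee_fin.
have hE : \int[P]_t h t = expR (s * q0) * ((1 - s * q0 + k * s ^+ 2 * q0 ^+ 2) +
    ((s - 2 * k * s ^+ 2 * q0) * q0 + k * s ^+ 2 * \int[P]_t (q t ^+ 2))).
  rewrite /h RintegralZl//; last first.
    apply: rintegrableD; first by apply: finite_measure_integrable_cst.
    by apply: rintegrableD; exact: rintegrableZ.
  rewrite RintegralD//; last 2 first.
  - by apply: finite_measure_integrable_cst.
  - by apply: rintegrableD; exact: rintegrableZ.
  rewrite Rintegral_prob_cst RintegralD//; last 2 first.
  - exact: rintegrableZ.
  - exact: rintegrableZ.
  by rewrite !RintegralZl.
have ehi := @le_Rintegral _ _ _ P setT _ h measurableT ei hi (fun t _ => le_h t).
have e0 := @Rintegral_ge0 _ _ _ P setT (fun t => expR (s * q t)) (fun t _ => expR_ge0 _).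
have eh0 := le_trans e0 ehi; apply: (le_trans ehi); move: eh0.
rewrite hE expRD pmulr_rge0 ?expR_gt0// => h0.
apply: ler_pM; rewrite ?expR_ge0//.
- by rewrite ler_expR ler_pM2l.
(* The terms linear in [q0] cancel: what remains is [1 + k s^2 (E q^2 - q0^2)], and [q0^2] is
   dropped. *)
apply: le_trans (expR_ge1Dx _); rewrite -/k.
have : k * s ^+ 2 * (\int[P]_t (q t ^+ 2)) <= k * s ^+ 2 * v.
  by apply: ler_wpM2l => //; exact: mulr_ge0 k0 (sqr_ge0 _).
have : 0 <= k * s ^+ 2 * q0 ^+ 2 by exact: mulr_ge0 (mulr_ge0 k0 (sqr_ge0 _)) (sqr_ge0 _).
by move: (\int[P]_t _) => A; lra.
Qed.

Lemma same_law_ge0_integral {R : realType} d (T : measurableType d) (P : probability T R)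
    d' (Z : measurableType d') (Y Y' : {RV P >-> Z}) (f : Z -> \bar R) :
  same_law Y Y' -> measurable_fun setT f -> (forall z, 0 <= f z)%E ->
  (\int[P]_t f (Y t) = \int[P]_t f (Y' t))%E.
Proof.
move=> law mf f0.
transitivity (\int[distribution P Y]_z f z)%E; first by rewrite ge0_integral_distribution.
transitivity (\int[distribution P Y']_z f z)%E; last by rewrite ge0_integral_distribution.
by apply: eq_measure_integral => A mA _; exact: law.
Qed.

Lemma same_law_Rintegral {R : realType} d (T : measurableType d) (P : probability T R)
    d' (Z : measurableType d') (Y Y' : {RV P >-> Z}) (f : Z -> R) :
  same_law Y Y' -> measurable_fun setT f ->
  P.-integrable setT (EFin \o (f \o Y')) ->
  P.-integrable setT (EFin \o (f \o Y)) /\ \int[P]_t f (Y t) = \int[P]_t f (Y' t).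
Proof.
move=> law mf fi'.
have mEf : measurable_fun setT (EFin \o f) by exact/measurable_EFinP.
have fi : P.-integrable setT (EFin \o (f \o Y)).
  apply/integrableP; split.
    by apply/measurable_EFinP; exact: measurableT_comp.
  have [_ fi'oo] := integrableP _ _ _ fi'.
  rewrite (same_law_ge0_integral (f := fun z => `|(f z)%:E|%E) law)//.
  exact: measurableT_comp.
split=> //; rewrite /Rintegral; congr fine.
transitivity (\int[distribution P Y]_z (f z)%:E)%E.
  by rewrite integral_distribution.
transitivity (\int[distribution P Y']_z (f z)%:E)%E.
  by apply: eq_measure_integral => A mA _; exact: law.
by rewrite integral_distribution.
Qed.

(** * Moments of the batch noise at a fixed point *)

Section Batch.
Context {R : realType} {H : completeNormedModType R} (dot : {dot H for idfun}).
Hypothesis dotE : forall x : H, dot x x = `|x| ^+ 2.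
Context (X : set H) d d' (T : measurableType d) (Z : measurableType d')
  (P : probability T R) (xi : {RV P >-> Z}) (uh : H -> Z -> H) (sigma : R).
Hypothesis uh_measurable : jointly_measurable X uh.
Hypothesis uh_integrable : forall x, X x -> bochner_integrable P (uh x \o xi).
Hypothesis uh_variance : forall x, X x ->
  (\int[P]_t (`|uh x (xi t) - bochner_expectation P (uh x \o xi)| ^+ 2)%:E
     <= (sigma ^+ 2)%:E)%E.
Context (m : nat) (xis : nat -> 'I_m -> {RV P >-> Z}).
Hypothesis m0 : (0 < m)%N.
Hypothesis xis_law : forall k j, (0 < k)%N -> same_law (xis k j) xi.

Definition draw (kj : nat * 'I_m) : T -> Z := xis kj.1 kj.2.
Hypothesis xis_independent : mutually_independent P
  [set kj : nat * 'I_m | (0 < kj.1)%N] draw.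

Definition mean_subgrad (x : H) : H := bochner_expectation P (uh x \o xi).

Lemma measurable_draw i : measurable_fun setT (draw i).
Proof. exact: measurable_funP. Qed.

Lemma uh_strongly_measurable x : X x -> strongly_measurable (uh x).
Proof.
move=> Xx; apply: (@jointly_measurable_comp _ _ _ Z _ Z X uh (fun=> x) id) => //.
exact: strongly_measurable_cst.
Qed.

Section FixedPoint.
Variables (x : H) (k : nat).
Hypotheses (Xx : X x) (k0 : (0 < k)%N).

Let u := mean_subgrad x.

Definition noise (j : 'I_m) (t : T) : H := uh x (xis k j t) - u.

Lemma noise_strongly_measurable (K : set (nat * 'I_m)) j : K (k, j) ->
  strongly_measurable (noise j : g_sigma_algebraType (cylinders draw K) -> H).
Proof.
move=> Kj; apply: strongly_measurableB; last exact: strongly_measurable_cst.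
apply: (@strongly_measurable_comp _ _ _ _ _ _ (uh x)).
  exact: (cylinders_coordinate_measurable Kj).
exact: uh_strongly_measurable.
Qed.

Lemma noise_strongly_measurableT j : strongly_measurable (noise j).
Proof.
apply: strongly_measurableB; last exact: strongly_measurable_cst.
apply: (@strongly_measurable_comp _ _ _ _ _ _ (uh x)) => //.
exact: uh_strongly_measurable.
Qed.

Lemma mean_subgradP : is_bochner_expectation P (uh x \o xi) u.
Proof.
rewrite /u /mean_subgrad /bochner_expectation.
by case: xgetP => [e _ //|no]; have [e /no] := uh_integrable Xx.
Qed.

Lemma noise_dot j v :
  P.-integrable setT (EFin \o (fun t => dot (noise j t) v)) /\
  \int[P]_t dot (noise j t) v = 0.
Proof.
have mg : strongly_measurable (uh x \o xi).
  apply: strongly_measurable_comp => //; exact: uh_strongly_measurable.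
have [gi gE] := bochner_dot dotE mg mean_subgradP.
have di : P.-integrable setT (EFin \o (fun t => dot (uh x (xi t)) v)).
  apply: (@dominated_integrable _ _ _ _ _ (fun t => `|v| * `|uh x (xi t)|)).
  - by apply: strongly_measurable_dot => //; exact: strongly_measurable_cst.
  - by move=> t; rewrite mulrC cauchy_schwarz_norm.
  - exact: rintegrableZ.
have mphi : measurable_fun setT (fun z => dot (uh x z - u) v).
  apply: strongly_measurable_dot => //; last exact: strongly_measurable_cst.
  apply: strongly_measurableB; last exact: strongly_measurable_cst.
  exact: uh_strongly_measurable.
have phii : P.-integrable setT (EFin \o ((fun z => dot (uh x z - u) v) \o xi)).
  have -> : (fun z => dot (uh x z - u) v) \o xi =
      (fun t => dot (uh x (xi t)) v - dot u v).
    by apply/funext => t /=; rewrite dotDl dotNl.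
  by apply: rintegrableB => //; apply: finite_measure_integrable_cst.
have [ni nE] := same_law_Rintegral (xis_law j k0) mphi phii.
split=> //; rewrite /noise nE.
under eq_Rintegral do rewrite dotDl dotNl.
rewrite RintegralB//; last by apply: finite_measure_integrable_cst.
by rewrite gE Rintegral_prob_cst subrr.
Qed.

Lemma noise_sqr j : (\int[P]_t (`|noise j t| ^+ 2)%:E <= (sigma ^+ 2)%:E)%E.
Proof.
apply: le_trans (uh_variance Xx); rewrite le_eqVlt; apply/orP; left; apply/eqP.
apply: (same_law_ge0_integral (f := fun z => (`|uh x z - u| ^+ 2)%:E) (xis_law j k0)).
  apply/measurable_EFinP; apply: measurable_funX; apply: strongly_measurable_norm.
  apply: strongly_measurableB; last exact: strongly_measurable_cst.
  exact: uh_strongly_measurable.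
by move=> z; rewrite lee_fin sqr_ge0.
Qed.

(** Partial sums over the batch: an induction on [n] adds one draw that is independent of the
    preceding ones. *)
Definition noise_sum n t := \sum_(j < m | (j < n)%N) noise j t.

Lemma noise_sum_strongly_measurable n (K : set (nat * 'I_m)) :
  (forall j : 'I_m, (j < n)%N -> K (k, j)) ->
  strongly_measurable (noise_sum n : g_sigma_algebraType (cylinders draw K) -> H).
Proof.
by move=> Kn; apply: strongly_measurable_sum => j jn; apply: noise_strongly_measurable; exact: Kn.
Qed.

Lemma noise_sum_strongly_measurableT n : strongly_measurable (noise_sum n).
Proof. by apply: strongly_measurable_sum => j _; exact: noise_strongly_measurableT. Qed.

Lemma noise_sum_dot n v :
  P.-integrable setT (EFin \o (fun t => dot (noise_sum n t) v)) /\
  \int[P]_t dot (noise_sum n t) v = 0.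
Proof.
pose F j t := dot (noise j t) v.
have key (r : seq 'I_m) :
    P.-integrable setT (EFin \o (fun t => \sum_(j <- r | (j < n)%N) F j t)) /\
    \int[P]_t (\sum_(j <- r | (j < n)%N) F j t) = 0.
  elim: r => [|j r [ih1 ih2]].
    under [X in _ /\ X = _]eq_Rintegral do rewrite big_nil.
    under eq_fun do rewrite big_nil.
    rewrite Rintegral_prob_cst; split=> //.
    by apply: finite_measure_integrable_cst.
  under [X in _ /\ X = _]eq_Rintegral do rewrite big_cons.
  under eq_fun do rewrite big_cons.
  case: (boolP (j < n)%N) => // _; have [Fi FE] := noise_dot j v.
  by split; [exact: rintegrableD|rewrite RintegralD// ih2 FE addr0].
under [X in _ /\ X = _]eq_Rintegral do rewrite dot_suml.
under eq_fun do rewrite dot_suml.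
exact: key.
Qed.

(** Variances of independent draws add up. With the first [n] draws frozen in a vector [a], the
    cross term integrates to 0 by [noise_dot], leaving [|a|^2] plus at most [sigma^2]; Fubini then
    integrates over [a]. *)
Lemma noise_sum_sqr n : (n <= m)%N ->
  (\int[P]_t (`|noise_sum n t| ^+ 2)%:E <= (n%:R * sigma ^+ 2)%:E)%E.
Proof.
elim: n => [_|n ih nm].
  rewrite mul0r; under eq_integral do rewrite /noise_sum big_pred0// normr0 expr0n.
  by rewrite integral0.
pose j := Ordinal nm.
have mS : measurable_fun setT (fun t => `|noise_sum n t| ^+ 2).
  by apply: measurable_funX; apply: strongly_measurable_norm; exact: noise_sum_strongly_measurableT.
have mj : measurable_fun setT (fun t => `|noise j t| ^+ 2).
  by apply: measurable_funX; apply: strongly_measurable_norm; exact: noise_strongly_measurableT.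
pose J : set (nat * 'I_m) := [set i : nat * 'I_m | i.1 = k /\ (i.2 < n)%N].
pose J' : set (nat * 'I_m) := [set (k, j)].
pose f (z : g_sigma_algebraType (cylinders draw J) * g_sigma_algebraType (cylinders draw J')) : \bar R :=
  (`|noise_sum n z.1 + noise j z.2| ^+ 2)%:E.
have -> : (\int[P]_t (`|noise_sum n.+1 t| ^+ 2)%:E = \int[P]_t f (t, t))%E.
  apply: eq_integral => t _; rewrite /f/= /noise_sum (bigD1 j)//= addrC.
  congr (`|_ + _| ^+ 2)%:E; apply: eq_bigl => i.
  by rewrite -val_eqE/= ltnS [RHS]ltn_neqAle andbC.
apply: (@le_trans _ _ (\int[P]_t (`|noise_sum n t| ^+ 2 + sigma ^+ 2)%:E)%E); last first.
  under eq_integral do rewrite EFinD.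
  rewrite ge0_integralD//=; [|exact/measurable_EFinP|by move=> t _; rewrite lee_fin sqr_ge0].
  rewrite integral_cst// [X in (_ + _ * X)%E](probability_setT P) mule1.
  by rewrite -natr1 mulrDl mul1r EFinD leeD// ih// ltnW.
apply: (fubini_independent_le measurable_draw xis_independent (J := J) (J' := J')).
- by move=> [a b] [/= -> _].
- by move=> _ /= ->.
- apply/seteqP; split=> // -[a b] [/= [_ bn]] [_ bE].
  by move: bn; rewrite bE ltnn.
- apply/measurable_EFinP; apply: measurable_funX; apply: strongly_measurable_norm.
  apply: strongly_measurableD.
    apply: (strongly_measurable_comp measurable_fst).
    by apply: noise_sum_strongly_measurable => i.
  apply: (strongly_measurable_comp measurable_snd).
  exact: noise_strongly_measurable.
- by move=> z; rewrite lee_fin sqr_ge0.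
- by apply/measurable_EFinP; apply: measurable_funD.
move=> t; rewrite /f/=; set a := noise_sum n t.
have [ni nE] := noise_dot j a.
have [n2i n2] := ge0_integral_le mj (fun t => sqr_ge0 _) (noise_sqr j).
have ci : P.-integrable setT (EFin \o (fun _ : T => `|a| ^+ 2)).
  by apply: finite_measure_integrable_cst.
have E t' : `|a + noise j t'| ^+ 2 = `|a| ^+ 2 + (2 * dot (noise j t') a + `|noise j t'| ^+ 2).
  by rewrite (normD_sqr dotE) (dotC dot a) addrA.
under eq_integral do rewrite E.
have i2 := rintegrableD (rintegrableZ 2 ni) n2i.
rewrite -(EFin_Rintegral (rintegrableD ci i2)) lee_fin RintegralD//.
rewrite Rintegral_prob_cst RintegralD//; last exact: rintegrableZ.
by rewrite RintegralZl// nE mulr0 add0r lerD2l.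
Qed.

Lemma batch_mean_noise t :
  batch_mean uh (xis k) (fun=> x) t - u = m%:R^-1 *: noise_sum m t.
Proof.
have mn : m%:R != 0 :> R by rewrite pnatr_eq0 -lt0n.
rewrite /batch_mean /noise_sum /noise.
under [X in _ = _ *: X]eq_bigl do rewrite ltn_ord.
rewrite sumrB scalerBr sumr_const card_ord; congr (_ - _).
by rewrite -(scaler_nat m u) scalerA mulVf// scale1r.
Qed.

Lemma batch_noise_strongly_measurableT :
  strongly_measurable (fun t => batch_mean uh (xis k) (fun=> x) t - u).
Proof.
have -> : (fun t => batch_mean uh (xis k) (fun=> x) t - u) =
    (fun t => m%:R^-1 *: noise_sum m t) by apply/funext => t; exact: batch_mean_noise.
by apply: strongly_measurableZ; exact: noise_sum_strongly_measurableT.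
Qed.

Lemma batch_noise_dot v :
  P.-integrable setT (EFin \o (fun t => dot (batch_mean uh (xis k) (fun=> x) t - u) v)) /\
  \int[P]_t dot (batch_mean uh (xis k) (fun=> x) t - u) v = 0.
Proof.
have [ni nE] := noise_sum_dot m v.
have -> : (fun t => dot (batch_mean uh (xis k) (fun=> x) t - u) v) =
    (fun t => m%:R^-1 * dot (noise_sum m t) v).
  by apply/funext => t; rewrite batch_mean_noise dotZl.
by split; [exact: rintegrableZ|rewrite RintegralZl// nE mulr0].
Qed.

Lemma batch_noise_sqr :
  P.-integrable setT (EFin \o (fun t => `|batch_mean uh (xis k) (fun=> x) t - u| ^+ 2)) /\
  \int[P]_t (`|batch_mean uh (xis k) (fun=> x) t - u| ^+ 2) <= sigma ^+ 2 / m%:R.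
Proof.
have mn : m%:R != 0 :> R by rewrite pnatr_eq0 -lt0n.
have mS : measurable_fun setT (fun t => `|noise_sum m t| ^+ 2).
  by apply: measurable_funX; apply: strongly_measurable_norm; exact: noise_sum_strongly_measurableT.
have [si sE] := ge0_integral_le mS (fun t => sqr_ge0 _) (noise_sum_sqr (leqnn m)).
have -> : (fun t => `|batch_mean uh (xis k) (fun=> x) t - u| ^+ 2) =
    (fun t => (m%:R^-1) ^+ 2 * `|noise_sum m t| ^+ 2).
  by apply/funext => t; rewrite batch_mean_noise normrZ exprMn real_normK ?num_real.
split; first exact: rintegrableZ.
rewrite RintegralZl//; apply: le_trans (ler_wpM2l (sqr_ge0 _) sE) _.
by rewrite le_eqVlt; apply/orP; left; apply/eqP; field.
Qed.

End FixedPoint.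

(** * The gap of one step at a fixed point *)

Section OneStep.
Context (f : H -> R) (L D eps : R) (xs : H).
Hypotheses (L0 : 0 < L) (fL : forall x y, `|f x - f y| <= L * `|x - y|)
  (uh_subgradient : forall x, X x -> subdifferential dot f x (mean_subgrad x))
  (XD : forall x y, X x -> X y -> `|x - y| <= D) (Xxs : X xs) (eps0 : 0 < eps).

Local Notation M := (sigma ^+ 2 / m%:R).

Let M_ge0 : 0 <= M.
Proof. exact: divr_ge0 (sqr_ge0 _) (ler0n _ _). Qed.

(** No mean subgradient occurs in it: its measurability in the iterate needs only the continuity of
    [f]. *)
Definition step_gap (w g : R) (x b : H) : R :=
  w * (f x - f xs) + w * dot b (xs - x) + w * g / 2 * `|b| ^+ 2.

(** The first term is [D] times the clipping bias; the second uses that [M + L^2] bounds the second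
    moment of the clipped mean. *)
Definition step_mean (w g lam : R) : R :=
  w * (D * M * (1 + 1 / eps) / (4 * lam) + g / 2 * (M + L ^+ 2)).

(** The linear part of [q] varies by at most [2 D lam], since the clipped vector has norm at most
    [lam]; the quadratic part lies between 0 and [g / 2 * lam^2]. *)
Definition step_range (w g lam : R) : R := w * (2 * D * lam + g / 2 * lam ^+ 2).

(** A bound of the L2 norm of [q]. The linear part is at most [D] times the norm of the unclipped
    noise; in the quadratic part [|b|^2 <= lam |b|], so one factor keeps its second moment
    [M + L^2]. *)
Definition step_dev (w g lam : R) : R :=
  w * (D * Num.sqrt M + g / 2 * lam * Num.sqrt (M + L ^+ 2)).

Section Fixed.
Variables (x : H) (k : nat) (w g lam : R).
Hypotheses (Xx : X x) (k0 : (0 < k)%N) (w0 : 0 < w) (g0 : 0 < g)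
  (lamL : (1 + eps) * L <= lam).

Let u := mean_subgrad x.
Let y := xs - x.
Let n t := batch_mean uh (xis k) (fun=> x) t - u.
Let B t := clip (batch_mean uh (xis k) (fun=> x) t) lam.

Let D0 : 0 <= D.
Proof. by have := XD Xxs Xxs; rewrite subrr normr0. Qed.

Let lam0 : 0 < lam.
Proof. by apply: lt_le_trans lamL; rewrite mulr_gt0// addr_gt0. Qed.

Let uL : `|u| <= L.
Proof. exact: (subgradient_norm (ltW L0) dotE fL (uh_subgradient Xx)). Qed.

Let ulam : `|u| < lam.
Proof. by apply: le_lt_trans uL _; apply: lt_le_trans lamL; rewrite mulrDl mul1r ltrDl mulr_gt0. Qed.

Let yD : `|y| <= D. Proof. exact: XD. Qed.

Let n_sqr : P.-integrable setT (EFin \o (fun t => `|n t| ^+ 2)) /\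
  \int[P]_t (`|n t| ^+ 2) <= M.
Proof. exact: batch_noise_sqr. Qed.

(** The majorants of [q] and of [q^2] both have this form in the noise [n], so centredness and the
    variance bound are all they use. *)
Lemma affine_quadratic_integral a v kap : 0 <= kap ->
  P.-integrable setT (EFin \o (fun t => a + (dot (n t) v + kap * `|n t| ^+ 2))) /\
  \int[P]_t (a + (dot (n t) v + kap * `|n t| ^+ 2)) <= a + kap * M.
Proof.
move=> kap0; have [ni nE] := batch_noise_dot Xx k0 v; have [n2i n2] := n_sqr.
have ai : P.-integrable setT (EFin \o (fun _ : T => a)).
  by apply: finite_measure_integrable_cst.
have bi := rintegrableD ni (rintegrableZ kap n2i).
split; first exact: rintegrableD.
rewrite RintegralD// Rintegral_prob_cst RintegralD//; last exact: rintegrableZ.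
by rewrite nE add0r RintegralZl// lerD2l ler_wpM2l.
Qed.

Let clip_sqr t : `|B t| ^+ 2 <= L ^+ 2 + (dot (n t) (2 *: u) + `|n t| ^+ 2).
Proof.
have := @clip_dist _ _ dot dotE lam lam0 (batch_mean uh (xis k) (fun=> x) t) 0.
rewrite normr0 !subr0 => /(_ (ltW lam0)) /le_trans; apply.
rewrite -{1}(subrK u (batch_mean uh (xis k) (fun=> x) t)) (normD_sqr dotE) dotZr.
have : `|u| ^+ 2 <= L ^+ 2 by rewrite lerXn2r ?nnegrE ?(ltW L0).
rewrite -/(n t); lra.
Qed.

Let q t := w * dot (B t - u) y + w * g / 2 * `|B t| ^+ 2.

Let B_strongly_measurable : strongly_measurable B.
Proof.
have -> : B = (fun v => clip v lam) \o (fun t => n t + u).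
  by apply/funext => t /=; rewrite /n subrK.
apply: strongly_measurable_continuous; first exact: clip_continuous.
apply: strongly_measurableD; last exact: strongly_measurable_cst.
exact: batch_noise_strongly_measurableT.
Qed.

Let q_measurable : measurable_fun setT q.
Proof.
apply: measurable_funD; apply: measurable_funM => //.
  apply: strongly_measurable_dot => //; last exact: strongly_measurable_cst.
  by apply: strongly_measurableB => //; exact: strongly_measurable_cst.
by apply: measurable_funX; exact: strongly_measurable_norm.
Qed.

Let wg0 : 0 <= w * g / 2.
Proof. by rewrite divr_ge0// mulr_ge0// ltW. Qed.

Let B_sqr_lam t : `|B t| ^+ 2 <= lam ^+ 2.
Proof. by rewrite lerXn2r ?nnegrE ?(ltW lam0)// norm_clip. Qed.

Let B_dot t : `|dot (B t) y| <= D * lam.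
Proof.
apply: le_trans (cauchy_schwarz_norm dotE _ _) _.
by rewrite mulrC ler_pM// norm_clip.
Qed.

Let q_le t : q t <= w * (D * lam - dot u y) + w * g / 2 * lam ^+ 2.
Proof.
rewrite /q dotDl dotNl lerD ?ler_wpM2l//; first exact: ltW.
by rewrite lerD2r (le_trans (ler_norm _)).
Qed.

Let q_ge t : w * (- (D * lam) - dot u y) <= q t.
Proof.
rewrite /q dotDl dotNl; apply: ler_wpDr; first by rewrite mulr_ge0// sqr_ge0.
apply: ler_wpM2l; first exact: ltW.
by rewrite lerD2r; have := B_dot t; rewrite ler_norml => /andP[].
Qed.

Let q_bounded : exists C, forall t, `|q t| <= C.
Proof.
exists (`|w * (D * lam - dot u y) + w * g / 2 * lam ^+ 2| + `|w * (- (D * lam) - dot u y)|) => t.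
rewrite ler_norml; apply/andP; split.
  apply: le_trans (q_ge t).
  have := ler_norm (- (w * (- (D * lam) - dot u y))); rewrite normrN.
  have := normr_ge0 (w * (D * lam - dot u y) + w * g / 2 * lam ^+ 2).
  lra.
apply: le_trans (q_le t) _; apply: le_trans (ler_norm _) _.
by rewrite lerDl.
Qed.

Let q_integrable : P.-integrable setT (EFin \o q).
Proof. by have [C qC] := q_bounded; exact: bounded_integrable qC. Qed.

Let q_range t : q t - \int[P]_t q t <= step_range w g lam.
Proof.
have : w * (- (D * lam) - dot u y) <= \int[P]_t q t.
  rewrite -[leLHS](Rintegral_prob_cst P); apply: le_Rintegral => //.
  by apply: finite_measure_integrable_cst.
have := q_le t; rewrite /step_range; lra.
Qed.

Let q_mean : \int[P]_t q t <= step_mean w g lam.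
Proof.
pose b := D * (1 + 1 / eps) / (4 * lam).
have b0 : 0 <= b.
  by rewrite divr_ge0 ?mulr_ge0 ?(ltW lam0)// addr_ge0// divr_ge0// ltW.
have kap0 : 0 <= w * b + w * g / 2 by rewrite addr_ge0// mulr_ge0// ltW.
have [hi h] := affine_quadratic_integral (w * g / 2 * L ^+ 2)
  (w *: y + (w * g / 2) *: (2 *: u)) kap0.
apply: le_trans (@le_Rintegral _ _ _ P setT q _ measurableT q_integrable hi _) _.
  move=> t _.
  have bias : dot (B t - batch_mean uh (xis k) (fun=> x) t) y <= b * `|n t| ^+ 2.
    apply: le_trans (cauchy_schwarz dotE _ _) _.
    apply: (@le_trans _ _ ((`|n t| ^+ 2 / (4 * (lam - `|u|))) * D)).
      by apply: ler_pM => //; exact: clip_bias.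
    have d0 : 0 < lam - `|u| by rewrite subr_gt0.
    (* The difference of the two sides is [(lam - (1 + eps) |u|) / eps], nonnegative because
       [lam >= (1 + eps) L >= (1 + eps) |u|]. *)
    have le1 : lam <= (lam - `|u|) * (1 + 1 / eps).
      have : (1 + eps) * `|u| <= lam.
        by apply: le_trans lamL; rewrite ler_pM2l// addr_gt0.
      rewrite -(ler_pM2r eps0) => h'.
      have -> : (lam - `|u|) * (1 + 1 / eps) = lam + (lam - (1 + eps) * `|u|) / eps.
        by field; rewrite gt_eqF.
      by rewrite lerDl divr_ge0 ?(ltW eps0)// subr_ge0 -(ler_pM2r eps0).
    have le2 : (4 * (lam - `|u|))^-1 <= (1 + 1 / eps) / (4 * lam).
      rewrite -[leLHS]mul1r ler_pdivrMr ?mulr_gt0// mulrAC ler_pdivlMr ?mulr_gt0//.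
      move: le1; lra.
    have -> : b * `|n t| ^+ 2 = `|n t| ^+ 2 * ((1 + 1 / eps) / (4 * lam)) * D.
      by rewrite /b; ring.
    apply: ler_wpM2r => //; apply: ler_wpM2l => //; exact: sqr_ge0.
  have nE : dot (B t - u) y = dot (n t) y + dot (B t - batch_mean uh (xis k) (fun=> x) t) y.
    by rewrite -dotDl [n t + _]addrC subrKA.
  rewrite /q nE /= (dotDr dot (w *: y)) !dotZr.
  have := ler_wpM2l wg0 (clip_sqr t); rewrite dotZr.
  have := ler_wpM2l (ltW w0) bias.
  lra.
apply: le_trans h _; rewrite /step_mean -/M /b le_eqVlt; apply/orP; left; apply/eqP.
by ring.
Qed.

Let q_sqr : \int[P]_t (q t ^+ 2) <= step_dev w g lam ^+ 2.
Proof.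
rewrite /step_dev mulrDr.
(* Minkowski's inequality: Young's inequality holds pointwise for each [eta], and [eta] is optimized
   after integration. *)
apply: sqr_le_param => [||eta eta0].
- by rewrite mulr_ge0 ?(ltW w0)// mulr_ge0// sqrtr_ge0.
- by rewrite mulr_ge0 ?(ltW w0)// mulr_ge0 ?sqrtr_ge0// mulr_ge0 ?(ltW lam0)// divr_ge0// ltW.
have ei0 : 0 < eta^-1 by rewrite invr_gt0.
pose c1 := (1 + eta) * (w * D) ^+ 2.
pose c2 := (1 + eta^-1) * (w * g / 2 * lam) ^+ 2.
have c10 : 0 <= c1 by rewrite mulr_ge0 ?sqr_ge0// addr_ge0// ltW.
have c20 : 0 <= c2 by rewrite mulr_ge0 ?sqr_ge0// addr_ge0// ltW.
have [hi h] := affine_quadratic_integral (c2 * L ^+ 2) (c2 *: (2 *: u)) (addr_ge0 c10 c20).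
have [C qC] := q_bounded.
have q2i : P.-integrable setT (EFin \o (fun t => q t ^+ 2)).
  apply: (@bounded_integrable _ _ _ _ _ (C ^+ 2)); first exact: measurable_funX.
  by move=> t; rewrite normrX lerXn2r// nnegrE// (le_trans _ (qC t)).
apply: le_trans (@le_Rintegral _ _ _ P setT _ _ measurableT q2i hi _) _.
  move=> t _.
  have young (a b : R) : (a + b) ^+ 2 <= (1 + eta) * a ^+ 2 + (1 + eta^-1) * b ^+ 2.
    have -> : (1 + eta) * a ^+ 2 + (1 + eta^-1) * b ^+ 2 =
        (a + b) ^+ 2 + eta * (a - eta^-1 * b) ^+ 2 by field; rewrite gt_eqF.
    by rewrite lerDl mulr_ge0 ?sqr_ge0// ltW.
  apply: le_trans (young _ _) _.
  have h1 : (w * dot (B t - u) y) ^+ 2 <= (w * D) ^+ 2 * `|n t| ^+ 2.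
    rewrite [leLHS]exprMn.
    have -> : (w * D) ^+ 2 * `|n t| ^+ 2 = w ^+ 2 * (D ^+ 2 * `|n t| ^+ 2) by ring.
    apply: ler_wpM2l; first exact: sqr_ge0.
    apply: le_trans (dot_sqr_le dotE _ _) _; rewrite mulrC.
    apply: ler_pM; rewrite ?sqr_ge0//; first by rewrite lerXn2r// nnegrE.
    by apply: clip_dist => //; exact: ltW.
  have h2 : (w * g / 2 * `|B t| ^+ 2) ^+ 2 <= (w * g / 2 * lam) ^+ 2 * `|B t| ^+ 2.
    have -> : (w * g / 2 * `|B t| ^+ 2) ^+ 2 =
      (w * g / 2) ^+ 2 * (`|B t| ^+ 2 * `|B t| ^+ 2) by ring.
    have -> : (w * g / 2 * lam) ^+ 2 * `|B t| ^+ 2 =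
      (w * g / 2) ^+ 2 * (lam ^+ 2 * `|B t| ^+ 2) by ring.
    apply: ler_wpM2l; first exact: sqr_ge0.
    by apply: ler_wpM2r => //; exact: sqr_ge0.
  apply: (@le_trans _ _ (c1 * `|n t| ^+ 2 + c2 * `|B t| ^+ 2)).
    rewrite /c1 /c2 -(mulrA (1 + eta)) -(mulrA (1 + eta^-1)).
    by apply: lerD; apply: ler_wpM2l => //; rewrite addr_ge0// ltW.
  have := ler_wpM2l c20 (clip_sqr t); rewrite !dotZr; lra.
apply: le_trans h _; rewrite le_eqVlt; apply/orP; left; apply/eqP.
have -> : (w * (D * Num.sqrt M)) ^+ 2 = (w * D) ^+ 2 * M.
  by have := sqr_sqrtr M_ge0; move: (Num.sqrt M) => r <-; ring.
have -> : (w * (g / 2 * lam * Num.sqrt (M + L ^+ 2))) ^+ 2 =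
    (w * (g / 2 * lam)) ^+ 2 * (M + L ^+ 2).
  have := sqr_sqrtr (addr_ge0 M_ge0 (sqr_ge0 L)).
  by move: (Num.sqrt (M + L ^+ 2)) => r <-; ring.
by rewrite /c1 /c2; move: M => M'; field; rewrite gt_eqF.
Qed.

(** The subgradient inequality at [xs] puts the gap below [q]. A range [c] larger than that of this
    step is allowed because one pair [s], [c] must serve all steps. *)
Lemma step_mgf c s : step_range w g lam <= c -> 0 <= c -> 0 < s -> s * c < 3 ->
  (\int[P]_t (expR (s * step_gap w g x (B t)))%:E <=
   (expR (s * step_mean w g lam +
     s ^+ 2 * step_dev w g lam ^+ 2 / (2 * (1 - s * c / 3))))%:E)%E.
Proof.
move=> rc c0 s0 sc3; have [C qC] := q_bounded.
apply: le_trans (bernstein_mgf q_measurable qC q_mean _ q_sqr c0 s0 sc3); last first.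
  by move=> t; apply: le_trans (q_range t) rc.
apply: ge0_le_integral => //.
- apply/measurable_EFinP; apply: measurableT_comp => //; apply: measurable_funM => //.
  apply: measurable_funD; first apply: measurable_funD => //.
    apply: measurable_funM => //; apply: strongly_measurable_dot => //.
    exact: strongly_measurable_cst.
  apply: measurable_funM => //; apply: measurable_funX; exact: strongly_measurable_norm.
- apply/measurable_EFinP; apply: measurableT_comp => //; exact: measurable_funM.
move=> t _; rewrite lee_fin ler_expR ler_pM2l// /step_gap /q lerD2r -mulrDr ler_pM2l//.
have := uh_subgradient Xx xs; rewrite -/u -/y (dotC dot y) dotDl dotNl; lra.
Qed.

End Fixed.

(** * The trajectory *)

Section Trajectory.
Hypotheses (Xclosed : closed X) (Xconvex : convex_set X) (Xbounded : bounded_set X)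
  (fconvex : convex_function [set: H] f).
Context (w gam lam : nat -> R) (x1 : H) (x : nat -> T -> H).
Hypotheses (Xx1 : X x1) (w0 : forall k, (0 < k)%N -> 0 < w k)
  (gam0 : forall k, (0 < k)%N -> 0 < gam k)
  (lamL : forall k, (0 < k)%N -> (1 + eps) * L <= lam k)
  (iter : cssgm X uh xis gam lam x1 x).

Let X0 : X !=set0. Proof. by exists xs. Qed.

Let lam0 k : (0 < k)%N -> 0 < lam k.
Proof. by move=> k0; apply: lt_le_trans (lamL k0); rewrite mulr_gt0// addr_gt0. Qed.

(** The draws strictly before time [k]: they determine [x_k], but not the clipped mean at time [k].
    Time 0 lies outside the independent family. *)
Definition past (k : nat) : set (nat * 'I_m) := [set i | (0 < i.1 < k)%N].

Local Notation TS k := (g_sigma_algebraType (cylinders draw (past k))).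

Lemma iterate_in k t : (0 < k)%N -> X (x k t).
Proof.
case: iter => xE xS; case: k => // -[|k] _; first by rewrite xE.
by rewrite xS//; apply: (projection_in dotE).
Qed.

Definition clipped (k : nat) (t : T) : H := clip (batch_mean uh (xis k) (x k) t) (lam k).

(** The source space is arbitrary because the clipped mean is needed on the space of past draws, on
    the product of past and present, and with a frozen iterate. *)
Lemma batch_clipped_measurable d0 (S : measurableType d0) k (y : S -> H) (z : 'I_m -> S -> Z) :
  (0 < k)%N -> strongly_measurable y -> (forall t, X (y t)) ->
  (forall j, measurable_fun setT (z j)) ->
  strongly_measurable (fun t => clip (batch_mean uh z y t) (lam k)).
Proof.
move=> k0 my Xy mz.
apply: (@strongly_measurable_continuous _ _ _ _ (batch_mean uh z y) (fun v => clip v (lam k))).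
  exact: clip_continuous (lam0 k0).
apply: strongly_measurableZ; apply: strongly_measurable_sum => j _.
exact: (jointly_measurable_comp uh_measurable my Xy (mz j)).
Qed.

(** Stated for every [n >= k], so that all iterates of a sum are measurable for one and the same
    sigma-algebra. *)
Lemma iterate_measurable k n : (0 < k <= n)%N -> strongly_measurable (x k : TS n -> H).
Proof.
case: iter => xE xS; case/andP; elim: k n => // -[|k] ih n _ kn.
  have -> : x 1 = fun=> x1 by apply/funext => t; exact: xE.
  exact: strongly_measurable_cst.
have -> : x k.+2 = projection X \o (fun t => x k.+1 t - gam k.+1 *: clipped k.+1 t).
  by apply/funext => t /=; rewrite xS.
apply: strongly_measurable_continuous; first exact: (projection_continuous dotE).
have mx := ih n isT (ltnW kn).
apply: strongly_measurableB => //; apply: strongly_measurableZ.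
apply: batch_clipped_measurable => // [t|j]; first exact: iterate_in.
apply: (@cylinders_coordinate_measurable _ _ _ _ _ draw (past n) (k.+1, j)).
by rewrite /past/=.
Qed.

Lemma clipped_measurable k n : (0 < k < n)%N -> strongly_measurable (clipped k : TS n -> H).
Proof.
case/andP=> k0 kn; apply: batch_clipped_measurable => // [|t|j].
- by apply: iterate_measurable; rewrite k0 ltnW.
- exact: iterate_in.
apply: (@cylinders_coordinate_measurable _ _ _ _ _ draw (past n) (k, j)).
by rewrite /past/= k0.
Qed.

Definition gap_sum (k : nat) (t : T) : R :=
  \sum_(1 <= i < k.+1) step_gap (w i) (gam i) (x i t) (clipped i t).

Lemma f_continuous : continuous f. Proof. exact: lipschitz_continuous fL. Qed.

Lemma step_gap_measurable d0 (S : measurableType d0) a b (y v : S -> H) :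
  strongly_measurable y -> strongly_measurable v ->
  measurable_fun setT (fun t => step_gap a b (y t) (v t)).
Proof.
move=> my mv; apply: measurable_funD; first apply: measurable_funD.
- apply: measurable_funM => //; apply: measurable_funB => //.
  exact: (strongly_measurable_real f_continuous my).
- apply: measurable_funM => //; apply: strongly_measurable_dot => //.
  by apply: strongly_measurableB => //; exact: strongly_measurable_cst.
- apply: measurable_funM => //; apply: measurable_funX; exact: strongly_measurable_norm.
Qed.

Lemma gap_sum_measurable k n : (k < n)%N -> measurable_fun setT (gap_sum k : TS n -> R).
Proof.
move=> kn.
have -> : gap_sum k = fun t => \sum_(i < k) step_gap (w i.+1) (gam i.+1) (x i.+1 t) (clipped i.+1 t).
  by apply/funext => t; rewrite /gap_sum big_add1 big_mkord.
apply: measurable_sum => i; apply: step_gap_measurable.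
  by apply: iterate_measurable => /=; rewrite (leq_trans (ltn_ord i))// ltnW.
by apply: clipped_measurable => /=; rewrite (leq_ltn_trans (ltn_ord i)).
Qed.

Lemma measurable_past n d0 (S : measurableType d0) (h : TS n -> S) :
  measurable_fun setT h -> @measurable_fun _ _ T S setT h.
Proof.
by move=> mh _ B mB; exact: (g_cylinders_measurable measurable_draw (mh measurableT _ mB)).
Qed.

Lemma gap_sum_mgf k c s : (forall i, (0 < i <= k)%N -> step_range (w i) (gam i) (lam i) <= c) ->
  0 <= c -> 0 < s -> s * c < 3 ->
  (\int[P]_t (expR (s * gap_sum k t))%:E <=
   (expR (\sum_(1 <= i < k.+1) (s * step_mean (w i) (gam i) (lam i) +
     s ^+ 2 * step_dev (w i) (gam i) (lam i) ^+ 2 / (2 * (1 - s * c / 3)))))%:E)%E.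
Proof.
move=> + c0 s0 sc3; elim: k => [_|k ih rc].
  under eq_integral do rewrite /gap_sum big_geq// mulr0 expR0.
  by rewrite big_geq// expR0 integral_cst// [X in (_ * X)%E](probability_setT P) mule1.
rewrite big_nat_recr//= expRD.
set E := expR (\sum_(1 <= i < k.+1) _); set F := expR (_ + _).
have mS : measurable_fun setT (fun t => expR (s * gap_sum k t)).
  apply: measurableT_comp => //; apply: measurable_funM => //.
  exact: (measurable_past (gap_sum_measurable (ltnSn k))).
pose now : set (nat * 'I_m) := [set i | i.1 = k.+1].
(* On the diagonal this is the exponential of the whole sum; with the first variable frozen, only
   the batch of step [k + 1] is random and [step_mgf] applies. *)
pose g (z : TS k.+1 * g_sigma_algebraType (cylinders draw now)) : \bar R :=
  (expR (s * gap_sum k z.1) * expR (s * step_gap (w k.+1) (gam k.+1) (x k.+1 z.1)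
    (clip (batch_mean uh (xis k.+1) (fun=> x k.+1 z.1) z.2) (lam k.+1))))%:E.
have -> : (\int[P]_t (expR (s * gap_sum k.+1 t))%:E = \int[P]_t g (t, t))%E.
  by apply: eq_integral => t _; rewrite /g/= -expRD -mulrDr /gap_sum big_nat_recr.
apply: (@le_trans _ _ (\int[P]_t (expR (s * gap_sum k t) * F)%:E)%E); last first.
  under eq_integral do rewrite EFinM.
  have mSE : measurable_fun setT (fun t => (expR (s * gap_sum k t))%:E).
    exact/measurable_EFinP.
  rewrite (ge0_integralZr P measurableT mSE (k := F%:E) (fun t _ => expR_ge0 _) (expR_ge0 _)).
  rewrite EFinM lee_wpmul2r ?lee_fin ?expR_ge0//; apply: ih => i /andP[i0 ik].
  by apply: rc; rewrite i0 leqW.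
apply: (fubini_independent_le measurable_draw xis_independent (J := past k.+1) (J' := now)).
- by move=> [a b] /= /andP[].
- by move=> [a b]; rewrite /now/= => ->.
- apply/seteqP; split=> // -[a b] [/= /andP[_ +] ak].
  by rewrite (_ : a = k.+1)// ltnn.
- apply/measurable_EFinP; apply: measurable_funM.
    apply: (measurableT_comp (f := expR)) => //; apply: measurable_funM => //.
    exact: (measurableT_comp (gap_sum_measurable (ltnSn k)) measurable_fst).
  apply: (measurableT_comp (f := expR)) => //; apply: measurable_funM => //.
  have mx : strongly_measurable (fun z : TS k.+1 * g_sigma_algebraType (cylinders draw now) => x k.+1 z.1).
    apply: (strongly_measurable_comp measurable_fst).
    by apply: iterate_measurable; rewrite leqnn.
  apply: step_gap_measurable => //.
  apply: (@batch_clipped_measurable _ _ k.+1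
    (fun z : TS k.+1 * g_sigma_algebraType (cylinders draw now) => x k.+1 z.1)
    (fun j z => xis k.+1 j z.2)) => // [z|j]; first exact: iterate_in.
  apply: (measurableT_comp _ measurable_snd).
  exact: (@cylinders_coordinate_measurable _ _ _ _ _ draw now (k.+1, j)).
- by move=> z; rewrite lee_fin mulr_ge0 ?expR_ge0.
- by apply/measurable_EFinP; exact: measurable_funM.
move=> t; rewrite /g/=.
under eq_integral do rewrite EFinM.
have mB : measurable_fun setT (fun t' => (expR (s * step_gap (w k.+1) (gam k.+1) (x k.+1 t)
    (clip (batch_mean uh (xis k.+1) (fun=> x k.+1 t) t') (lam k.+1))))%:E).
  apply/measurable_EFinP; apply: (measurableT_comp (f := expR)) => //.
  apply: measurable_funM => //; apply: step_gap_measurable.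
    exact: strongly_measurable_cst.
  apply: (@batch_clipped_measurable _ _ k.+1 (fun=> x k.+1 t)) => // [|z].
    exact: strongly_measurable_cst.
  exact: iterate_in.
rewrite (ge0_integralZl P measurableT mB (k := (expR (s * gap_sum k t))%:E) (fun t _ => expR_ge0 _) (expR_ge0 _)).
rewrite EFinM lee_wpmul2l ?lee_fin ?expR_ge0//.
apply: step_mgf => //; rewrite ?w0 ?gam0 ?lamL//; first exact: iterate_in.
by apply: rc; rewrite leqnn.
Qed.

Lemma regret_gap_sum k t : (0 < k)%N ->
  (forall i, (0 < i < k)%N -> w i / gam i <= w i.+1 / gam i.+1) ->
  \sum_(1 <= i < k.+1) w i * (f (x i t) - f xs) <=
    D ^+ 2 / 2 * (w k / gam k) + gap_sum k t.
Proof.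
case: iter => _ xS.
pose a i := `|x i t - xs| ^+ 2; pose r i := w i / gam i.
have aD i : (0 < i)%N -> a i <= D ^+ 2.
  move=> i0; have xD := XD (iterate_in t i0) Xxs.
  by rewrite lerXn2r ?nnegrE// (le_trans _ xD).
have r0 i : (0 < i)%N -> 0 < r i by move=> i0; rewrite divr_gt0 ?w0 ?gam0.
have step i : (0 < i)%N -> w i * (f (x i t) - f xs) <=
    step_gap (w i) (gam i) (x i t) (clipped i t) + r i / 2 * (a i - a i.+1).
  move=> i0; have g0 := gam0 i0; have wi0 := w0 i0.
  have le_a : a i.+1 <= a i - 2 * gam i * dot (clipped i t) (x i t - xs) +
      gam i ^+ 2 * `|clipped i t| ^+ 2.
    rewrite /a xS// -/(clipped i t).
    apply: (@le_trans _ _ (`|x i t - gam i *: clipped i t - xs| ^+ 2)).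
      rewrite lerXn2r ?nnegrE//.
      exact: (projection_dist dotE X0 Xclosed Xconvex Xbounded _ Xxs).
    rewrite addrAC (normB_sqr dotE (x i t - xs)) dotZr normrZ exprMn real_normK ?num_real//.
    by rewrite (dotC dot _ (clipped i t)) mulrA.
  have h : r i / 2 * (2 * gam i * dot (clipped i t) (x i t - xs) -
      gam i ^+ 2 * `|clipped i t| ^+ 2) <= r i / 2 * (a i - a i.+1).
    rewrite ler_wpM2l ?divr_ge0 ?(ltW (r0 _ i0))//; move: le_a; lra.
  have e : r i / 2 * (2 * gam i * dot (clipped i t) (x i t - xs) -
      gam i ^+ 2 * `|clipped i t| ^+ 2) =
      w i * dot (clipped i t) (x i t - xs) - w i * gam i / 2 * `|clipped i t| ^+ 2.
    by rewrite /r; field; rewrite gt_eqF.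
  move: h; rewrite e /step_gap -(opprB (x i t) xs) dotNr; lra.
move=> k0 rmono.
(* Summation by parts: the induction keeps [- r_k a_(k+1) / 2], so that the next step costs
   [(r_(k+1) - r_k) a_(k+1) / 2], at most the same with [D^2] in place of [a_(k+1)]. *)
suff h : \sum_(1 <= i < k.+1) w i * (f (x i t) - f xs) <=
    D ^+ 2 / 2 * r k - r k / 2 * a k.+1 + gap_sum k t.
  apply: le_trans h _; rewrite lerD2r gerBl mulr_ge0 ?sqr_ge0// divr_ge0// ltW//.
  exact: r0.
case: k k0 rmono => // k _; elim: k => [_|k ih rmono].
  rewrite /gap_sum !big_nat1; apply: le_trans (step 1%N isT) _.
  rewrite addrC lerD2r.
  have : r 1%N * a 1%N <= r 1%N * D ^+ 2 by rewrite ler_wpM2l ?aD// ltW// r0.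
  lra.
have /ih : forall i, (0 < i < k.+1)%N -> w i / gam i <= w i.+1 / gam i.+1.
  by move=> i /andP[i0 ik]; apply: rmono; rewrite i0 leqW.
move=> {}ih.
have := step k.+2 isT; have := rmono k.+1; rewrite ltnSn => /(_ isT).
rewrite -/(r k.+1) -/(r k.+2) => rle.
have : (r k.+2 - r k.+1) * a k.+2 <= (r k.+2 - r k.+1) * D ^+ 2.
  by rewrite ler_wpM2l ?aD// subr_ge0.
move: ih; rewrite /gap_sum (@big_nat_recr _ _ _ k.+2 1 _)//= [X in _ -> _ -> _ -> _ <= _ + X](@big_nat_recr _ _ _ k.+2 1)//=; lra.
Qed.

Lemma gap_sum_tail k c l V : (0 < k)%N -> 0 < l -> 0 < c -> 0 < V ->
  (forall i, (0 < i <= k)%N -> step_range (w i) (gam i) (lam i) <= c) ->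
  \sum_(1 <= i < k.+1) step_dev (w i) (gam i) (lam i) ^+ 2 <= V ->
  ((1 - expR (- l))%:E <= P [set t | (gap_sum k t <=
    \sum_(1 <= i < k.+1) step_mean (w i) (gam i) (lam i)
      + (c * l / 3 + Num.sqrt (2 * V * l)))%R])%E.
Proof.
move=> k0 l0 c0 V0 rc sV; set mu := \sum_(1 <= i < k.+1) step_mean _ _ _.
set tau := c * l / 3 + _.
have [s [s0 sc3 sE]] := chernoff_parameter c0 V0 l0.
have mS : @measurable_fun _ _ T R setT (gap_sum k) := measurable_past (gap_sum_measurable (ltnSn k)).
pose A := [set t | gap_sum k t <= mu + tau].
have mA : measurable A.
  by rewrite -[A]setTI; apply: measurable_fun_le.
have PAc : (P (~` A) <= (expR (- l))%:E)%E.
  have mE : measurable_fun setT (fun t => (expR (s * gap_sum k t))%:E).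
    apply/measurable_EFinP; apply: measurableT_comp => //; exact: measurable_funM.
  have q0 : 0 < 1 - s * c / 3 by rewrite subr_gt0 ltr_pdivrMr// mul1r.
  (* Markov's inequality: the indicator of the bad event is at most
     [expR (s * (gap_sum k - mu - tau))]. *)
  apply: (@le_trans _ _ ((expR (- (s * (mu + tau))))%:E * \int[P]_t (expR (s * gap_sum k t))%:E)%E).
    rewrite -(ge0_integralZl P measurableT mE (k := (expR (- (s * (mu + tau))))%:E)
      (fun t _ => expR_ge0 _) (expR_ge0 _)).
    rewrite -(setIT (~` A)) -integral_indic//; last exact: measurableC.
    apply: ge0_le_integral => //.
    - by apply/measurable_EFinP; apply: measurable_indic; exact: measurableC.
    - exact: emeasurable_funM.
    move=> t _; rewrite -EFinM lee_fin -expRD indicE.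
    case: (boolP (t \in ~` A)) => [|_]; last exact: expR_ge0.
    rewrite inE /A/= => /negP; rewrite -ltNge => tA.
    rewrite -[leLHS]expR0 ler_expR addrC subr_ge0 ler_pM2l// ltW//.
  have mg := gap_sum_mgf rc (ltW c0) s0 sc3.
  apply: le_trans (lee_wpmul2l _ mg) _; first by rewrite lee_fin expR_ge0.
  rewrite -EFinM lee_fin -expRD ler_expR big_split/= -mulr_sumr -/mu.
  rewrite -mulr_suml -mulr_sumr mulrDr.
  have : s ^+ 2 * (\sum_(1 <= i < k.+1) step_dev (w i) (gam i) (lam i) ^+ 2) /
      (2 * (1 - s * c / 3)) <= s ^+ 2 * V / (2 * (1 - s * c / 3)).
    by rewrite ler_wpM2r ?invr_ge0 ?mulr_ge0 ?(ltW q0)// ler_wpM2l ?sqr_ge0.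
  (* [sE] says that [s * tau] exceeds the variance term by exactly [l], so the total exponent is at
     most [- l]. *)
  move: sE; rewrite -/tau; lra.
rewrite -/A.
have -> : P A = (1 - P (~` A))%E by rewrite -probability_setC ?setCK//; exact: measurableC.
by rewrite EFinB leeB.
Qed.

Lemma error_measurable k : (0 < k)%N ->
  measurable_fun setT (fun t => f (average w x k t)).
Proof.
move=> k0; apply: (strongly_measurable_real f_continuous).
have -> : average w x k = fun t => (\sum_(1 <= i < k.+1) w i)^-1 *:
    \sum_(i < k) w i.+1 *: x i.+1 t.
  by apply/funext => t; rewrite /average [in X in _ *: X]big_add1 big_mkord.
apply: strongly_measurableZ; apply: strongly_measurable_sum => i _.
apply: strongly_measurableZ.
have mx : strongly_measurable (x i.+1 : TS k.+1 -> H).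
  by apply: iterate_measurable => /=; rewrite leqW.
exact: (strongly_measurable_comp (@cylinders_id_measurable _ _ _ _ _ _ measurable_draw (past k.+1)) mx).
Qed.

(** [a] and [b] bound the Euclidean norms of [(w_i)] and [(w_i gam_i lam_i)]. Minkowski's inequality
    over the steps, again through [sqr_le_param], bounds the norm of the deviations by [v], linear
    in [a] and [b]; Jensen's inequality then passes to the average. *)
Lemma high_probability_bound k l a b c bound : (0 < k)%N -> 0 < l ->
  (forall i, (0 < i < k)%N -> w i / gam i <= w i.+1 / gam i.+1) ->
  0 <= a -> 0 <= b -> 0 < c ->
  (forall i, (0 < i <= k)%N -> step_range (w i) (gam i) (lam i) <= c) ->
  \sum_(1 <= i < k.+1) w i ^+ 2 <= a ^+ 2 ->
  \sum_(1 <= i < k.+1) (w i * gam i * lam i) ^+ 2 <= b ^+ 2 ->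
  D ^+ 2 / 2 * (w k / gam k) + \sum_(1 <= i < k.+1) step_mean (w i) (gam i) (lam i)
    + c * l / 3 + Num.sqrt (2 * l) * (D * Num.sqrt M * a + Num.sqrt (M + L ^+ 2) / 2 * b)
    <= (\sum_(1 <= i < k.+1) w i) * bound ->
  ((1 - expR (- l))%:E <= P [set t | (f (average w x k t) - f xs <= bound)%R])%E.
Proof.
move=> k0 l0 rmono a0 b0 c0 rc wa wb le_bound.
have D0 : 0 <= D by have := XD Xxs Xxs; rewrite subrr normr0.
set A := Num.sqrt M in le_bound; set B := Num.sqrt (M + L ^+ 2) in le_bound.
have A0 : 0 <= A by exact: sqrtr_ge0.
have B0 : 0 < B by rewrite sqrtr_gt0 ltr_wpDl ?M_ge0// exprn_gt0.
pose W := \sum_(1 <= i < k.+1) w i.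
have wk := w0 k0; have gk := gam0 k0; have lk := lam0 k0.
have W0 : 0 < W.
  rewrite /W big_nat_recr//= ltr_wpDl// big_nat sumr_ge0// => i /andP[i0 _].
  by rewrite ltW// w0.
(* The [k]-th summand is positive. This makes [v] positive even if [sigma] or [D] is 0, as the
   choice of the Chernoff parameter requires. *)
have b_gt0 : 0 < b.
  rewrite lt_def b0 andbT; apply/eqP => bE; move: wb; rewrite bE expr0n/= big_nat_recr//=.
  rewrite leNgt => /negP; apply; rewrite ltr_wpDl//.
    by apply: sumr_ge0 => i _; exact: sqr_ge0.
  by rewrite exprn_gt0// !mulr_gt0.
pose v := D * A * a + B / 2 * b.
have v0 : 0 < v by rewrite ltr_wpDl ?mulr_ge0// mulr_gt0// divr_gt0.
have sv : \sum_(1 <= i < k.+1) step_dev (w i) (gam i) (lam i) ^+ 2 <= v ^+ 2.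
  apply: sqr_le_param => [||eta eta0]; rewrite ?mulr_ge0 ?divr_ge0 ?(ltW B0)//.
  apply: (@le_trans _ _ (\sum_(1 <= i < k.+1) ((1 + eta) * (D * A) ^+ 2 * w i ^+ 2 +
     (1 + eta^-1) * (B / 2) ^+ 2 * (w i * gam i * lam i) ^+ 2))).
    apply: ler_sum => i _; rewrite /step_dev -/A -/B.
    have -> : (1 + eta) * (D * A) ^+ 2 * w i ^+ 2 +
        (1 + eta^-1) * (B / 2) ^+ 2 * (w i * gam i * lam i) ^+ 2 =
        (w i * (D * A + gam i / 2 * lam i * B)) ^+ 2 +
        eta * (w i * (D * A) - eta^-1 * (w i * (gam i / 2 * lam i * B))) ^+ 2.
      by field; rewrite gt_eqF.
    by rewrite lerDl mulr_ge0 ?sqr_ge0// ltW.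
  rewrite big_split/= -!mulr_sumr; apply: lerD.
    have -> : (1 + eta) * (D * A * a) ^+ 2 = (1 + eta) * (D * A) ^+ 2 * a ^+ 2 by ring.
    apply: ler_wpM2l => //.
    by rewrite mulr_ge0 ?sqr_ge0// addr_ge0// ltW.
  have -> : (1 + eta^-1) * (B / 2 * b) ^+ 2 = (1 + eta^-1) * (B / 2) ^+ 2 * b ^+ 2 by ring.
  apply: ler_wpM2l => //.
  by rewrite mulr_ge0 ?sqr_ge0// addr_ge0// ltW// invr_gt0.
have V0 : 0 < v ^+ 2 by rewrite exprn_gt0.
apply: le_trans (gap_sum_tail k0 l0 c0 V0 rc sv) _.
have mS : @measurable_fun _ _ T R setT (gap_sum k) := measurable_past (gap_sum_measurable (ltnSn k)).
apply: le_measure; rewrite ?inE.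
- by rewrite -[X in measurable X]setTI; apply: measurable_fun_le.
- rewrite -[X in measurable X]setTI; apply: measurable_fun_le => //.
  by apply: measurable_funB => //; exact: error_measurable.
move=> t /= le_gap; rewrite -(ler_pM2l W0) -/W; apply: le_trans le_bound.
have jen := jensen_average x t fconvex w0 k0; rewrite -/W in jen.
have reg := regret_gap_sum t k0 rmono.
have sq : Num.sqrt (2 * v ^+ 2 * l) = Num.sqrt (2 * l) * v.
  rewrite mulrAC sqrtrM; last by rewrite mulr_ge0// ltW.
  by rewrite sqrtr_sqr ger0_norm// ltW.
rewrite sq in le_gap.
have jen' : W * f (average w x k t) <= \sum_(1 <= i < k.+1) w i * f (x i t).
  by rewrite -ler_pdivlMl.
have regE : \sum_(1 <= i < k.+1) w i * (f (x i t) - f xs) =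
    \sum_(1 <= i < k.+1) w i * f (x i t) - W * f xs.
  by under eq_bigr do rewrite mulrBr; rewrite sumrB /W mulr_suml.
move: reg; rewrite regE mulrBr -/v; move: le_gap jen'; lra.
Qed.

(* [high_probability_bound] is sharper: there the range term has the factor 1/3 and the
   noise term lacks [4 (1 + 1/eps)]. *)
Lemma rate_bound k l gamma S T0 m1 m2 n1 n2 rest : 0 <= sigma -> (0 < k)%N -> 0 < l ->
  0 < gamma -> 0 < S -> 0 <= n1 -> 0 <= n2 -> 0 <= rest ->
  (forall i, (0 < i < k)%N -> w i / gam i <= w i.+1 / gam i.+1) ->
  w k / gam k <= S / gamma ->
  (forall i, (0 < i <= k)%N -> w i * lam i <= S * m1) ->
  (forall i, (0 < i <= k)%N -> w i * gam i * lam i ^+ 2 <= gamma * S * m2) ->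
  \sum_(1 <= i < k.+1) w i ^+ 2 <= (S * n1) ^+ 2 ->
  \sum_(1 <= i < k.+1) (w i * gam i * lam i) ^+ 2 <= (gamma * S * n2) ^+ 2 ->
  \sum_(1 <= i < k.+1) step_mean (w i) (gam i) (lam i) <= S * rest ->
  S <= T0 * \sum_(1 <= i < k.+1) w i ->
  ((1 - expR (- l))%:E <= P [set t | (f (average w x k t) - f xs <= T0 *
    (D ^+ 2 / (2 * gamma) + 2 / 3 * (2 * D * m1 + gamma * m2) * l
     + 1 / Num.sqrt 2 * (4 * (1 + 1 / eps) * (D * sigma / Num.sqrt m%:R) * n1
         + gamma * n2 * Num.sqrt (M + L ^+ 2)) * Num.sqrt l
     + rest))%R])%E.
Proof.
move=> sigma0 k0 l0 gamma0 S0 n10 n20 rest0 rmono wgk wl wgl ww wgl2 mean SW.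
have D0 : 0 <= D by have := XD Xxs Xxs; rewrite subrr normr0.
have wk := w0 k0; have gk := gam0 k0; have lk := lam0 k0.
have kk : (0 < k <= k)%N by rewrite k0 leqnn.
have m1_gt0 : 0 < m1.
  by rewrite -(pmulr_rgt0 _ S0); apply: lt_le_trans (wl k kk); exact: mulr_gt0.
have m2_gt0 : 0 < m2.
  rewrite -(pmulr_rgt0 _ (mulr_gt0 gamma0 S0)); apply: lt_le_trans (wgl k kk).
  by rewrite !mulr_gt0// exprn_gt0.
have dm : 0 <= 2 * D * m1 by rewrite !mulr_ge0// ltW.
have gm : 0 < gamma * m2 by exact: mulr_gt0.
(* [S] is the common order of growth in [k] of all terms, [T0] bounds its ratio to the sum of the
   weights, and [m1], [m2], [n1], [n2], [rest] are what remains after dividing by [S]. *)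
pose c := S * (2 * D * m1 + gamma * m2).
have c0 : 0 < c by rewrite mulr_gt0// ltr_wpDl.
have rc i : (0 < i <= k)%N -> step_range (w i) (gam i) (lam i) <= c.
  move=> ik; have i0 : (0 < i)%N by case/andP: ik.
  have := ler_wpM2l D0 (wl i ik); have := wgl i ik.
  have : 0 < w i * gam i * lam i ^+ 2 by rewrite mulr_gt0 ?exprn_gt0 ?lam0// mulr_gt0 ?w0 ?gam0.
  by rewrite /step_range /c; lra.
apply: (high_probability_bound k0 l0 rmono _ _ c0 rc ww wgl2).
- by rewrite mulr_ge0// ltW.
- by rewrite !mulr_ge0// ltW.
set br := (X in _ <= _ * (T0 * X)).
have sM : Num.sqrt M = sigma / Num.sqrt m%:R.
  by rewrite sqrtrM ?sqr_ge0// sqrtr_sqr ger0_norm// sqrtrV.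
have sl : Num.sqrt (2 * l) = Num.sqrt 2 * Num.sqrt l by rewrite sqrtrM.
have s2 : 1 / Num.sqrt 2 = Num.sqrt 2 / 2 :> R.
  have s20 : 0 < Num.sqrt 2 :> R by rewrite sqrtr_gt0.
  rewrite -{3}(@sqr_sqrtr R 2)//; field; rewrite gt_eqF//.
pose x1' := D * (sigma / Num.sqrt m%:R) * n1.
have x10 : 0 <= x1' by rewrite !mulr_ge0// divr_ge0// sqrtr_ge0.
pose z := Num.sqrt 2 * Num.sqrt l.
have z0 : 0 <= z by rewrite mulr_ge0 ?sqrtr_ge0.
have brS : D ^+ 2 / 2 * (w k / gam k) + \sum_(1 <= i < k.+1) step_mean (w i) (gam i) (lam i)
    + c * l / 3 + Num.sqrt (2 * l) * (D * Num.sqrt M * (S * n1) +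
      Num.sqrt (M + L ^+ 2) / 2 * (gamma * S * n2)) <= S * br.
  have -> : S * br = D ^+ 2 / 2 * (S / gamma) + S * rest + 2 * (c * l / 3) +
     (z * S * 2 * (1 + 1 / eps) * x1' + z * (Num.sqrt (M + L ^+ 2) / 2 * (gamma * S * n2))).
    rewrite /br /z /c /x1' s2; move: (Num.sqrt (M + _)) (Num.sqrt m%:R)^-1 => A B.
    by field; rewrite !gt_eqF.
  have h1 : D ^+ 2 / 2 * (w k / gam k) <= D ^+ 2 / 2 * (S / gamma).
    by rewrite ler_wpM2l// divr_ge0 ?sqr_ge0.
  have h2 : 0 <= c * l / 3 by apply: divr_ge0 => //; exact: mulr_ge0 (ltW c0) (ltW l0).
  have h3 : z * S * x1' <= z * S * 2 * (1 + 1 / eps) * x1'.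
    apply: ler_wpM2r => //; rewrite -mulrA ler_peMr ?mulr_ge0 ?(ltW S0)//.
    have : 0 < 1 / eps by rewrite divr_gt0.
    lra.
  rewrite sl sM -/z.
  have -> : z * (D * (sigma / Num.sqrt m%:R) * (S * n1) +
      Num.sqrt (M + L ^+ 2) / 2 * (gamma * S * n2)) = z * S * x1' +
      z * (Num.sqrt (M + L ^+ 2) / 2 * (gamma * S * n2)) by rewrite /x1'; ring.
  move: h1 h2 h3 mean; move: (z * (Num.sqrt (M + L ^+ 2) / 2 * _)) => A; lra.
apply: le_trans brS _.
have br0 : 0 <= br.
  have h1 : 0 <= D ^+ 2 / (2 * gamma) by rewrite divr_ge0 ?sqr_ge0// mulr_ge0// ltW.
  have h2 : 0 <= 2 / 3 * (2 * D * m1 + gamma * m2) * l.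
    by rewrite !mulr_ge0 ?addr_ge0 ?divr_ge0// ?ltW.
  have e0 : 0 < 1 / eps by rewrite divr_gt0.
  have h3 : 0 <= 1 / Num.sqrt 2 * (4 * (1 + 1 / eps) * (D * sigma / Num.sqrt m%:R) * n1
         + gamma * n2 * Num.sqrt (M + L ^+ 2)) * Num.sqrt l.
    rewrite mulr_ge0 ?sqrtr_ge0// mulr_ge0 ?divr_ge0 ?sqrtr_ge0//.
    apply: addr_ge0; last by rewrite !mulr_ge0 ?sqrtr_ge0// ltW.
    by rewrite !mulr_ge0 ?invr_ge0 ?sqrtr_ge0// addr_ge0// ltW.
  by rewrite /br !addr_ge0.
by rewrite mulrA ler_wpM2r// mulrC.
Qed.

End Trajectory.
End OneStep.
End Batch.

(** * Sums of powers and step size schedules *)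

Section PowerSums.
Context {R : realType}.
Implicit Types a b p y : R.

Lemma natr_gt0 (n : nat) : (0 < n)%N -> 0 < n%:R :> R. Proof. by rewrite ltr0n. Qed.

Lemma natr_ge1 (n : nat) : (0 < n)%N -> 1 <= n%:R :> R. Proof. by rewrite ler1n. Qed.

(** Bernoulli's inequality, from the convexity of the exponential between [ln y] and 0. *)
Lemma powR_le1D y b : 0 <= y -> 0 < b -> b <= 1 -> y `^ b <= 1 + b * (y - 1).
Proof.
move=> y0 b0 b1; have [->|yN0] := eqVneq y 0.
  by rewrite powR0 ?gt_eqF//; lra.
have yp : 0 < y by rewrite lt_def yN0.
have b01 : 0 <= b by exact: ltW.
have := @convex_expR R (Itv01 b01 b1) (ln y) 0.
rewrite !convRE /= expR0 lnK ?posrE// /powR (negbTE yN0) mulr0 addr0 mulr1.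
by rewrite /unstable.onem; lra.
Qed.

(** The preceding inequality for [y^s] and the exponent [1 / s]. *)
Lemma powR_ge1D y s : 0 <= y -> 1 <= s -> 1 + s * (y - 1) <= y `^ s.
Proof.
move=> y0 s1; have s0 : 0 < s by lra.
have := @powR_le1D (y `^ s) s^-1 (powR_ge0 _ _).
rewrite invr_gt0 s0 invf_le1// s1 => /(_ isT isT).
rewrite -powRrM divff ?gt_eqF// powRr1// -(ler_pM2l s0) mulrDr mulVKf ?gt_eqF//.
lra.
Qed.

Lemma powR_neg_ge1D y a : 0 < y -> a <= 0 -> 1 + a * (y - 1) <= y `^ a.
Proof.
move=> y0 a0; rewrite /powR gt_eqF//; apply: le_trans (expR_ge1Dx _).
have := @le_ln1Dx R (y - 1); have -> : 1 + (y - 1) = y by ring.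
have -> : -1 < y - 1 by lra.
by move=> /(_ isT) h; rewrite lerD2l ler_wnM2l.
Qed.

(** Together with [natr_pred_div], Bernoulli's inequality at [y = 1 - 1 / n] compares [(n - 1)^b]
    with [n^b - b n^(b - 1)]: power sums then telescope without integrals. *)
Lemma powR_pred (n : nat) b : (0 < n)%N ->
  n%:R `^ b * (1 - b / n%:R) = n%:R `^ b - b * n%:R `^ (b - 1) :> R.
Proof.
move=> n0; have nz : n%:R != 0 :> R by rewrite pnatr_eq0 -lt0n.
by rewrite powRB ?nz ?implybT// powRr1//; field.
Qed.

Lemma natr_pred_div (n : nat) b : (0 < n)%N ->
  n.-1%:R `^ b = n%:R `^ b * (1 - n%:R^-1) `^ b :> R.
Proof.
case: n => // n _; rewrite -powRM ?subr_ge0 ?invf_le1 ?ler1n ?ltr0n//.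
congr (_ `^ _); rewrite -[n.+1.-1]/n -(natr1 n); field.
by rewrite natr1 pnatr_eq0.
Qed.

Lemma one_sub_inv_ge0 (n : nat) : (0 < n)%N -> 0 <= 1 - n%:R^-1 :> R.
Proof. by move=> n0; rewrite subr_ge0 invf_le1 ?ler1n ?ltr0n. Qed.

Lemma powR_nat_mono (i k : nat) b : (0 < i <= k)%N -> 0 <= b -> i%:R `^ b <= k%:R `^ b :> R.
Proof. by case/andP=> i0 ik b0; rewrite ge0_ler_powR ?nnegrE// ler_nat. Qed.

Lemma powR_nat_anti (i k : nat) b : (0 < i <= k)%N -> b <= 0 -> k%:R `^ b <= i%:R `^ b :> R.
Proof.
case/andP=> i0 ik b0; have k0 : (0 < k)%N by exact: leq_trans ik.
rewrite -[b]opprK !(powRN _ (- b)) lef_pV2 ?posrE ?powR_gt0 ?natr_gt0//.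
by apply: powR_nat_mono; rewrite ?i0// oppr_ge0.
Qed.

Lemma powR_nat_le_max (i k : nat) b : (0 < i <= k)%N -> i%:R `^ b <= k%:R `^ Num.max b 0 :> R.
Proof.
move=> ik; have [i0 ik'] := andP ik; apply: (@le_trans _ _ (i%:R `^ Num.max b 0)).
  by apply: ler_powR; [exact: natr_ge1|rewrite le_max lexx].
by apply: powR_nat_mono => //; rewrite le_max lexx orbT.
Qed.

(** For [b >= 1] the last term is the largest; for [b < 1] the sum telescopes, at the price of
    [1 / b]. *)
Lemma sum_powR_le (k : nat) b : 0 < b ->
  \sum_(1 <= i < k.+1) i%:R `^ (b - 1) <= k%:R `^ b / Num.min b 1 :> R.
Proof.
move=> b0; have [b1|b1] := leP 1 b.
  rewrite divr1; case: k => [|k]; first by rewrite big_geq// powR_ge0.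
  apply: (@le_trans _ _ (\sum_(1 <= i < k.+2) k.+1%:R `^ (b - 1))).
    rewrite !big_nat; apply: ler_sum => i /andP[i0 ik]; apply: powR_nat_mono; last lra.
    by rewrite i0.
  by rewrite sumr_const_nat subn1 /= -[X in X <= _]mulr_natl mulr_powRB1.
rewrite ler_pdivlMr// mulr_suml.
elim: k => [|k ih]; first by rewrite big_geq// powR_ge0.
rewrite big_nat_recr//=; apply: le_trans (lerD ih (lexx _)) _.
have n0 := ltn0Sn k; have := natr_pred_div b n0; rewrite -[k.+1.-1]/k => ->.
have hb := @powR_le1D (1 - k.+1%:R^-1) b (one_sub_inv_ge0 n0) b0 (ltW b1).
have := ler_wpM2l (powR_ge0 k.+1%:R b) hb.
have -> : 1 + b * (1 - k.+1%:R^-1 - 1) = 1 - b / k.+1%:R by ring.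
rewrite powR_pred//; lra.
Qed.

Lemma sum_powR_neg_le (k : nat) a : a < 0 ->
  \sum_(1 <= i < k.+1) i%:R `^ (a - 1) <= 1 - 1 / a :> R.
Proof.
move=> a0; suff h : (0 < k)%N -> - a * \sum_(1 <= i < k.+1) i%:R `^ (a - 1) <= 1 - a - k%:R `^ a :> R.
  have na : 0 < - a by rewrite oppr_gt0.
  case: k h => [_|k /(_ isT) h].
    by rewrite big_geq// subr_ge0 (le_trans _ ler01)// ler_ndivrMr// mul0r ler01.
  rewrite -(ler_pM2l na); apply: le_trans h _.
  have -> : - a * (1 - 1 / a) = 1 - a by field; rewrite lt_eqF.
  by rewrite gerBl powR_ge0.
case: k => // k _; elim: k => [|k ih].
  by rewrite big_nat1 !powR1; lra.
rewrite big_nat_recr//= mulrDr; apply: le_trans (lerD ih (lexx _)) _.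
have n0 := ltn0Sn k.+1; have := natr_pred_div a n0; rewrite -[k.+2.-1]/k.+1 => ->.
have y0 : 0 < 1 - k.+2%:R^-1 :> R by rewrite subr_gt0 invf_lt1 ?ltr1n ?ltr0n.
have hb := powR_neg_ge1D y0 (ltW a0).
have := ler_wpM2l (powR_ge0 k.+2%:R a) hb.
have -> : 1 + a * (1 - k.+2%:R^-1 - 1) = 1 - a / k.+2%:R by ring.
rewrite powR_pred//; lra.
Qed.

(** For [p < 0] every term is at least the last one, whence the factor 1; for [p >= 0] telescoping
    gives [p + 1]. *)
Lemma sum_powR_ge (k : nat) p : -1 < p ->
  k%:R `^ (p + 1) <= Num.max (p + 1) 1 * \sum_(1 <= i < k.+1) i%:R `^ p :> R.
Proof.
move=> p1; case: k => [|k0]; first by rewrite powR0 ?big_geq ?mulr0// gt_eqF//; lra.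
have p10 : 0 < p + 1 by lra.
have [p0|p0] := leP 0 p; last first.
  rewrite max_r; last lra.
  rewrite mul1r; apply: (@le_trans _ _ (\sum_(1 <= i < k0.+2) k0.+1%:R `^ p)).
    rewrite sumr_const_nat subn1 /= -[X in _ <= X]mulr_natl.
    by rewrite -[X in _ <= _ * _ `^ X](addrK 1) mulr_powRB1.
  rewrite !big_nat; apply: ler_sum => i ik; apply: powR_nat_anti (ltW p0).
  by move: ik; rewrite ltnS.
rewrite max_l; last lra.
elim: (k0.+1) => [|k ih]; first by rewrite powR0 ?big_geq ?mulr0// gt_eqF.
rewrite big_nat_recr//= mulrDr; apply: le_trans (lerD ih (lexx _)).
have n0 := ltn0Sn k; have := natr_pred_div (p + 1) n0; rewrite -[k.+1.-1]/k => ->.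
have hb := @powR_ge1D (1 - k.+1%:R^-1) (p + 1) (one_sub_inv_ge0 n0).
have {}hb := hb (ltac:(lra)).
have := ler_wpM2l (powR_ge0 k.+1%:R (p + 1)) hb.
have -> : 1 + (p + 1) * (1 - k.+1%:R^-1 - 1) = 1 - (p + 1) / k.+1%:R by ring.
rewrite powR_pred// addrK; lra.
Qed.

Lemma sum_inv_le_ln (k : nat) : (0 < k)%N ->
  \sum_(1 <= i < k.+1) i%:R^-1 <= 1 + ln k%:R :> R.
Proof.
case: k => // k _; elim: k => [|k ih]; first by rewrite big_nat1 invr1 ln1 addr0.
rewrite big_nat_recr//=; apply: le_trans (lerD ih (lexx _)) _.
rewrite -addrA lerD2l.
have y0 : 0 < 1 - k.+2%:R^-1 :> R by rewrite subr_gt0 invf_lt1 ?ltr1n ?ltr0n.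
have -> : k.+1%:R = k.+2%:R * (1 - k.+2%:R^-1) :> R.
  by rewrite mulrBr mulr1 divff ?pnatr_eq0// -(natr1 k.+1) addrK.
rewrite lnM ?posrE ?ltr0n// -addrA gerDl.
have := @le_ln1Dx R (- k.+2%:R^-1); rewrite ltrN2 invf_lt1 ?ltr1n ?ltr0n// => /(_ isT) h.
by rewrite -lerBrDr sub0r.
Qed.

Lemma powRN1_nat (i : nat) : i%:R `^ (-1) = i%:R^-1 :> R.
Proof. by rewrite powR_inv1. Qed.

End PowerSums.

(** * Clipping levels growing like a square root *)

Section StepSums.
Context {R : realType} (beta Leps : R).
Hypotheses (beta0 : 0 < beta) (Leps0 : 0 < Leps).
Implicit Types p q a b : R.

Lemma natr_powRD (i : nat) a b : (0 < i)%N -> i%:R `^ (a + b) = i%:R `^ a * i%:R `^ b :> R.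
Proof. by move=> i0; rewrite powRD// pnatr_eq0 -lt0n i0 implybT. Qed.

Lemma natr_powR_gt0 (i : nat) a : (0 < i)%N -> 0 < i%:R `^ a :> R.
Proof. by move=> i0; rewrite powR_gt0 ?ltr0n. Qed.

Lemma natr_powR_sqr (i : nat) a : (i%:R `^ a) ^+ 2 = i%:R `^ (2 * a) :> R.
Proof. by rewrite -powR_mulrn ?powR_ge0// -powRrM mulrC. Qed.

Lemma natr_sqrt (i : nat) : Num.sqrt i%:R = i%:R `^ (1 / 2) :> R.
Proof. by rewrite div1r powR12_sqrt. Qed.

Lemma maxr_sqr a b : 0 <= a -> 0 <= b -> Num.max a b ^+ 2 = Num.max (a ^+ 2) (b ^+ 2).
Proof.
move=> a0 b0; have [ab|ba] := leP a b.
  by rewrite max_r// lerXn2r.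
by rewrite max_l// lerXn2r// ltW.
Qed.

Definition clip_level (i : nat) : R := Num.max (beta * i%:R `^ (1 / 2)) Leps.

Lemma clip_level_sqr i : (0 < i)%N ->
  clip_level i ^+ 2 = Num.max (beta ^+ 2 * i%:R) (Leps ^+ 2).
Proof.
move=> i0; rewrite /clip_level maxr_sqr ?(ltW Leps0) ?mulr_ge0 ?(ltW beta0) ?powR_ge0//.
by rewrite exprMn natr_powR_sqr mul1r divff// powRr1.
Qed.

Lemma clip_level_sqr_le i : (0 < i)%N ->
  clip_level i ^+ 2 <= beta ^+ 2 * i%:R + Leps ^+ 2.
Proof.
move=> i0; rewrite clip_level_sqr// ge_max lerDl sqr_ge0 lerDr.
by rewrite mulr_ge0// sqr_ge0.
Qed.

Lemma clip_level_gt0 i : 0 < clip_level i.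
Proof. by rewrite lt_max Leps0 orbT. Qed.

(** Absorbs the logarithm of the harmonic sum when [p = 0]; it is [ln y <= y - 1] at
    [y = sqrt k]. *)
Lemma ln_le_sqrt (k : nat) : (0 < k)%N -> 1 + ln k%:R <= 2 * k%:R `^ (1 / 2) :> R.
Proof.
move=> k0; set y := k%:R `^ (1 / 2).
have y0 : 0 < y by exact: natr_powR_gt0.
have : ln y = 1 / 2 * ln k%:R by rewrite /y ln_powR.
have := @le_ln1Dx R (y - 1); have -> : 1 + (y - 1) = y by ring.
have -> : -1 < y - 1 by lra.
move=> /(_ isT); lra.
Qed.

(** Origin of [vcoef]: up to [gamma^2], the left side is the sum of [(w_i gam_i lam_i)^2]. For
    [p > 0] the level is bounded by its value at [k]; for [p = 0] a harmonic sum appears; for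
    [p < 0] the squared maximum is split into a sum, giving a growing and a bounded power sum. *)
Lemma sum_clip_level_vcoef p k : - (1 / 2) < p -> (0 < k)%N ->
  \sum_(1 <= i < k.+1) i%:R `^ (2 * p - 1) * clip_level i ^+ 2 <=
    (k%:R `^ (p + 1 / 2) * vcoef beta Leps p k) ^+ 2.
Proof.
move=> p12 k0; set K : R := k%:R; have K0 : 0 < K by rewrite ltr0n.
have s0 : 0 < Num.sqrt K by rewrite sqrtr_gt0.
have sK : Num.sqrt K ^+ 2 = K by rewrite sqr_sqrtr// ltW.
have SE : (K `^ (p + 1 / 2)) ^+ 2 = K `^ (2 * p + 1).
  by rewrite natr_powR_sqr; congr (_ `^ _); field.
rewrite exprMn SE /vcoef -/K; case: ifPn => [p0|pN0].
  set mx := Num.max beta (Leps / Num.sqrt K).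
  have p2 : 0 < 2 * p by rewrite mulr_gt0.
  have mn0 : 0 < Num.min (2 * p) 1 by rewrite lt_min p2/=.
  have mx2 : K * mx ^+ 2 = Num.max (beta ^+ 2 * K) (Leps ^+ 2).
    rewrite maxr_sqr ?(ltW beta0) ?divr_ge0 ?(ltW Leps0) ?(ltW s0)//.
    rewrite maxr_pMr ?(ltW K0)// [K * _]mulrC; congr Num.max.
    by rewrite expr_div_n sK; field; rewrite gt_eqF.
  apply: (@le_trans _ _ (\sum_(1 <= i < k.+1) i%:R `^ (2 * p - 1) * (K * mx ^+ 2))).
    rewrite !big_nat; apply: ler_sum => i /andP[i0 ik]; apply: ler_wpM2l; first exact: powR_ge0.
    rewrite clip_level_sqr// mx2 ge_max !le_max lexx orbT andbT ler_pM2l ?exprn_gt0//.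
    by rewrite ler_nat -ltnS ik.
  rewrite -mulr_suml; have := sum_powR_le k p2.
  move=> /(ler_wpM2r _) h; apply: le_trans (h _ _) _; first by rewrite mulr_ge0 ?sqr_ge0// ltW.
  rewrite exprMn sqr_sqrtr ?divr_ge0// ?(ltW mn0)//.
  have -> : K `^ (2 * p + 1) = K `^ (2 * p) * K by rewrite natr_powRD// powRr1// ltW.
  have A0 : 0 <= K `^ (2 * p) / Num.min (2 * p) 1 * (K * mx ^+ 2).
    apply: mulr_ge0; first by rewrite divr_ge0 ?powR_ge0// ltW.
    exact: mulr_ge0 (ltW K0) (sqr_ge0 _).
  have -> : K `^ (2 * p) * K * (2 / Num.min (2 * p) 1 * mx ^+ 2) =
    2 * (K `^ (2 * p) / Num.min (2 * p) 1 * (K * mx ^+ 2)).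
    by field; rewrite gt_eqF.
  by move: A0; lra.
rewrite -leNgt in pN0.
case: ifPn => [/eqP pE|p_neq0].
  have -> : 2 * p + 1 = 1 by rewrite pE; ring.
  rewrite powRr1 ?(ltW K0)//.
  have E (i : nat) : i%:R `^ (2 * p - 1) = i%:R^-1 :> R.
    by rewrite pE mulr0 sub0r powRN1_nat.
  (* Below the threshold [beta^2 i < Leps^2] for all [i <= k], so the level is constantly [Leps]. *)
  case: ifPn => [Ka|_].
    apply: (@le_trans _ _ (\sum_(1 <= i < k.+1) Leps ^+ 2)); last first.
      by rewrite sumr_const_nat subn1/= -mulr_natl.
    rewrite !big_nat; apply: ler_sum => i /andP[i0 ik]; rewrite E clip_level_sqr//.
    rewrite max_r; last first.
      move: Ka; rewrite ltr_pdivlMr ?exprn_gt0// => /ltW; apply: le_trans.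
      by rewrite mulrC ler_pM2r ?exprn_gt0// ler_nat -ltnS.
    rewrite ger_pMl ?exprn_gt0// invf_le1 ?ltr0n// ler1n//.
  set a := Leps ^+ 2 / beta ^+ 2.
  have a0 : 0 < a by rewrite divr_gt0// exprn_gt0.
  have aE : Leps ^+ 2 = beta ^+ 2 * a by rewrite /a; field; rewrite gt_eqF.
  (* By [ln_le_sqrt], [a (1 + ln K)] is at most the cross term of [(a + sqrt K)^2]. *)
  apply: (@le_trans _ _ (beta ^+ 2 * (K + a * (1 + ln K)))).
    apply: (@le_trans _ _ (\sum_(1 <= i < k.+1) (beta ^+ 2 + beta ^+ 2 * a * i%:R^-1))).
      rewrite !big_nat; apply: ler_sum => i /andP[i0 ik]; rewrite E.
      apply: le_trans (ler_wpM2l _ (clip_level_sqr_le i0)) _; first by rewrite invr_ge0.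
      rewrite aE mulrDr le_eqVlt; apply/orP; left; apply/eqP; field.
      by rewrite pnatr_eq0 -lt0n.
    rewrite big_split/= sumr_const_nat subn1/= -mulr_sumr -[_ *+ _]mulr_natr -mulrA -mulrDr.
    rewrite ler_pM2l ?exprn_gt0// lerD2l ler_pM2l//; exact: sum_inv_le_ln.
  have -> : K * (beta * (a / Num.sqrt K + 1)) ^+ 2 = beta ^+ 2 * (a + Num.sqrt K) ^+ 2.
    by rewrite -{1}sK; field; rewrite gt_eqF.
  rewrite ler_pM2l ?exprn_gt0//.
  have := ln_le_sqrt k0; rewrite -natr_sqrt -/K => hln.
  have : a * (1 + ln K) <= a * (2 * Num.sqrt K) by rewrite ler_pM2l.
  have := sqr_ge0 a; move: sK; lra.
have p0 : p < 0 by rewrite lt_neqAle p_neq0.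
have p21 : 0 < 2 * p + 1 by lra.
have p2 : 2 * p < 0 by lra.
rewrite min_l; last lra.
apply: (@le_trans _ _ (beta ^+ 2 * (K `^ (2 * p + 1) / (2 * p + 1)) + Leps ^+ 2 * (1 - 1 / (2 * p)))).
  apply: (@le_trans _ _ (\sum_(1 <= i < k.+1) (beta ^+ 2 * i%:R `^ (2 * p + 1 - 1) +
      Leps ^+ 2 * i%:R `^ (2 * p - 1)))).
    rewrite !big_nat; apply: ler_sum => i /andP[i0 ik].
    apply: le_trans (ler_wpM2l (powR_ge0 _ _) (clip_level_sqr_le i0)) _.
    rewrite mulrDr addrK le_eqVlt; apply/orP; left; apply/eqP; congr (_ + _); last by rewrite mulrC.
    have -> : i%:R `^ (2 * p) = i%:R `^ (2 * p - 1) * i%:R :> R.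
      by rewrite -[in LHS](subrK 1 (2 * p)) natr_powRD// powRr1.
    by ring.
  rewrite big_split/= -!mulr_sumr; apply: lerD; apply: ler_wpM2l; rewrite ?sqr_ge0//.
    by have := sum_powR_le k p21; rewrite min_l//; lra.
  exact: sum_powR_neg_le.
set u := Leps / _ * _; set v := _ / Num.sqrt _.
have p2' : 0 <= 1 - 1 / (2 * p).
  by rewrite subr_ge0 (le_trans _ ler01)// ler_ndivrMr// mul0r ler01.
have u0 : 0 <= u by rewrite /u mulr_ge0 ?sqrtr_ge0// divr_ge0 ?powR_ge0// ltW.
have v0 : 0 <= v by rewrite /v divr_ge0 ?sqrtr_ge0// le_max (ltW beta0).
apply: (@le_trans _ _ (K `^ (2 * p + 1) * (u ^+ 2 + v ^+ 2))); last first.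
  apply: ler_wpM2l; first exact: powR_ge0.
  have := mulr_ge0 u0 v0; move: u v {u0 v0} => u v; lra.
have -> : K `^ (2 * p + 1) * (u ^+ 2 + v ^+ 2) =
    K `^ (2 * p + 1) * v ^+ 2 + K `^ (2 * p + 1) * u ^+ 2 by ring.
apply: lerD.
  rewrite mulrCA; apply: ler_wpM2l; first exact: powR_ge0.
  rewrite /v expr_div_n sqr_sqrtr ?(ltW p21)// ler_wpM2r ?invr_ge0 ?(ltW p21)//.
  by rewrite lerXn2r ?nnegrE ?(ltW beta0)// ?le_max ?lexx ?(ltW beta0).
rewrite /u exprMn sqr_sqrtr// expr_div_n SE mulrA ler_wpM2r//.
by rewrite mulrCA divff ?mulr1// gt_eqF// powR_gt0.
Qed.

(** The case [p = - 1/2]. The constant [sqrt 2] comes from the sum of [i^-2], at most 2, and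
    [1 + ln k] is below its square. *)
Lemma sum_clip_level_log k : (0 < k)%N ->
  \sum_(1 <= i < k.+1) i%:R `^ (- 2) * clip_level i ^+ 2 <=
    (Num.sqrt 2 * Leps + beta * (1 + ln k%:R)) ^+ 2.
Proof.
move=> k0; have l0 : 0 <= ln k%:R :> R by rewrite ln_ge0// ler1n.
apply: (@le_trans _ _ (\sum_(1 <= i < k.+1) (beta ^+ 2 * i%:R^-1 + Leps ^+ 2 * i%:R `^ (-1 - 1)))).
  rewrite !big_nat; apply: ler_sum => i /andP[i0 ik].
  apply: le_trans (ler_wpM2l (powR_ge0 _ _) (clip_level_sqr_le i0)) _.
  have -> : -2 = -1 - 1 :> R by ring.
  rewrite mulrDr le_eqVlt; apply/orP; left; apply/eqP; congr (_ + _); last by rewrite mulrC.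
  rewrite natr_powRD// powRN1_nat; field.
  by rewrite pnatr_eq0 -lt0n.
rewrite big_split/= -!mulr_sumr.
have h1 := ler_wpM2l (sqr_ge0 beta) (sum_inv_le_ln k0).
have h2 := ler_wpM2l (sqr_ge0 Leps) (@sum_powR_neg_le R k (-1) (ltrN10 _)).
have e : 1 - 1 / -1 = 2 :> R by field.
rewrite e in h2.
have s2 : Num.sqrt 2 ^+ 2 = 2 :> R by rewrite sqr_sqrtr.
have s20 : 0 <= Num.sqrt 2 :> R by exact: sqrtr_ge0.
have -> : (Num.sqrt 2 * Leps + beta * (1 + ln k%:R)) ^+ 2 =
  Num.sqrt 2 ^+ 2 * Leps ^+ 2 + 2 * (Num.sqrt 2 * Leps) * (beta * (1 + ln k%:R))
   + beta ^+ 2 * (1 + ln k%:R) ^+ 2 by ring.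
rewrite s2; apply: (le_trans (lerD h1 h2)).
have h3 : 0 <= 2 * (Num.sqrt 2 * Leps) * (beta * (1 + ln k%:R)).
  by rewrite !mulr_ge0 ?addr_ge0// ltW.
have h4 : beta ^+ 2 * (1 + ln k%:R) <= beta ^+ 2 * (1 + ln k%:R) ^+ 2.
  by apply: ler_wpM2l; [exact: sqr_ge0|rewrite expr2 ler_peMr ?addr_ge0// lerDl].
move: h3 h4; lra.
Qed.

End StepSums.

Section SquareRootSchedule.
Context {R : realType} (beta Leps gamma : R).
Hypotheses (beta0 : 0 < beta) (Leps0 : 0 < Leps) (gamma0 : 0 < gamma).
Implicit Types p q r a b : R.
Local Notation lam := (clip_level beta Leps).

Lemma natr_powR_sub (k : nat) a b : (0 < k)%N ->
  k%:R `^ a / k%:R `^ b = k%:R `^ (a - b) :> R.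
Proof. by move=> k0; rewrite natr_powRD// powRN. Qed.

(** Under the constant level, [i^p <= k^max(p, 0)], and [max (p, 0) = p + 1/2 - min (p + 1/2, 1/2)];
    this is the exponent dividing [Leps]. *)
Lemma weight_clip_le p i k : - (1 / 2) <= p -> (0 < i <= k)%N ->
  i%:R `^ p * lam i <= k%:R `^ (p + 1 / 2) *
    Num.max beta (Leps / k%:R `^ Num.min (p + 1 / 2) (1 / 2)).
Proof.
move=> p12 ik; have [i0 ik'] := andP ik; have k0 : (0 < k)%N by exact: leq_trans ik'.
have p0 : 0 <= p + 1 / 2 by lra.
rewrite /clip_level maxr_pMr ?powR_ge0// ge_max; apply/andP; split.
  have -> : i%:R `^ p * (beta * i%:R `^ (1 / 2)) = i%:R `^ (p + 1 / 2) * beta :> R.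
    by rewrite natr_powRD//; ring.
  apply: ler_pM; rewrite ?powR_ge0 ?(ltW beta0)//; first exact: powR_nat_mono.
  by rewrite le_max lexx.
apply: (@le_trans _ _ (k%:R `^ (p + 1 / 2) * (Leps / k%:R `^ Num.min (p + 1 / 2) (1 / 2)))).
  rewrite [_ * (Leps / _)]mulrA mulrAC natr_powR_sub//; apply: ler_wpM2r; first exact: ltW.
  apply: le_trans (powR_nat_le_max p ik) _; apply: ler_powR; first exact: natr_ge1.
  by rewrite ge_max; apply/andP; split; case: (leP (p + 1 / 2) (1 / 2)); lra.
by apply: ler_wpM2l; [exact: powR_ge0|rewrite le_max lexx orbT].
Qed.

Lemma weight_clip_sqr_le p i k : - (1 / 2) <= p -> (0 < i <= k)%N ->
  i%:R `^ p * (gamma / i%:R `^ (1 / 2)) * lam i ^+ 2 <= gamma * k%:R `^ (p + 1 / 2) *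
    Num.max (beta ^+ 2) (Leps ^+ 2 / k%:R `^ Num.min (p + 1 / 2) 1).
Proof.
move=> p12 ik; have [i0 ik'] := andP ik; have k0 : (0 < k)%N by exact: leq_trans ik'.
have p0 : 0 <= p + 1 / 2 by lra.
have -> : i%:R `^ p * (gamma / i%:R `^ (1 / 2)) = gamma * i%:R `^ (p - 1 / 2) :> R.
  by rewrite -natr_powR_sub//; ring.
rewrite -[leLHS](mulrA gamma) -[leRHS](mulrA gamma) ler_pM2l// clip_level_sqr// maxr_pMr ?powR_ge0// ge_max; apply/andP; split.
  have -> : i%:R `^ (p - 1 / 2) * (beta ^+ 2 * i%:R) = i%:R `^ (p + 1 / 2) * beta ^+ 2 :> R.
    have -> : p + 1 / 2 = p - 1 / 2 + 1 by field.
    by rewrite (@natr_powRD R i (p - 1 / 2) 1)// powRr1//; ring.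
  apply: ler_pM; rewrite ?powR_ge0 ?sqr_ge0//; first exact: powR_nat_mono.
  by rewrite le_max lexx.
apply: (@le_trans _ _ (k%:R `^ (p + 1 / 2) * (Leps ^+ 2 / k%:R `^ Num.min (p + 1 / 2) 1))).
  rewrite [_ * (_ / _)]mulrA mulrAC natr_powR_sub//; apply: ler_wpM2r; first exact: sqr_ge0.
  apply: le_trans (powR_nat_le_max _ ik) _; apply: ler_powR; first exact: natr_ge1.
  by rewrite ge_max; apply/andP; split; case: (leP (p + 1 / 2) 1); lra.
by apply: ler_wpM2l; [exact: powR_ge0|rewrite le_max lexx orbT].
Qed.

Lemma ge1_inv_min a : 0 < a -> 1 <= 1 / Num.min a 1.
Proof.
move=> a0; have m0 : 0 < Num.min a 1 by rewrite lt_min a0/=.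
by rewrite ler_pdivlMr// mul1r ge_min lexx orbT.
Qed.

(** The constant [z = 1 / min (2 p + 1, 1)] is at least 1, so [z <= z^2] brings the bound into the
    form of a square. *)
Lemma sum_powR_sqr_le p k : - (1 / 2) < p ->
  \sum_(1 <= i < k.+1) (i%:R `^ p) ^+ 2 <=
    (k%:R `^ (p + 1 / 2) * (1 / Num.min (2 * p + 1) 1)) ^+ 2 :> R.
Proof.
move=> p12; have p0 : 0 < 2 * p + 1 by lra.
have := ge1_inv_min p0; set z := 1 / Num.min _ _ => z1.
apply: (@le_trans _ _ (k%:R `^ (2 * p + 1) * z)).
  rewrite /z div1r; apply: le_trans (sum_powR_le k p0); rewrite le_eqVlt; apply/orP; left.
  by apply/eqP; apply: eq_bigr => i _; rewrite addrK natr_powR_sqr.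
rewrite exprMn natr_powR_sqr; have -> : 2 * (p + 1 / 2) = 2 * p + 1 by field.
by apply: ler_wpM2l; [exact: powR_ge0|rewrite expr2 ler_peMr//; lra].
Qed.

Lemma weight_gam_clip_sqrE p i : (0 < i)%N ->
  (i%:R `^ p * (gamma / i%:R `^ (1 / 2)) * lam i) ^+ 2 =
    gamma ^+ 2 * (i%:R `^ (2 * p - 1) * lam i ^+ 2).
Proof.
move=> i0; have -> : i%:R `^ (2 * p - 1) = (i%:R `^ p) ^+ 2 / (i%:R `^ (1 / 2)) ^+ 2 :> R.
  by rewrite !natr_powR_sqr natr_powR_sub//; congr (_ `^ _); field.
have : i%:R `^ (1 / 2) != 0 :> R by rewrite gt_eqF// natr_powR_gt0.
by move: (i%:R `^ (1 / 2)) (i%:R `^ p) => u v u0; field.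
Qed.

Lemma weight_step_ratioE p i : (0 < i)%N ->
  i%:R `^ p / (gamma / i%:R `^ (1 / 2)) = i%:R `^ (p + 1 / 2) / gamma.
Proof. by move=> i0; rewrite invf_div mulrA natr_powRD. Qed.

Lemma weight_step_ratio_mono p i : - (1 / 2) <= p -> (0 < i)%N ->
  i%:R `^ p / (gamma / i%:R `^ (1 / 2)) <= i.+1%:R `^ p / (gamma / i.+1%:R `^ (1 / 2)).
Proof.
move=> p12 i0; rewrite !weight_step_ratioE// ler_pM2r ?invr_gt0//.
apply: powR_nat_mono; first by rewrite i0/=.
lra.
Qed.

Lemma clip_level_inv_le i c : (0 < i)%N -> 0 <= c ->
  c / (4 * lam i) <= i%:R `^ (- (1 / 2)) * (c * (1 / beta)).
Proof.
move=> i0 c0; have i12 := @natr_powR_gt0 R i (1 / 2) i0.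
have -> : i%:R `^ (- (1 / 2)) * (c * (1 / beta)) = c / (beta * i%:R `^ (1 / 2)).
  by rewrite powRN invfM; ring.
have l0 := clip_level_gt0 beta Leps0 i.
apply: ler_wpM2l => //; rewrite lef_pV2 ?posrE ?mulr_gt0//.
have : beta * i%:R `^ (1 / 2) <= lam i by rewrite le_max lexx.
by lra.
Qed.

Lemma mean_term_le p i (c m : R) : (0 < i)%N -> 0 <= c -> 0 <= m ->
  i%:R `^ p * (c / (4 * lam i) + gamma / i%:R `^ (1 / 2) / 2 * m) <=
    i%:R `^ (p - 1 / 2) * (c * (1 / beta) + gamma / 2 * m).
Proof.
move=> i0 c0 m0.
have -> : i%:R `^ (p - 1 / 2) * (c * (1 / beta) + gamma / 2 * m) =
    i%:R `^ p * (i%:R `^ (- (1 / 2)) * (c * (1 / beta)) + gamma / i%:R `^ (1 / 2) / 2 * m).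
  by rewrite natr_powRD// powRN; ring.
by apply: ler_wpM2l; [exact: powR_ge0|rewrite lerD2r clip_level_inv_le].
Qed.

End SquareRootSchedule.

(** * Constant step size for a fixed horizon *)

Section FiniteHorizonSchedule.
Context {R : realType} (beta Leps gamma : R).
Hypotheses (beta0 : 0 < beta) (Leps0 : 0 < Leps) (gamma0 : 0 < gamma).
Variables (p : R) (k : nat).
Hypotheses (p0 : 0 <= p) (k0 : (0 < k)%N).
Local Notation lam := (clip_level beta Leps).
Local Notation K := (k%:R : R).

Let K0 : 0 < K. Proof. by rewrite ltr0n. Qed.
Let s0 : 0 < Num.sqrt K. Proof. by rewrite sqrtr_gt0. Qed.
Let sK : Num.sqrt K ^+ 2 = K. Proof. by rewrite sqr_sqrtr// ltW. Qed.

Let SE : K `^ (p + 1 / 2) = K `^ p * Num.sqrt K.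
Proof. by rewrite natr_powRD// -natr_sqrt. Qed.

Let lam_sqr_le i : (0 < i <= k)%N -> lam i ^+ 2 <= K * Num.max (beta ^+ 2) (Leps ^+ 2 / K).
Proof.
move=> /andP[i0 ik]; rewrite clip_level_sqr// maxr_pMr ?(ltW K0)//.
have -> : K * (Leps ^+ 2 / K) = Leps ^+ 2 by rewrite mulrCA divff ?mulr1// gt_eqF.
by rewrite ge_max !le_max lexx orbT andbT [K * _]mulrC ler_pM2l ?exprn_gt0// ler_nat ik.
Qed.

Lemma horizon_clip_sqr_le i : (0 < i <= k)%N ->
  i%:R `^ p * (gamma / Num.sqrt K) * lam i ^+ 2 <=
    gamma * K `^ (p + 1 / 2) * Num.max (beta ^+ 2) (Leps ^+ 2 / K).
Proof.
move=> ik; apply: (@le_trans _ _ (K `^ p * (gamma / Num.sqrt K) *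
    (K * Num.max (beta ^+ 2) (Leps ^+ 2 / K)))).
  apply: ler_pM; rewrite ?sqr_ge0 ?lam_sqr_le//.
    by rewrite mulr_ge0 ?powR_ge0// divr_ge0 ?sqrtr_ge0// ltW.
  by apply: ler_wpM2r; [rewrite divr_ge0 ?sqrtr_ge0// ltW|exact: powR_nat_mono].
rewrite SE le_eqVlt; apply/orP; left; apply/eqP.
move: (K `^ p) (Num.max _ _) => u v; have := sK; move: (Num.sqrt K) s0 => s sp <-.
by field; rewrite gt_eqF.
Qed.

Lemma horizon_sum_clip_le :
  \sum_(1 <= i < k.+1) (i%:R `^ p * (gamma / Num.sqrt K) * lam i) ^+ 2 <=
    (gamma * K `^ (p + 1 / 2) * (Num.sqrt 2 * Num.max beta (Leps / Num.sqrt K))) ^+ 2.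
Proof.
set mx := Num.max beta _.
have mx2 : mx ^+ 2 = Num.max (beta ^+ 2) (Leps ^+ 2 / K).
  by rewrite maxr_sqr ?(ltW beta0) ?divr_ge0 ?sqrtr_ge0 ?(ltW Leps0)// expr_div_n sK.
apply: (@le_trans _ _ (\sum_(1 <= i < k.+1) (K `^ p * gamma) ^+ 2 * mx ^+ 2)).
  rewrite !big_nat; apply: ler_sum => i ik.
  have -> : (i%:R `^ p * (gamma / Num.sqrt K) * lam i) ^+ 2 =
      (i%:R `^ p * gamma) ^+ 2 * (lam i ^+ 2 / K).
    by rewrite -[in RHS]sK; field; rewrite gt_eqF.
  apply: ler_pM; rewrite ?sqr_ge0 ?divr_ge0 ?sqr_ge0 ?(ltW K0)//.
    rewrite lerXn2r ?nnegrE ?mulr_ge0 ?powR_ge0 ?(ltW gamma0)// ler_pM2r//.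
    exact: powR_nat_mono.
  by rewrite ler_pdivrMr// mulrC mx2 lam_sqr_le.
rewrite sumr_const_nat subn1/= -[X in X <= _]mulr_natr SE.
have -> : (gamma * (K `^ p * Num.sqrt K) * (Num.sqrt 2 * mx)) ^+ 2 =
    Num.sqrt 2 ^+ 2 * ((K `^ p * gamma) ^+ 2 * mx ^+ 2 * Num.sqrt K ^+ 2) by ring.
rewrite sK sqr_sqrtr//; apply: ler_peMl; last by rewrite ler1n.
by apply: mulr_ge0 (ltW K0); apply: mulr_ge0; exact: sqr_ge0.
Qed.

(** The step size leaves the sum, and the sum of [i^p] is at most [k^(p + 1)] as [p >= 0]. Hence the
    factor [1 / min (p + 1/2, 1)] affects the bias only. *)
Lemma horizon_mean_le (c m : R) : 0 <= c -> 0 <= m ->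
  \sum_(1 <= i < k.+1) i%:R `^ p * (c / (4 * lam i) + gamma / Num.sqrt K / 2 * m) <=
    K `^ (p + 1 / 2) * (1 / Num.min (p + 1 / 2) 1 * (c * (1 / beta)) + gamma / 2 * m).
Proof.
move=> c0 m0; have p12 : 0 < p + 1 / 2 by rewrite ltr_wpDl// divr_gt0.
apply: (@le_trans _ _ (\sum_(1 <= i < k.+1) (c * (1 / beta) * i%:R `^ (p + 1 / 2 - 1) +
    gamma / Num.sqrt K / 2 * m * i%:R `^ (p + 1 - 1)))).
  rewrite !big_nat; apply: ler_sum => i /andP[i0 ik].
  have -> : p + 1 / 2 - 1 = p + (- (1 / 2)) by field.
  rewrite addrK (@natr_powRD R i p (- (1 / 2)))//.
  rewrite mulrDr; apply: lerD; last by rewrite mulrC.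
  apply: le_trans (ler_wpM2l (@powR_ge0 R i%:R p) (clip_level_inv_le beta0 Leps0 i0 c0)) _.
  by rewrite [leLHS]mulrA [leLHS]mulrC.
have p10 : 0 < p + 1 by rewrite ltr_wpDl.
have h1 := ler_wpM2l (mulr_ge0 c0 (divr_ge0 ler01 (ltW beta0))) (sum_powR_le k p12).
have gm0 : 0 <= gamma / Num.sqrt K / 2 * m.
  by rewrite mulr_ge0// divr_ge0// divr_ge0 ?sqrtr_ge0// ltW.
have := ler_wpM2l gm0 (sum_powR_le k p10); rewrite [Num.min (p + 1) 1]min_r ?divr1 ?lerDr//.
have e : gamma / Num.sqrt K / 2 * m * K `^ (p + 1) = K `^ (p + 1 / 2) * (gamma / 2 * m).
  rewrite SE natr_powRD// powRr1 ?(ltW K0)//; move: (K `^ p) => u.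
  by have := sK; move: (Num.sqrt K) s0 => s sp <-; field; rewrite gt_eqF.
rewrite e big_split/= -!mulr_sumr mulrDr => h2; apply: lerD h2.
by apply: le_trans h1 _; rewrite le_eqVlt; apply/orP; left; apply/eqP; ring.
Qed.

End FiniteHorizonSchedule.

(** * General exponents and the asymptotic rate *)

Section GeneralSchedule.
Context {R : realType}.
Implicit Types p r q : R.

(** As a list, so that domination by [rate] reduces to membership of an exponent. *)
Definition rate_exponents p r q : seq R :=
  [:: 1 - r; Num.min (p + 1) (1 - q); Num.min (p + 1) (r + 1 - 2 * q);
      Num.min (p + 1) (1 / 2); Num.min (p + 1) (r + 1 / 2 - q);
      Num.min (p + 1) q; Num.min (p + 1) r].

Lemma rateE p r q k : rate p r q k = \sum_(x <- rate_exponents p r q) 1 / k%:R `^ x.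
Proof. by rewrite /rate /rate_exponents !big_cons big_nil addr0 !addrA. Qed.

Lemma rate_exponents_gt0 p r q x : admissible p r q -> x \in rate_exponents p r q -> 0 < x.
Proof.
case=> rp /andP[r0 r1] /andP[q0 q1] qr.
have p1 : 0 < p + 1 by lra.
by rewrite !inE => /or4P[/eqP->|/eqP->|/eqP->|/or4P[/eqP->|/eqP->|/eqP->|/eqP->]];
  rewrite ?lt_min ?p1/=; lra.
Qed.

Lemma rate_ge p r q k x : x \in rate_exponents p r q -> 1 / k%:R `^ x <= rate p r q k.
Proof.
move=> xr; rewrite rateE (big_rem x)//= lerDl; apply: sumr_ge0 => y _.
by rewrite divr_ge0// powR_ge0.
Qed.

Lemma powR_cvg0_infty (x : R) : 0 < x -> (fun k : nat => 1 / k%:R `^ x) @ \oo --> 0.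
Proof.
move=> x0; apply/cvgrPdist_lt => e e0.
pose M := (1 / e) `^ (x^-1); have [N NM] : exists N : nat, M < N%:R.
  by exists (Num.bound M); apply: archi_boundP; exact: powR_ge0.
exists N.+1 => // n /= Nn; have n0 : (0 < n)%N by exact: leq_trans Nn.
have nx0 : 0 < n%:R `^ x :> R by rewrite powR_gt0 ?ltr0n.
rewrite sub0r normrN ger0_norm ?divr_ge0 ?powR_ge0// ltr_pdivrMr// -ltr_pdivrMl// mulr1.
have -> : e^-1 = M `^ x.
  by rewrite /M -powRrM mulVf ?gt_eqF// powRr1 ?div1r// invr_ge0 ltW.
apply: gt0_ltr_powR => //; rewrite ?nnegrE ?powR_ge0//.
by apply: lt_le_trans NM _; rewrite ler_nat ltnW.
Qed.

Lemma rate_cvg0 p r q : admissible p r q -> (rate p r q : nat -> R) @ \oo --> 0.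
Proof.
move=> adm; have -> : (rate p r q : nat -> R) =
    (fun k => \sum_(x <- rate_exponents p r q) 1 / k%:R `^ x).
  by apply/funext => k; exact: rateE.
have : forall x, x \in rate_exponents p r q -> 0 < x.
  by move=> x; exact: rate_exponents_gt0.
elim: (rate_exponents p r q) => [|x s ih] xs.
  by under eq_fun do rewrite big_nil; exact: cvg_cst.
under eq_fun do rewrite big_cons.
have h1 := powR_cvg0_infty (xs x (mem_head _ _)).
have h2 : (fun k : nat => \sum_(y <- s) 1 / k%:R `^ y) @ \oo --> (0 : R).
  by apply: ih => y ys; apply: xs; rewrite inE ys orbT.
by have := cvgD h1 h2; rewrite addr0; exact.
Qed.

(** Raising the exponent to [2 e - 1 > -1] excludes logarithmic and bounded sums, leaving a pure
    power. *)
Lemma sum_powR_sqr_dom (k : nat) a e (S : R) : (0 < k)%N -> 0 < e -> a + 1 <= 2 * e ->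
  k%:R `^ e <= S -> \sum_(1 <= i < k.+1) i%:R `^ a <= (S * (1 / Num.min (2 * e) 1)) ^+ 2.
Proof.
move=> k0 e0 ae KS; have e20 : 0 < 2 * e by rewrite mulr_gt0.
have z1 := ge1_inv_min e20; set z := 1 / _ in z1 *.
apply: (@le_trans _ _ (k%:R `^ (2 * e) * z)).
  rewrite /z div1r; apply: le_trans (sum_powR_le k e20).
  rewrite !big_nat; apply: ler_sum => i /andP[i0 _]; apply: ler_powR; first exact: natr_ge1.
  lra.
rewrite exprMn -natr_powR_sqr; apply: ler_pM; rewrite ?sqr_ge0 ?(le_trans ler01)//.
  by rewrite lerXn2r ?nnegrE ?powR_ge0// (le_trans (powR_ge0 _ _) KS).
by rewrite expr2 ler_peMr// (le_trans ler01).
Qed.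

Lemma sum_powR_dom (k : nat) a e (S : R) : (0 < k)%N -> 0 < e -> a + 1 <= e ->
  k%:R `^ e <= S -> \sum_(1 <= i < k.+1) i%:R `^ a <= S * (1 / Num.min e 1).
Proof.
move=> k0 e0 ae KS; have mn : 0 < Num.min e 1 by rewrite lt_min e0/=.
rewrite div1r; apply: (@le_trans _ _ (k%:R `^ e / Num.min e 1)); last first.
  by apply: ler_wpM2r => //; rewrite invr_ge0 ltW.
apply: le_trans (sum_powR_le k e0); rewrite !big_nat; apply: ler_sum => i /andP[i0 _].
apply: ler_powR; first exact: natr_ge1.
lra.
Qed.

Variables (beta Leps gamma p r q : R).
Hypotheses (beta0 : 0 < beta) (Leps0 : 0 < Leps) (gamma0 : 0 < gamma)
  (adm : admissible p r q).

Definition power_level (i : nat) : R := Num.max (beta * i%:R `^ q) Leps.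

Local Notation lam := power_level.
Local Notation B := (beta + Leps).

Lemma power_level_le i : (0 < i)%N -> lam i <= B * i%:R `^ q.
Proof.
case: adm => _ _ /andP[q0 _] _ i0; have i1 : 1 <= i%:R `^ q :> R.
  by rewrite -[leLHS](powRr0 i%:R); apply: ler_powR; [exact: natr_ge1|exact: ltW].
rewrite ge_max mulrDl lerDl mulr_ge0 ?powR_ge0 ?(ltW Leps0)//=.
by apply: ler_wpDl; [rewrite mulr_ge0 ?powR_ge0// ltW|rewrite ler_peMr// ltW].
Qed.

Lemma power_level_gt0 i : 0 < lam i. Proof. by rewrite lt_max Leps0 orbT. Qed.

Variable k : nat.
Hypothesis k0 : (0 < k)%N.
Local Notation K := (k%:R : R).
Local Notation S := (K `^ (p + 1) * rate p r q k).

Let B0 : 0 < B. Proof. exact: addr_gt0. Qed.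

Lemma rate_gt0 : 0 < rate p r q k.
Proof.
apply: lt_le_trans (rate_ge k (mem_head _ _)).
by rewrite divr_gt0// natr_powR_gt0.
Qed.

Lemma scale_gt0 : 0 < S.
Proof. by rewrite mulr_gt0 ?rate_gt0// natr_powR_gt0. Qed.

Lemma powR_le_scale x e : x \in rate_exponents p r q -> e <= p + 1 - x -> K `^ e <= S.
Proof.
move=> xr ex; apply: (@le_trans _ _ (K `^ (p + 1) * (1 / K `^ x))); last first.
  by apply: ler_wpM2l; [exact: powR_ge0|exact: rate_ge].
by rewrite mulrA mulr1 natr_powR_sub//; apply: ler_powR; first exact: natr_ge1.
Qed.

Lemma powR_pr_le_scale e : e <= p + r -> K `^ e <= S.
Proof. by move=> er; apply: (@powR_le_scale (1 - r)); rewrite ?mem_head//; lra. Qed.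

(** Here [i^(p + q) <= k^max(p + q, 0)], and [max (p + q, 0) = p + 1 - min (p + 1, 1 - q)]: this is
    how [p + 1] enters the exponents of the rate. *)
Lemma power_weight_le i : (0 < i <= k)%N -> i%:R `^ p * lam i <= S * B.
Proof.
move=> ik; have [i0 ik'] := andP ik.
apply: le_trans (ler_wpM2l (powR_ge0 _ _) (power_level_le i0)) _.
rewrite mulrCA mulrC; apply: ler_wpM2r; first exact: ltW.
rewrite -natr_powRD//; apply: le_trans (powR_nat_le_max _ ik) _.
apply: (@powR_le_scale (Num.min (p + 1) (1 - q))); first by rewrite !inE eqxx !orbT.
by rewrite ge_max; apply/andP; split; case: (leP (p + 1) (1 - q)); lra.
Qed.

Lemma power_weight_sqr_le i : (0 < i <= k)%N ->
  i%:R `^ p * (gamma / i%:R `^ r) * lam i ^+ 2 <= gamma * S * B ^+ 2.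
Proof.
move=> ik; have [i0 ik'] := andP ik.
have l2 : lam i ^+ 2 <= B ^+ 2 * i%:R `^ (2 * q).
  rewrite -natr_powR_sqr -exprMn lerXn2r ?nnegrE ?(ltW (power_level_gt0 i))//.
    by rewrite mulr_ge0 ?powR_ge0// ltW.
  exact: power_level_le.
apply: le_trans (ler_wpM2l _ l2) _.
  by rewrite mulr_ge0 ?powR_ge0// divr_ge0 ?powR_ge0// ltW.
have -> : i%:R `^ p * (gamma / i%:R `^ r) * (B ^+ 2 * i%:R `^ (2 * q)) =
    gamma * i%:R `^ (p - r + 2 * q) * B ^+ 2 :> R.
  by rewrite natr_powRD// -natr_powR_sub//; ring.
apply: ler_wpM2r; first exact: sqr_ge0.
apply: ler_wpM2l; first exact: ltW.
apply: le_trans (powR_nat_le_max _ ik) _.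
apply: (@powR_le_scale (Num.min (p + 1) (r + 1 - 2 * q))); first by rewrite !inE eqxx !orbT.
by rewrite ge_max; apply/andP; split; case: (leP (p + 1) (r + 1 - 2 * q)); lra.
Qed.

Let pr0 : 0 < p + r. Proof. by case: adm => rp _ _ _; lra. Qed.

(** The natural exponent [p + 1 - x] of a sum may be nonpositive. It is then replaced by [p + r],
    which is positive and already accounted for by the term [1 / k^(1 - r)]; so no logarithm enters
    the rate. *)
Lemma powR_max_le_scale x : Num.min (p + 1) x \in rate_exponents p r q ->
  K `^ Num.max (p + 1 - x) (p + r) <= S.
Proof.
move=> xr; case: (leP (p + 1 - x) (p + r)) => h; first exact: powR_pr_le_scale.
apply: (powR_le_scale xr); case: (leP (p + 1) x); lra.
Qed.

Lemma power_sum_weight_le : \sum_(1 <= i < k.+1) (i%:R `^ p) ^+ 2 <=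
  (S * (1 / Num.min (2 * Num.max (p + 1 - 1 / 2) (p + r)) 1)) ^+ 2.
Proof.
under eq_bigr do rewrite natr_powR_sqr.
apply: sum_powR_sqr_dom => //.
- by rewrite lt_max pr0 orbT.
- by case: (leP (p + 1 - 1 / 2) (p + r)); lra.
- by apply: powR_max_le_scale; rewrite !inE eqxx !orbT.
Qed.

Lemma power_sum_clip_le :
  \sum_(1 <= i < k.+1) (i%:R `^ p * (gamma / i%:R `^ r) * lam i) ^+ 2 <=
  (gamma * S * (B * (1 / Num.min (2 * Num.max (p + 1 - (r + 1 / 2 - q)) (p + r)) 1))) ^+ 2.
Proof.
set z := 1 / _.
apply: (@le_trans _ _ (\sum_(1 <= i < k.+1) (gamma * B) ^+ 2 * i%:R `^ (2 * (p - r + q)))).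
  rewrite !big_nat; apply: ler_sum => i /andP[i0 _].
  rewrite -natr_powR_sqr -exprMn lerXn2r ?nnegrE//.
  - by rewrite !mulr_ge0 ?invr_ge0 ?powR_ge0 ?(ltW gamma0) ?(ltW (power_level_gt0 i)).
  - by rewrite !mulr_ge0 ?powR_ge0 ?(ltW gamma0) ?(ltW B0).
  have -> : gamma * B * i%:R `^ (p - r + q) = i%:R `^ p * (gamma / i%:R `^ r) * (B * i%:R `^ q).
    by rewrite natr_powRD// -natr_powR_sub//; ring.
  apply: ler_wpM2l; last exact: power_level_le.
  by rewrite mulr_ge0 ?powR_ge0// divr_ge0 ?powR_ge0// ltW.
rewrite -mulr_sumr.
have -> : (gamma * S * (B * z)) ^+ 2 = (gamma * B) ^+ 2 * (S * z) ^+ 2 by ring.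
apply: ler_wpM2l; first exact: sqr_ge0.
apply: sum_powR_sqr_dom => //.
- by rewrite lt_max pr0 orbT.
- by case: (leP (p + 1 - (r + 1 / 2 - q)) (p + r)); lra.
- by apply: powR_max_le_scale; rewrite !inE eqxx !orbT.
Qed.

Lemma power_mean_le (c m : R) : 0 <= c -> 0 <= m ->
  \sum_(1 <= i < k.+1) i%:R `^ p * (c / (4 * lam i) + gamma / i%:R `^ r / 2 * m) <=
    S * (c / beta * (1 / Num.min (Num.max (p + 1 - q) (p + r)) 1) +
         gamma / 2 * m * (1 / Num.min (Num.max (p + 1 - r) (p + r)) 1)).
Proof.
move=> c0 m0.
apply: (@le_trans _ _ (\sum_(1 <= i < k.+1) (c / beta * i%:R `^ (p - q) + gamma / 2 * m * i%:R `^ (p - r)))).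
  rewrite !big_nat; apply: ler_sum => i /andP[i0 _].
  have iq := @natr_powR_gt0 R i q i0.
  have h : c / (4 * lam i) <= c / (beta * i%:R `^ q).
    apply: ler_wpM2l => //; rewrite lef_pV2 ?posrE ?mulr_gt0 ?power_level_gt0//.
    have : beta * i%:R `^ q <= lam i by rewrite le_max lexx.
    have := power_level_gt0 i; lra.
  have := ler_wpM2l (@powR_ge0 R i%:R p) h.
  have -> : i%:R `^ p * (c / (beta * i%:R `^ q)) = c / beta * i%:R `^ (p - q).
    by rewrite -natr_powR_sub// invfM; ring.
  have -> : gamma / 2 * m * i%:R `^ (p - r) = i%:R `^ p * (gamma / i%:R `^ r / 2 * m).
    by rewrite -natr_powR_sub//; ring.
  by rewrite mulrDr lerD2r.
rewrite big_split/= -!mulr_sumr mulrDr; apply: lerD.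
  rewrite [leRHS]mulrCA; apply: ler_wpM2l; first by rewrite divr_ge0// ltW.
  apply: sum_powR_dom => //.
  - by rewrite lt_max pr0 orbT.
  - by case: (leP (p + 1 - q) (p + r)); lra.
  - by apply: powR_max_le_scale; rewrite !inE eqxx !orbT.
rewrite [leRHS]mulrCA; apply: ler_wpM2l.
  by rewrite mulr_ge0// divr_ge0// ltW.
apply: sum_powR_dom => //.
- by rewrite lt_max pr0 orbT.
- by case: (leP (p + 1 - r) (p + r)); lra.
- by apply: powR_max_le_scale; rewrite !inE eqxx !orbT.
Qed.

Lemma power_ratio_mono i : (0 < i)%N ->
  i%:R `^ p / (gamma / i%:R `^ r) <= i.+1%:R `^ p / (gamma / i.+1%:R `^ r).
Proof.
move=> i0; rewrite !invf_div [leLHS]mulrA [leRHS]mulrA -!natr_powRD// ler_pM2r ?invr_gt0//.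
by apply: powR_nat_mono; [rewrite i0/=|exact: ltW].
Qed.

Lemma power_ratio_le : K `^ p / (gamma / K `^ r) <= S / gamma.
Proof.
rewrite invf_div mulrA -natr_powRD//; apply: ler_wpM2r; first by rewrite invr_ge0 ltW.
exact: powR_pr_le_scale.
Qed.

End GeneralSchedule.

Lemma vcoef_ge0 {R : realType} (beta Leps p : R) (k : nat) :
  0 < beta -> 0 < Leps -> 0 <= vcoef beta Leps p k.
Proof.
move=> b0 l0; have mx : 0 <= Num.max beta (Leps / Num.sqrt k%:R).
  by rewrite le_max (ltW b0).
rewrite /vcoef; case: ifP => _; first by rewrite mulr_ge0 ?sqrtr_ge0.
case: ifP => _; first case: ifP => _; first exact: ltW.
  rewrite mulr_ge0 ?(ltW b0)// addr_ge0// divr_ge0 ?sqrtr_ge0//.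
  by rewrite divr_ge0 ?sqr_ge0.
by rewrite addr_ge0 ?mulr_ge0 ?divr_ge0 ?sqrtr_ge0 ?powR_ge0 ?(ltW l0).
Qed.

(** * The rate exponent and the theorem *)

Section RateExponent.
Context {R : realType}.
Implicit Types p r q : R.

Lemma rate_exponent_le_half p r q : rate_exponent p r q <= 1 / 2.
Proof. by rewrite /rate_exponent !ge_min lexx !orbT. Qed.

Lemma rate_exponent_half_attained :
  admissible (0 : R) (1 / 2) (1 / 2) /\ rate_exponent (0 : R) (1 / 2) (1 / 2) = 1 / 2.
Proof.
split; first by split; [lra|apply/andP; split; lra|apply/andP; split; lra|lra].
apply/eqP; rewrite eq_le rate_exponent_le_half /rate_exponent !le_min.
by do ![apply/andP; split] => //; lra.
Qed.

(** The value 1/2 is an upper bound, attained at [p = 0]. Reaching it forces [r], [1 - r], [q] and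
    [1 - q] to be at least 1/2; conversely [p > - r = - 1/2] gives [p + 1 > 1/2]. *)
Lemma rate_exponent_optimal p r q : admissible p r q ->
  (forall p' r' q', admissible p' r' q' -> rate_exponent p' r' q' <= rate_exponent p r q)
  <-> r = 1 / 2 /\ q = 1 / 2.
Proof.
move=> [rp _ _ _]; split=> [opt|[rE qE] p' r' q' _].
  have [adm0 e0] := rate_exponent_half_attained.
  have := opt _ _ _ adm0; rewrite e0 /rate_exponent !le_min.
  by move=> /andP[h1 /andP[_ /andP[h2 /andP[_ /andP[_ /andP[_ /andP[h3 h4]]]]]]]; split; lra.
apply: le_trans (rate_exponent_le_half _ _ _) _; rewrite /rate_exponent !le_min.
rewrite {}rE {}qE in rp *.
by do ![apply/andP; split] => //; lra.
Qed.

End RateExponent.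


Theorem theorem2
  (R : realType) (H : completeNormedModType R) (dot : {dot H for idfun})
  (dotE : forall x : H, dot x x = `|x| ^+ 2)
  (X : set H) (X0 : X !=set0) (Xclosed : closed X) (Xconvex : convex_set X)
  (Xbounded : bounded_set X)
  (f : H -> R) (L : R) (L0 : 0 < L) (fconvex : convex_function [set: H] f)
  (flipschitz : L.-lipschitz f)
  (d d' : measure_display) (T : measurableType d) (Z : measurableType d')
  (P : probability T R) (xi : {RV P >-> Z})
  (uh : H -> Z -> H) (sigma : R) (sigma0 : 0 <= sigma)
  (uh_measurable : jointly_measurable X uh)
  (uh_integrable : forall x, X x -> bochner_integrable P (uh x \o xi))
  (uh_subgradient : forall x, X x ->
    subdifferential dot f x (bochner_expectation P (uh x \o xi)))
  (uh_variance : forall x, X x ->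
    (\int[P]_t (`|uh x (xi t) - bochner_expectation P (uh x \o xi)| ^+ 2)%:E
       <= (sigma ^+ 2)%:E)%E)
  (m : nat) (m0 : (0 < m)%N) (xis : nat -> 'I_m -> {RV P >-> Z})
  (xis_law : forall k j, (0 < k)%N -> same_law (xis k j) xi)
  (xis_independent : mutually_independent P
    [set kj : nat * 'I_m | (0 < kj.1)%N] (fun kj => xis kj.1 kj.2 : T -> Z))
  (x1 : H) (Xx1 : X x1)
  (gamma beta eps delta : R)
  (gamma0 : 0 < gamma) (beta0 : 0 < beta) (eps0 : 0 < eps)
  (delta0 : 0 < delta) (delta2e : delta <= 2 / expR 1) :
  let D := diameter X in
  let Leps := (1 + eps) * L in
  let w (p : R) (k : nat) : R := k%:R `^ p in
  let gam (r : R) (k : nat) : R := gamma / k%:R `^ r in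
  let lam (q : R) (k : nat) : R := Num.max (beta * k%:R `^ q) ((1 + eps) * L) in
  let generated g l x := cssgm X uh xis g l x1 x in
  let err p x (k : nat) (t : T) : R := f (average (w p) x k t) - min_over f X in
  let logd := ln (2 / delta) in
  let M := sigma ^+ 2 / m%:R in
  [/\ (* infinite-horizon convergence and rate *)
      forall (p r q : R) (x : nat -> T -> H), generated (gam r) (lam q) x ->
        admissible p r q ->
        cvg_high_probability P (err p x) /\
        exists C : R, forall k, (0 < k)%N ->
          ((1 - delta)%:E < P [set t | (err p x k t <= C * rate p r q k)%R])%E,

      (* optimal choices of r and q *)
      forall p r q : R, admissible p r q ->
        (forall p' r' q' : R, admissible p' r' q' ->
          rate_exponent p' r' q' <= rate_exponent p r q)
        <-> r = 1 / 2 /\ q = 1 / 2,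

      (* (i) *)
      forall (p : R) (x : nat -> T -> H), - (1 / 2) < p ->
        generated (gam (1 / 2)) (lam (1 / 2)) x ->
        forall k, (0 < k)%N ->
        let K : R := k%:R in
        ((1 - delta)%:E <= P [set t | (err p x k t <=
          Num.max (p + 1) 1 / Num.sqrt K *
          (D ^+ 2 / (2 * gamma)
           + 2 / 3 * (2 * D * Num.max beta
                                (Leps / K `^ Num.min (p + 1 / 2) (1 / 2))
                      + gamma * Num.max (beta ^+ 2)
                                (Leps ^+ 2 / K `^ Num.min (p + 1 / 2) 1)) * logd
           + 1 / Num.sqrt 2 *
             (4 * (1 + 1 / eps) * (D * sigma / Num.sqrt m%:R)
                * (1 / Num.min (2 * p + 1) 1)
              + gamma * vcoef beta Leps p k * Num.sqrt (M + L ^+ 2))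
             * Num.sqrt logd
           + 1 / Num.min (p + 1 / 2) 1 *
             (D * sigma ^+ 2 / m%:R * (1 + 1 / eps) * (1 / beta)
              + gamma / 2 * (M + L ^+ 2))))%R])%E,

      (* (ii) *)
      forall x : nat -> T -> H,
        generated (gam (1 / 2)) (lam (1 / 2)) x ->
        forall k, (0 < k)%N ->
        let K : R := k%:R in
        let u := Num.sqrt 2 * Leps + beta * (1 + ln K) in
        ((1 - delta)%:E <= P [set t | (err (- (1 / 2)) x k t <=
          3 / 2 * (1 / Num.sqrt K) *
          (D ^+ 2 / (2 * gamma)
           + 2 / 3 * (2 * D * Num.max beta Leps
                      + gamma * Num.max (beta ^+ 2) (Leps ^+ 2)) * logd
           + 1 / Num.sqrt 2 *
             (4 * (1 + 1 / eps) * (D * sigma / Num.sqrt m%:R) * (1 + ln K)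
              + gamma * u * Num.sqrt (M + L ^+ 2))
             * Num.sqrt logd
           + (D * sigma ^+ 2 / m%:R * (1 + 1 / eps) * (1 / beta)
              + gamma / 2 * (M + L ^+ 2)) * (1 + ln K)))%R])%E &

      (* (iii) finite horizon *)
      forall (p : R) (k : nat) (x : nat -> T -> H), 0 <= p -> (0 < k)%N ->
        generated (fun=> gamma / Num.sqrt k%:R)
          (fun i => Num.max (beta * Num.sqrt i%:R) ((1 + eps) * L)) x ->
        let K : R := k%:R in
        let y := Num.sqrt 2 * Num.max beta (Leps / Num.sqrt K) in
        ((1 - delta)%:E <= P [set t | (err p x k t <=
          (p + 1) / Num.sqrt K *
          (D ^+ 2 / (2 * gamma)
           + 2 / 3 * (2 * D * Num.max beta (Leps / Num.sqrt K)
                      + gamma * Num.max (beta ^+ 2) (Leps ^+ 2 / K)) * logd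
           + 1 / Num.sqrt 2 *
             (4 * (1 + 1 / eps) * (D * sigma / Num.sqrt m%:R)
              + gamma * y * Num.sqrt (M + L ^+ 2))
             * Num.sqrt logd
           + 1 / Num.min (p + 1 / 2) 1 *
             (D * sigma ^+ 2 / m%:R) * (1 + 1 / eps) * (1 / beta)
           + gamma / 2 * (M + L ^+ 2)))%R])%E].

Proof.
move=> D Leps w gam lam generated err logd M.
have fL x y : `|f x - f y| <= L * `|x - y| by exact: (flipschitz (x, y)).
have [xs Xxs fxs] := min_over_attained dotE X0 Xclosed Xconvex Xbounded fconvex fL.
have XD x y : X x -> X y -> `|x - y| <= D by exact: diameterP.
have D0 : 0 <= D := diameter_ge0 X0 Xbounded.
have Leps0 : 0 < Leps by rewrite mulr_gt0// addr_gt0.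
have M0 : 0 <= M by rewrite divr_ge0 ?sqr_ge0.
have c0 : 0 <= D * M * (1 + 1 / eps).
  by rewrite mulr_ge0 ?mulr_ge0// addr_ge0// divr_ge0// ltW.
have m0' : 0 <= M + L ^+ 2 by rewrite addr_ge0 ?sqr_ge0.
have rest0 (a : R) : 0 < a -> 0 <= 1 / Num.min a 1 by move=> a0; exact: le_trans ler01 (ge1_inv_min a0).
have logd_gt0 (e : R) : 0 < e -> e <= 2 / expR 1 -> 0 < ln (2 / e).
  move=> e0 e2; rewrite ln_gt0// ltr_pdivlMr// mul1r (le_lt_trans e2)//.
  by rewrite ltr_pdivrMr ?expR_gt0// ltr_pMr// expR_gt1.
(* With [l = ln (2 / e)] the one-sided tail has probability at most [e / 2]; the spare half gives
   the strict inequality of the rate. *)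
have expN (e : R) : 0 < e -> expR (- ln (2 / e)) = e / 2.
  by move=> e0; rewrite expRN lnK ?posrE ?divr_gt0// invf_div.
have half (e : R) : 0 < e -> 1 - e <= 1 - e / 2 by move=> e0; lra.
have w0 p k : (0 < k)%N -> 0 < w p k by exact: natr_powR_gt0.
have gam0 r k : (0 < k)%N -> 0 < gam r k by move=> k0; rewrite divr_gt0 ?natr_powR_gt0.
have lamL q k : (0 < k)%N -> (1 + eps) * L <= lam q k by rewrite le_max lexx orbT.
pose RB := @rate_bound _ _ _ dotE _ _ _ _ _ _ _ _ _ uh_measurable uh_integrable uh_variance
  _ _ m0 xis_law xis_independent _ _ _ _ _ L0 fL uh_subgradient XD Xxs eps0 Xclosed Xconvex
  Xbounded fconvex.
have meanE (a g l : R) : step_mean sigma m L D eps a g l =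
    a * (D * M * (1 + 1 / eps) / (4 * l) + g / 2 * (M + L ^+ 2)) by [].
have cE : D * sigma ^+ 2 / m%:R * (1 + 1 / eps) = D * M * (1 + 1 / eps).
  by rewrite /M mulrA.
have rest_ge0 : 0 <= D * M * (1 + 1 / eps) * (1 / beta) + gamma / 2 * (M + L ^+ 2).
  by rewrite addr_ge0// mulr_ge0// divr_ge0// ltW.
have scaleE p k : (0 < k)%N -> k%:R `^ (p + 1 / 2) * Num.sqrt k%:R = k%:R `^ (p + 1) :> R.
  by move=> k0; rewrite natr_sqrt -natr_powRD//; congr (_ `^ _); field.
(* Stated for every confidence parameter [e], since convergence in high probability quantifies over
   its own. *)
have bound_rate p r q x e : generated (gam r) (lam q) x -> admissible p r q ->
    0 < e -> e <= 2 / expR 1 -> exists C : R, forall k, (0 < k)%N ->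
    ((1 - e / 2)%:E <= P [set t | (err p x k t <= C * rate p r q k)%R])%E.
  move=> gen adm e0 e2; have [rp r01 q01 qr] := adm.
  have pr0 : 0 < p + r by lra.
  have p1 : -1 < p by have [_ r1] := andP r01; lra.
  have B0 : 0 < beta + Leps by exact: addr_gt0.
  have max_gt0 a : 0 < Num.max a (p + r) by rewrite lt_max pr0 orbT.
  pose n1 := 1 / Num.min (2 * Num.max (p + 1 - 1 / 2) (p + r)) 1.
  pose n2 := (beta + Leps) * (1 / Num.min (2 * Num.max (p + 1 - (r + 1 / 2 - q)) (p + r)) 1).
  pose rest := D * M * (1 + 1 / eps) / beta * (1 / Num.min (Num.max (p + 1 - q) (p + r)) 1) +
         gamma / 2 * (M + L ^+ 2) * (1 / Num.min (Num.max (p + 1 - r) (p + r)) 1).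
  exists (Num.max (p + 1) 1 * (D ^+ 2 / (2 * gamma)
     + 2 / 3 * (2 * D * (beta + Leps) + gamma * (beta + Leps) ^+ 2) * ln (2 / e)
     + 1 / Num.sqrt 2 * (4 * (1 + 1 / eps) * (D * sigma / Num.sqrt m%:R) * n1
         + gamma * n2 * Num.sqrt (M + L ^+ 2)) * Num.sqrt (ln (2 / e)) + rest)) => k k0.
  rewrite /err -fxs mulrAC -expN//.
  (* The scale is [k^(p + 1) * rate]. As [k^(p + 1)] is at most [max (p + 1, 1)] times the sum of
     the weights, [T0] is [max (p + 1, 1) * rate]. *)
  apply: (RB _ _ _ _ _ Xx1 (w0 p) (gam0 r) (lamL q) gen k (ln (2 / e)) gamma
    (k%:R `^ (p + 1) * rate p r q k)) => //.
  + exact: logd_gt0.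
  + exact: scale_gt0.
  + by apply: rest0; rewrite mulr_gt0.
  + by rewrite mulr_ge0 ?(ltW B0)// rest0// mulr_gt0.
  + rewrite addr_ge0// mulr_ge0 ?rest0//; first by rewrite divr_ge0// ltW.
    by rewrite mulr_ge0// divr_ge0// ltW.
  + move=> i /andP[i0 _]; exact: (power_ratio_mono gamma0 adm).
  + exact: (power_ratio_le p r q gamma0 k0).
  + by move=> i ik; exact: (power_weight_le beta0 Leps0 adm).
  + by move=> i ik; exact: (power_weight_sqr_le beta0 Leps0 gamma0 adm).
  + exact: (power_sum_weight_le adm k0).
  + exact: (power_sum_clip_le beta0 Leps0 gamma0 adm k0).
  + exact: (power_mean_le beta0 Leps0 gamma0 adm k0 c0 m0').
  + rewrite mulrAC; apply: ler_wpM2r; first exact/ltW/rate_gt0.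
    exact: sum_powR_ge.
split.
- move=> p r q x gen adm; split.
    move=> e e0 e2; have [C CP] := bound_rate p r q x e gen adm e0 e2.
    exists (fun k => C * rate p r q k); split.
      by have := cvgM (cvg_cst C) (rate_cvg0 adm); rewrite mulr0; exact.
    by move=> k k0; apply: le_trans (CP k k0); rewrite lee_fin half.
  have [C CP] := bound_rate p r q x delta gen adm delta0 delta2e.
  exists C => k k0; apply: lt_le_trans (CP k k0); rewrite lte_fin; move: delta0; lra.
- exact: rate_exponent_optimal.
- move=> p x p12 gen k k0; cbv zeta; set K : R := k%:R.
  have s0 : 0 < Num.sqrt K by rewrite sqrtr_gt0 ltr0n.
  have p120 : 0 < p + 1 / 2 by lra.
  apply: (@le_trans _ _ ((1 - expR (- logd))%:E)); first by rewrite expN// lee_fin half.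
  rewrite /err -fxs cE.
  (* The scale [k^(p + 1/2)] is [gamma w_k / gam_k]; divided by the sum of the weights it gives the
     order [1 / sqrt k]. *)
  apply: (RB _ _ _ _ _ Xx1 (w0 p) (gam0 (1 / 2)) (lamL (1 / 2)) gen k logd gamma (K `^ (p + 1 / 2))) => //.
  + exact: logd_gt0.
  + exact: natr_powR_gt0.
  + by apply: rest0; lra.
  + exact: vcoef_ge0.
  + by rewrite mulr_ge0 ?rest0.
  + by move=> i /andP[i0 _]; apply: weight_step_ratio_mono => //; exact: ltW.
  + by rewrite [leLHS]weight_step_ratioE.
  + by move=> i ik; apply: weight_clip_le => //; exact: ltW.
  + by move=> i ik; apply: weight_clip_sqr_le => //; exact: ltW.
  + exact: sum_powR_sqr_le.
  + apply: (@le_trans _ _ (gamma ^+ 2 * \sum_(1 <= i < k.+1) i%:R `^ (2 * p - 1) *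
        clip_level beta Leps i ^+ 2)).
      rewrite mulr_sumr !big_nat; apply: ler_sum => i /andP[i0 _].
      by rewrite -weight_gam_clip_sqrE.
    rewrite -[X in _ <= X ^+ 2](mulrA gamma) [leRHS]exprMn; apply: ler_wpM2l; first exact: sqr_ge0.
    exact: sum_clip_level_vcoef.
  + apply: (@le_trans _ _ (\sum_(1 <= i < k.+1) i%:R `^ (p - 1 / 2) *
        (D * M * (1 + 1 / eps) * (1 / beta) + gamma / 2 * (M + L ^+ 2)))).
      rewrite !big_nat; apply: ler_sum => i /andP[i0 _]; rewrite meanE.
      exact: (mean_term_le gamma beta0 Leps0 p i0 c0 m0').
    rewrite -mulr_suml [leRHS]mulrA; apply: ler_wpM2r => //.
    have := sum_powR_le k p120; have -> : p + 1 / 2 - 1 = p - 1 / 2 by field.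
    by rewrite [1 / Num.min _ _]div1r.
  + rewrite mulrAC ler_pdivlMr// scaleE//; apply: sum_powR_ge; lra.
- move=> x gen k k0; cbv zeta; set K : R := k%:R.
  have s0 : 0 < Num.sqrt K by rewrite sqrtr_gt0 ltr0n.
  have l0 : 0 <= ln K by rewrite ln_ge0// ler1n.
  have l1 : 0 <= 1 + ln K by rewrite addr_ge0.
  have p0 : - (1 / 2) + 1 / 2 = 0 :> R by rewrite addNr.
  have Kp : K `^ (- (1 / 2) + 1 / 2) = 1 by rewrite p0 powRr0.
  have min12 : Num.min (- (1 / 2) + 1 / 2) (1 / 2) = 0 :> R by rewrite p0 min_l.
  have min1 : Num.min (- (1 / 2) + 1 / 2) 1 = 0 :> R by rewrite p0 min_l.
  apply: (@le_trans _ _ ((1 - expR (- logd))%:E)); first by rewrite expN// lee_fin half.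
  rewrite /err -fxs cE.
  (* At [p = - 1/2] the scale [k^(p + 1/2)] is 1, and growth in [k] survives only as [1 + ln k]. *)
  apply: (RB _ _ _ _ _ Xx1 (w0 (- (1 / 2))) (gam0 (1 / 2)) (lamL (1 / 2)) gen k logd gamma 1) => //.
  + exact: logd_gt0.
  + by apply: addr_ge0; apply: mulr_ge0; rewrite ?sqrtr_ge0// ltW.
  + by rewrite mulr_ge0.
  + by move=> i /andP[i0 _]; exact: weight_step_ratio_mono.
  + by rewrite [leLHS]weight_step_ratioE// Kp.
  + move=> i ik; have := weight_clip_le beta0 Leps0 (lexx (- (1 / 2))) ik.
    by rewrite Kp min12 powRr0 divr1.
  + move=> i ik; have := weight_clip_sqr_le beta0 Leps0 gamma0 (lexx (- (1 / 2))) ik.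
    by rewrite Kp min1 powRr0 divr1.
  + rewrite [X in _ <= X ^+ 2]mul1r; apply: (@le_trans _ _ (1 + ln K)); last by rewrite expr2 ler_peMr ?lerDl.
    apply: le_trans (@sum_inv_le_ln R k k0); rewrite le_eqVlt; apply/orP; left; apply/eqP.
    by apply: eq_bigr => i _; rewrite natr_powR_sqr mulrN div1r divff// powRN1_nat.
  + apply: (@le_trans _ _ (gamma ^+ 2 * \sum_(1 <= i < k.+1) i%:R `^ (- 2) *
        clip_level beta Leps i ^+ 2)).
      rewrite mulr_sumr !big_nat; apply: ler_sum => i /andP[i0 _].
      rewrite [leLHS](weight_gam_clip_sqrE beta Leps gamma _ i0).
      have -> // : 2 * - (1 / 2) - 1 = - 2 :> R by field.
    rewrite [X in _ <= (X * _) ^+ 2]mulr1 [leRHS]exprMn; apply: ler_wpM2l; first exact: sqr_ge0.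
    exact: (sum_clip_level_log beta0 Leps0 k0).
  + apply: (@le_trans _ _ (\sum_(1 <= i < k.+1) i%:R `^ (- (1 / 2) - 1 / 2) *
        (D * M * (1 + 1 / eps) * (1 / beta) + gamma / 2 * (M + L ^+ 2)))).
      rewrite !big_nat; apply: ler_sum => i /andP[i0 _]; rewrite meanE.
      exact: (mean_term_le gamma beta0 Leps0 (- (1 / 2)) i0 c0 m0').
    rewrite -mulr_suml [leRHS]mul1r [leLHS]mulrC; apply: ler_wpM2l => //.
    apply: le_trans (@sum_inv_le_ln R k k0); rewrite le_eqVlt; apply/orP; left; apply/eqP.
    apply: eq_bigr => i _; have -> : - (1 / 2) - 1 / 2 = -1 :> R by field.
    by rewrite powRN1_nat.
  + rewrite [1 / Num.sqrt K]div1r mulrAC ler_pdivlMr// [leLHS]mul1r.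
    have p1 : -1 < - (1 / 2) :> R by lra.
    have := sum_powR_ge k p1; have -> : - (1 / 2) + 1 = 1 / 2 :> R by field.
    rewrite -natr_sqrt max_r; last lra.
    rewrite mul1r => h; apply: le_trans h _; apply: ler_peMl; last lra.
    by apply: sumr_ge0 => i _; exact: powR_ge0.
- move=> p k x p0 k0 gen; cbv zeta; set K : R := k%:R.
  have s0 : 0 < Num.sqrt K by rewrite sqrtr_gt0 ltr0n.
  have p12 : - (1 / 2) < p by lra.
  have p120 : 0 < p + 1 / 2 by lra.
  have g0 i : (0 < i)%N -> 0 < gamma / Num.sqrt K by rewrite divr_gt0.
  have lamE : (fun i => Num.max (beta * Num.sqrt i%:R) ((1 + eps) * L)) = clip_level beta Leps.
    by apply/funext => i; rewrite natr_sqrt.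
  rewrite lamE in gen.
  have lL i : (0 < i)%N -> (1 + eps) * L <= clip_level beta Leps i.
    by rewrite le_max lexx orbT.
  have minp : Num.min (p + 1 / 2) (1 / 2) = 1 / 2 by rewrite min_r//; lra.
  have minp1 : Num.min (2 * p + 1) 1 = 1 by rewrite min_r//; lra.
  apply: (@le_trans _ _ ((1 - expR (- logd))%:E)); first by rewrite expN// lee_fin half.
  rewrite /err -fxs.
  set n2 := Num.sqrt 2 * _.
  have n20 : 0 <= n2 by rewrite mulr_ge0 ?sqrtr_ge0// le_max (ltW beta0).
  set rest := 1 / Num.min (p + 1 / 2) 1 * (D * M * (1 + 1 / eps) * (1 / beta)) +
    gamma / 2 * (M + L ^+ 2).
  have rest_nneg : 0 <= rest.
    apply: addr_ge0; last by rewrite mulr_ge0// divr_ge0// ltW.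
    apply: mulr_ge0; first exact: rest0.
    by rewrite mulr_ge0// divr_ge0// ltW.
  have B := RB _ _ _ _ _ Xx1 (w0 p) g0 lL gen k logd gamma (K `^ (p + 1 / 2))
    ((p + 1) / Num.sqrt K) (Num.max beta (Leps / Num.sqrt K)) (Num.max (beta ^+ 2) (Leps ^+ 2 / K)) 1 n2 rest.
  apply: le_trans (B _ _ _ _ _ _ _ _ _ _ _ _ _ _ _ _) _ => //.
  + exact: logd_gt0.
  + exact: natr_powR_gt0.
  + move=> i /andP[i0 ik]; apply: ler_wpM2r; first by rewrite invr_ge0 ltW ?(g0 i).
    by apply: powR_nat_mono => //; rewrite i0/=.
  + rewrite natr_powRD// -natr_sqrt invf_div.
    by rewrite mulrA.
  + move=> i ik; have := weight_clip_le beta0 Leps0 (ltW p12) ik.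
    by rewrite minp -natr_sqrt.
  + by move=> i ik; exact: horizon_clip_sqr_le.
  + by have := sum_powR_sqr_le k p12; rewrite minp1 divr1.
  + exact: horizon_sum_clip_le.
  + exact: (horizon_mean_le beta0 Leps0 gamma0 p0 k0 c0 m0').
  + rewrite mulrAC ler_pdivlMr// scaleE//.
    have p1 : -1 < p by lra.
    by have := sum_powR_ge k p1; rewrite [Num.max _ 1]max_l//; lra.
  rewrite le_eqVlt; apply/orP; left; apply/eqP; congr (P _); apply/funext => t.
  by congr (is_true (_ <= _)); rewrite /rest /M; ring.
Qed.
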